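(* Let $\tau$ be a finite relational vocabulary and let $\varphi$ be a fixed first-order formula over $\tau$, evaluated under team semantics. Then the problem $\mathrm{WT}_\varphi$ (given a finite $\tau$-structure $\mathcal{A}$ and $k\in\mathbb N$, decide whether there is a team $T$ with domain $\mathrm{Fr}(\varphi)$ such that $|T|=k$ and $\mathcal{A},T\models\varphi$) is in DLOGTIME-uniform $\mathrm{TC}^0$.
   Context: $\mathrm{Fr}(\varphi)$ denotes the set of free variables of $\varphi$. An assignment is a map $s\colon X\to A$ from a set $X$ of variables into the domain $A$ of $\mathcal{A}$; a team with domain $X$ is a set of such assignments. For first-order formulas (in negation normal form) team semantics is defined by: atomic and negated atomic formulas hold in $T$ iff they hold (in the usual Tarskian sense) under every $s\in T$; $\mathcal{A},T\models\varphi_0\wedge\varphi_1$ iff both hold in $T$; $\mathcal{A},T\models\varphi_0\vee\varphi_1$ iff $T=T_0\cup T_1$ with $\mathcal{A},T_i\models\varphi_i$ for $i=0,1$; $\mathcal{A},T\models\exists x\varphi$ iff $\mathcal{A},T^x_f\models\varphi$ for some $f\colon T\to\mathcal P(A)\setminus\{\emptyset\}$, where $T^x_f=\{s[x\mapsto a]: s\in T, a\in f(s)\}$; $\mathcal{A},T\models\forall x\varphi$ iff $\mathcal{A},T^x_A\models\varphi$ where $T^x_A=\{s[x\mapsto a]: s\in T,a\in A\}$. Here $\varphi$ is fixed and the input is $(\mathcal{A},k)$. *)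

(* Defs.v *)
(** World: MathComp (boot + finmap).

    All numbers are written in binary, least significant digit first, without
    superfluous zeros; 0 is the empty string. *)
From mathcomp Require Import all_boot finmap.
Set Implicit Arguments.
Unset Strict Implicit.
Unset Printing Implicit Defensive.

Local Open Scope fset_scope.
Local Open Scope fmap_scope.

Definition binary (n : nat) : seq bool :=
  mkseq (fun i => odd (n %/ 2 ^ i)) (up_log 2 n.+1).

(** * Random access Turing machines and DLOGTIME *)

Inductive dir := Left | Stay | Right.

(** A one-way infinite tape: written part and head position.  Beyond the
    written part, and wherever [None] stands, the tape is blank. *)
Definition tape (G : finType) : Type := (seq (option G) * nat)%type.

Definition tape_read (G : finType) (t : tape G) : option G := nth None t.1 t.2.

Definition tape_act (G : finType) (t : tape G) (a : option G * dir) : tape G :=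
  (set_nth None t.1 t.2 a.1,
   match a.2 with Left => t.2.-1 | Stay => t.2 | Right => t.2.+1 end).

(** Tape [ord0] is the address tape, the others are work tapes.  There is no
    head on the input: each transition sees the input letter whose position
    (from 0) is on the address tape, or [None] if there is no such position.
    [rdigit] says which symbols stand for the digit 1 on the address tape. *)
Record ratm (S : finType) := Ratm {
  rstate : finType;
  rsym : finType;
  rwork : nat;
  rdigit : pred rsym;
  rstart : rstate;
  raccept : rstate;
  rreject : rstate;
  rdelta : rstate -> option S -> ('I_rwork.+1 -> option rsym) ->
           rstate * ('I_rwork.+1 -> option rsym * dir)
}.

Section Run.
Variables (S : finType) (M : ratm S) (w : seq S).

Definition rconf : Type := (rstate M * ('I_(rwork M).+1 -> tape (rsym M)))%type.

Definition raddress (t : tape (rsym M)) : nat :=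
  \sum_(i < size t.1)
     (if nth None t.1 i is Some a then rdigit a else false) * 2 ^ i.

Definition rstep (c : rconf) : rconf :=
  if (c.1 == raccept M) || (c.1 == rreject M) then c else
  let: (q, act) := rdelta c.1 (onth w (raddress (c.2 ord0)))
                              (fun j => tape_read (c.2 j)) in
  (q, fun j => tape_act (c.2 j) (act j)).

Definition rinit : rconf := (rstart M, fun _ => ([::], 0)).

Definition rrun (t : nat) : rconf := iter t rstep rinit.

End Run.

Definition DLOGTIME (S : finType) (L : seq S -> Prop) : Prop :=
  exists (M : ratm S) (c : nat),
    raccept M != rreject M /\
    forall w : seq S,
      let q := (rrun M w (c * (trunc_log 2 (size w)).+1)).1 in
      (L w -> q = raccept M) /\ (~ L w -> q = rreject M).

(** * Circuits and DLOGTIME-uniform TC0 *)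

(** Gates of fan-in 0 serve as constants. *)
Inductive gate := Input of nat | Not | And | Or | Maj.

(** [cedge g h] means that [h] is a child of [g], that is, the output of [h] is
    fed into [g].  Gate [ord0] is the output gate. *)
Record circuit := Circuit {
  cmax : nat;
  clabel : 'I_cmax.+1 -> gate;
  cedge : rel 'I_cmax.+1
}.

Definition csize (C : circuit) : nat := (cmax C).+1.

Definition circuit_wf (n : nat) (C : circuit) : Prop :=
  forall g : 'I_(cmax C).+1,
    match clabel g with
    | Input i => i < n /\ #|[set h | cedge g h]| = 0
    | Not => #|[set h | cedge g h]| = 1
    | _ => True
    end.

(** In particular a circuit satisfying this is acyclic. *)
Definition depth_at_most (d : nat) (C : circuit) : Prop :=
  forall (g : 'I_(cmax C).+1) (p : seq 'I_(cmax C).+1),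
    path (@cedge C) g p -> size p <= d.

Fixpoint gate_value (C : circuit) (x : seq bool) (fuel : nat)
    (g : 'I_(cmax C).+1) : bool :=
  if fuel is f.+1 then
    match clabel g with
    | Input i => nth false x i
    | Not => [forall (h | cedge g h), ~~ gate_value x f h]
    | And => [forall (h | cedge g h), gate_value x f h]
    | Or => [exists (h | cedge g h), gate_value x f h]
    | Maj => #|[set h | cedge g h]|
               < 2 * #|[set h | cedge g h && gate_value x f h]|
    end
  else false.

(** In an acyclic circuit no path visits more than [csize C] gates, so the fuel
    never runs out. *)
Definition circuit_value (C : circuit) (x : seq bool) : bool :=
  gate_value x (csize C) (@ord0 (cmax C)).

Definition gate_tag (l : gate) : nat :=
  match l with Not => 0 | And => 1 | Or => 2 | Maj => 3 | Input _ => 4 end.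

Definition gate_arg (l : gate) : nat := if l is Input i then i else 0.

Definition wire_tag : nat := 5.

(** The word t#a#b#y over the alphabet {0,1,#}, with [None] as #. *)
Definition dc_word (t a b : nat) (y : seq (option bool)) : seq (option bool) :=
  map Some (binary t) ++ None :: map Some (binary a) ++
  None :: map Some (binary b) ++ None :: y.

(** The direct connection language.  The arbitrary string [y] only supplies the
    input length, [n = size y]; it ranges over all words, since a logarithmic
    time machine could not check any condition on its letters.  Besides the
    wires the language lists the label of every gate, as wires alone would not
    determine the labels of gates of fan-in 0. *)
Definition direct_connection (C : nat -> circuit) (w : seq (option bool))
    : Prop :=
  exists (y : seq (option bool)) (g : 'I_(cmax (C (size y))).+1),
    w = dc_word (gate_tag (clabel g)) g (gate_arg (clabel g)) y \/
    exists2 h : 'I_(cmax (C (size y))).+1,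
      cedge g h & w = dc_word wire_tag g h y.

Definition DLOGTIME_uniform_TC0 (L : seq bool -> Prop) : Prop :=
  exists C : nat -> circuit,
    [/\ DLOGTIME (direct_connection C),
        forall n, circuit_wf n (C n),
        exists d, forall n, depth_at_most d (C n),
        exists c, forall n, csize (C n) <= n ^ c + c
      & forall x : seq bool, circuit_value (C (size x)) x <-> L x].

(** * First-order logic under team semantics *)

Record vocabulary := Vocabulary {
  nrel : nat;
  arity : 'I_nrel -> nat
}.

(** Formulas in negation normal form; variables are natural numbers. *)
Inductive formula (tau : vocabulary) :=
| FEq of nat & nat
| FNeq of nat & nat
| FRel (R : 'I_(nrel tau)) of (arity R).-tuple nat
| FNrel (R : 'I_(nrel tau)) of (arity R).-tuple nat
| FAnd of formula tau & formula tau
| FOr of formula tau & formula tau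
| FEx of nat & formula tau
| FAll of nat & formula tau.

Fixpoint Fr (tau : vocabulary) (phi : formula tau) : {fset nat} :=
  match phi with
  | FEq x y | FNeq x y => [fset x; y]
  | FRel _ xs | FNrel _ xs => [fset x in (xs : seq nat)]
  | FAnd p q | FOr p q => Fr p `|` Fr q
  | FEx x p | FAll x p => Fr p `\ x
  end.

Record structure (tau : vocabulary) (A : finType) := Structure {
  interp : forall R : 'I_(nrel tau), {set (arity R).-tuple A}
}.

(** An assignment with domain [X] is a finite map [s] with [domf s = X]. *)
Definition assignment (A : finType) := {fmap nat -> A}.

Section TeamSemantics.
Variables (tau : vocabulary) (A : finType) (St : structure tau A).

(** Meant for assignments defined on all variables in the atom. *)
Definition eq_holds (s : assignment A) (x y : nat) : bool := s.[? x] == s.[? y].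

Definition rel_holds (s : assignment A) (R : 'I_(nrel tau))
    (xs : (arity R).-tuple nat) : bool :=
  [exists a in interp St R, [forall i, s.[? tnth xs i] == Some (tnth a i)]].

Definition team_ext (T : {fset assignment A}) (x : nat)
    (f : assignment A -> {set A}) : {fset assignment A} :=
  [fset s.[x <- a] | s in T, a in f s].

Fixpoint team_sat (T : {fset assignment A}) (phi : formula tau) : Prop :=
  match phi with
  | FEq x y => forall s, s \in T -> eq_holds s x y
  | FNeq x y => forall s, s \in T -> ~~ eq_holds s x y
  | FRel R xs => forall s, s \in T -> rel_holds s xs
  | FNrel R xs => forall s, s \in T -> ~~ rel_holds s xs
  | FAnd p q => team_sat T p /\ team_sat T q
  | FOr p q => exists T0 T1 : {fset assignment A},
      [/\ T = T0 `|` T1, team_sat T0 p & team_sat T1 q]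
  | FEx x p => exists f : assignment A -> {set A},
      (forall s, s \in T -> f s != set0) /\ team_sat (team_ext T x f) p
  | FAll x p => team_sat (team_ext T x (fun _ => setT)) p
  end.

Definition WT (phi : formula tau) (k : nat) : Prop :=
  exists T : {fset assignment A},
    [/\ forall s, s \in T -> domf s = Fr phi, #|` T| = k & team_sat T phi].

End TeamSemantics.

(** * Encoding of instances *)

(** The characteristic string of an r-ary relation on {0, ..., m}, the tuples
    being listed in lexicographic order. *)
Definition encode_rel (m r : nat) (R : {set r.-tuple 'I_m.+1}) : seq bool :=
  mkseq (fun j => [tuple inord (j %/ m.+1 ^ (r - i.+1) %% m.+1) | i < r] \in R)
        (m.+1 ^ r).

(** 0^n 1 enc(R_1) ... enc(R_p) bin(k), where n = m + 1 is the size of the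
    domain. *)
Definition encode (tau : vocabulary) (m : nat) (St : structure tau 'I_m.+1)
    (k : nat) : seq bool :=
  nseq m.+1 false ++ true ::
  flatten [seq encode_rel (interp St R) | R <- enum 'I_(nrel tau)] ++ binary k.

Definition WT_language (tau : vocabulary) (phi : formula tau) (w : seq bool)
    : Prop :=
  exists (m : nat) (St : structure tau 'I_m.+1) (k : nat),
    w = encode St k /\ WT St phi k.

(* Main.v *)
(** First-order team semantics is flat, so a team of size [k] exists if and only
    if at least [k] assignments satisfy the formula in the sense of Tarski.  With
    majority quantifiers over tuples one can count and hence multiply, so that
    first-order logic with these quantifiers can locate the relations in the
    input, evaluate the formula and compare [k], the number of triples
    (i, 2^i, z) with digit i of [k] set and z < 2^i, with the number of
    satisfying assignments.

    The gates for a sentence of this logic are its nodes together with values of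
    the variables, all below the least power of 2 exceeding the input length.
    The digits of the components of a gate are interleaved, so that one finite
    automaton, reading all components in parallel, decides the direct connection
    language.  A random access machine needs only logarithmic time to find the
    length of its input, to copy the two gate numbers to tapes, and to run this
    automaton. *)
From Stdlib Require Import FunctionalExtensionality.
From HB Require Import structures.
From mathcomp Require Import all_boot finmap zify.
Require Import Defs.
Set Implicit Arguments.
Unset Strict Implicit.
Unset Printing Implicit Defensive.

(** * Binary numbers *)

Definition bit (n i : nat) : bool := odd (n %/ 2 ^ i).

Fixpoint val2 (s : seq bool) : nat :=
  if s is b :: s' then b + (val2 s').*2 else 0.

Lemma bitS n i : bit n i.+1 = bit n./2 i.
Proof. by rewrite /bit expnS divnMA divn2. Qed.

Lemma bit0 n : bit n 0 = odd n.
Proof. by rewrite /bit divn1. Qed.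

Lemma bit0n i : bit 0 i = false.
Proof. by rewrite /bit div0n. Qed.

Lemma bit_small n i : n < 2 ^ i -> bit n i = false.
Proof. by move=> h; rewrite /bit divn_small. Qed.

Lemma bit_big n i j : n < 2 ^ i -> i <= j -> bit n j = false.
Proof. by move=> h ij; apply/bit_small/(leq_trans h); rewrite leq_pexp2l. Qed.

Lemma bit_inj a b : (forall i, bit a i = bit b i) -> a = b.
Proof.
elim/ltn_ind: a b => a IH b h.
have h0 : odd a = odd b by rewrite -!bit0 h.
have hS i : bit a./2 i = bit b./2 i by rewrite -!bitS h.
case: (posnP a) => [a0|a0].
  rewrite a0; apply/eqP; rewrite eq_sym; apply/negPn/negP; rewrite -lt0n => b0.
  have: bit b (trunc_log 2 b) = bit a (trunc_log 2 b) by [].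
  rewrite a0 bit0n /bit.
  suff -> : b %/ 2 ^ trunc_log 2 b = 1 by [].
  apply/eqP; rewrite eqn_leq -ltnS ltn_divLR ?expn_gt0 // leq_divRL ?expn_gt0 //.
  by rewrite mul1n trunc_logP // -expnS trunc_log_ltn.
by rewrite -(odd_double_half a) -(odd_double_half b) h0 (IH _ _ _ hS) //; lia.
Qed.

Lemma val2_half b s : (val2 (b :: s))./2 = val2 s.
Proof. by rewrite /= half_bit_double. Qed.

Lemma bit_val2 s i : bit (val2 s) i = nth false s i.
Proof.
elim: s i => [|b s IH] [|i]; rewrite ?bit0n //.
  by rewrite bit0 /= oddD odd_double addbF; case: b.
by rewrite bitS val2_half IH.
Qed.

Lemma val2_lt s : val2 s < 2 ^ size s.
Proof. by elim: s => //= b s; rewrite expnS; case: b; lia. Qed.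

Lemma val2_rcons s b : val2 (rcons s b) = val2 s + b * 2 ^ size s.
Proof.
by case: b; elim: s => [|a s IH] /=; rewrite ?IH ?expnS ?expn0; lia.
Qed.

Lemma val2_cat s t : val2 (s ++ t) = val2 s + val2 t * 2 ^ size s.
Proof. by elim: s => [|a s IH] /=; rewrite ?IH ?expnS ?expn0; lia. Qed.

Lemma val2_nseq0 n : val2 (nseq n false) = 0.
Proof. by elim: n => //= n ->. Qed.

Lemma val2_bits n K : n < 2 ^ K -> val2 (mkseq (bit n) K) = n.
Proof.
move=> h; apply: bit_inj => i; rewrite bit_val2.
case: (ltnP i K) => iK; first by rewrite nth_mkseq.
by rewrite nth_default ?size_mkseq // (bit_big h).
Qed.

Lemma val2_mkseq_lt f K : val2 (mkseq f K) < 2 ^ K.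
Proof. by rewrite -{2}(size_mkseq f K) val2_lt. Qed.

Lemma bit_mkseq f K i : bit (val2 (mkseq f K)) i = (i < K) && f i.
Proof.
rewrite bit_val2; case: (ltnP i K) => iK; first by rewrite nth_mkseq.
by rewrite nth_default ?size_mkseq.
Qed.

Lemma modn_pow2S n K : n %% 2 ^ K.+1 = n %% 2 ^ K + bit n K * 2 ^ K.
Proof.
rewrite /bit -modn2 expnS mulnC.
have: 0 < 2 ^ K by rewrite expn_gt0.
move: (2 ^ K) => p p0.
have r_lt : n %/ p %% 2 < 2 by rewrite ltn_mod.
have s_lt : n %% p < p by rewrite ltn_mod.
have : n = n %/ p %/ 2 * (p * 2) + (n %% p + n %/ p %% 2 * p) :> nat.
  by rewrite {1}(divn_eq n p) {1}(divn_eq (n %/ p) 2); lia.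
move: (n %/ p %% 2) (n %% p) (n %/ p %/ 2) r_lt s_lt => r t q r_lt t_lt ->.
rewrite modnMDl modn_small //; case: r r_lt => [|[|?]] //; lia.
Qed.

Lemma size_binary n K : (size (binary n) <= K) = (n < 2 ^ K).
Proof.
rewrite size_mkseq; apply/idP/idP => h.
  by apply: leq_trans (up_logP n.+1 (isT : 1 < 2)) _; rewrite leq_pexp2l.
exact: up_log_min.
Qed.

Lemma ltn_size_binary n : n < 2 ^ size (binary n).
Proof. by rewrite -size_binary. Qed.

Lemma binaryE n : binary n = mkseq (bit n) (size (binary n)).
Proof. by rewrite size_mkseq. Qed.

Lemma nth_binary n i : nth false (binary n) i = bit n i.
Proof.
case: (ltnP i (size (binary n))) => h.
  by rewrite nth_mkseq //; rewrite size_mkseq in h.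
by rewrite nth_default // (bit_big (ltn_size_binary n)).
Qed.

Lemma val2_binary n : val2 (binary n) = n.
Proof. by rewrite {1}binaryE val2_bits // ltn_size_binary. Qed.

Lemma last_val2_ge s : last true s -> 0 < size s -> 2 ^ (size s).-1 <= val2 s.
Proof.
case/lastP: s => // s b; rewrite last_rcons => -> _.
by rewrite val2_rcons size_rcons mul1n leq_addl.
Qed.

Lemma binary_val2 s : last true s -> binary (val2 s) = s.
Proof.
move=> ls; have sz : size (binary (val2 s)) = size s.
  apply/eqP; rewrite eqn_leq size_binary val2_lt /= leqNgt.
  apply/negP => lt; have s0 : 0 < size s by apply: leq_ltn_trans lt.
  have := last_val2_ge ls s0; rewrite leqNgt -size_binary => /negP; apply; lia.
apply: (@eq_from_nth _ false) => // i _.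
by rewrite nth_binary bit_val2.
Qed.

Lemma last_binary n : last true (binary n).
Proof.
case/lastP E : (binary n) => [//|s b]; rewrite last_rcons.
case: b E => // E; have: n < 2 ^ size s.
  by rewrite -(val2_binary n) E val2_rcons mul0n addn0 val2_lt.
by rewrite -size_binary E size_rcons ltnn.
Qed.

(** * A logarithmic-time machine running a finite automaton *)

Section States.
Variables (d : nat) (Q : finType).

Definition blk : finType := {ffun 'I_d.+1 -> bool}.

Inductive pstate :=
| Tag of 3.-bseq bool
| Dig of bool & 'I_6 & bool & 'I_d.+1.

Inductive state :=
| Init | Up | Up1 | Down | Down1 | Clear | Back | Acc | Rej
| Parse of pstate | Incr of pstate | Return of pstate
| Rewind of bool & 'I_6
| Scan of Q & bool.

Definition pstate_code (p : pstate) : 3.-bseq bool + bool * 'I_6 * bool * 'I_d.+1 :=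
  match p with Tag x => inl x | Dig ab t l c => inr (ab, t, l, c) end.

Definition pstate_decode (x : 3.-bseq bool + bool * 'I_6 * bool * 'I_d.+1) :=
  match x with inl x => Tag x | inr (ab, t, l, c) => Dig ab t l c end.

Lemma pstate_codeK : cancel pstate_code pstate_decode.
Proof. by case. Qed.

HB.instance Definition _ := Finite.copy pstate (can_type pstate_codeK).

Definition state_code (s : state) :
    'I_9 + ((pstate + (pstate + pstate)) + (bool * 'I_6 + Q * bool)) :=
  match s with
  | Init => inl (Ordinal (isT : 0 < 9)) | Up => inl (Ordinal (isT : 1 < 9)) | Up1 => inl (Ordinal (isT : 2 < 9))
  | Down => inl (Ordinal (isT : 3 < 9)) | Down1 => inl (Ordinal (isT : 4 < 9)) | Clear => inl (Ordinal (isT : 5 < 9))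
  | Back => inl (Ordinal (isT : 6 < 9)) | Acc => inl (Ordinal (isT : 7 < 9)) | Rej => inl (Ordinal (isT : 8 < 9))
  | Parse p => inr (inl (inl p))
  | Incr p => inr (inl (inr (inl p)))
  | Return p => inr (inl (inr (inr p)))
  | Rewind ab t => inr (inr (inl (ab, t)))
  | Scan q b => inr (inr (inr (q, b)))
  end.

Definition state_decode
    (x : 'I_9 + ((pstate + (pstate + pstate)) + (bool * 'I_6 + Q * bool))) : state :=
  match x with
  | inl i => nth Init [:: Init; Up; Up1; Down; Down1; Clear; Back; Acc; Rej] i
  | inr (inl (inl p)) => Parse p
  | inr (inl (inr (inl p))) => Incr p
  | inr (inl (inr (inr p))) => Return p
  | inr (inr (inl (ab, t))) => Rewind ab t
  | inr (inr (inr (q, b))) => Scan q b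
  end.

Lemma state_codeK : cancel state_code state_decode.
Proof. by case. Qed.

HB.instance Definition _ := Finite.copy state (can_type state_codeK).

End States.
Arguments Tag {d}.
Arguments Init {d Q}. Arguments Up {d Q}. Arguments Up1 {d Q}.
Arguments Down {d Q}. Arguments Down1 {d Q}. Arguments Clear {d Q}.
Arguments Back {d Q}. Arguments Acc {d Q}. Arguments Rej {d Q}.
Arguments Parse {d Q}. Arguments Incr {d Q}. Arguments Return {d Q}.
Arguments Rewind {d Q}. Arguments Scan {d Q}.

Section Machine.
Variables (d : nat) (Q : finType) (q0 : 'I_6 -> Q).
Variables (dlt : Q -> bool -> blk d -> blk d -> Q) (F : pred Q).

Local Notation D := d.+1.
Local Notation st := (state d Q).

Definition sym : finType := (bool * bool * blk d)%type.

Definition cell (b m : bool) : option sym := Some (b, m, [ffun=> false]).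
Definition bcell (k : blk d) : option sym := Some (false, false, k).
Definition rd (o : option sym) : bool := if o is Some (b, _, _) then b else false.
Definition mk (o : option sym) : bool := if o is Some (_, m, _) then m else false.
Definition bl (o : option sym) : blk d := if o is Some (_, _, k) then k else [ffun=> false].

Definition width (ab : bool) (t : 'I_6) : nat :=
  if ab && (val t != wire_tag) then 1 else D.

Definition put (k : blk d) (c : 'I_D) (b : bool) : blk d :=
  [ffun j => if j == c then b else k j].

Definition act : Type := (option sym * dir)%type.

(* Tape 0 is the address.  Tape 1 receives [size w - 1] in binary, found by
   doubling and binary search, and is afterwards the ruler that bounds the
   lengths of [a] and [b].  Tapes 2 and 3 receive the digits of [a] and [b] in
   blocks of [width] digits per cell.  The marker is set in cell 0 only.  [Scan]
   carries the borrow of the subtraction of the address of the third [#] from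
   [size w - 1], whose result is the length of [y]. *)
Definition delta4 (s : st) (l : option (option bool)) (r0 r1 r2 r3 : option sym) :
    st * (act * act * act * act) :=
  let k0 := (r0, Stay) in let k1 := (r1, Stay) in
  let k2 := (r2, Stay) in let k3 := (r3, Stay) in
  let keep := (k0, k1, k2, k3) in
  match s with
  | Init => (Up, ((cell true true, Stay), (cell false true, Stay), k2, k3))
  | Up => if l is Some _ then (Up1, ((cell false (mk r0), Right), (r1, Right), k2, k3))
          else (Down, keep)
  | Up1 => (Up, ((cell true false, Stay), (cell false false, Stay), k2, k3))
  | Down =>
      let m := mk r0 in let dr := if m then Stay else Left in
      (if m then Clear else Down1,
       ((cell (isSome l) m, dr), (cell (isSome l) m, dr), k2, k3))
  | Down1 => (Down, ((cell true (mk r0), Stay), k1, k2, k3))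
  | Clear => if r0 is Some _ then (Clear, ((cell false (mk r0), Right), k1, k2, k3))
             else (Back, ((r0, Left), k1, k2, k3))
  | Back => if mk r0 then (Parse (Tag (insub_bseq 3 [::])), keep)
            else (Back, ((r0, Left), k1, k2, k3))
  | Acc => (Acc, keep)
  | Rej => (Rej, keep)
  | Parse (Tag x) =>
      match l with
      | None => (Rej, keep)
      | Some (Some b) => if size x < 3 then (Incr (Tag (insub_bseq 3 (rcons x b))), keep)
                         else (Rej, keep)
      | Some None => if [pick t : 'I_6 | binary t == x] is Some t
                     then (Incr (Dig false t true ord0), keep) else (Rej, keep)
      end
  | Parse (Dig ab t z c) =>
      match l with
      | None => (Rej, keep)
      | Some (Some b) =>
          if r1 is Some _ then
            let full := c.+1 == width ab t in
            let dr := if full then Right else Stay in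
            (Incr (Dig ab t b (if full then ord0 else inord c.+1)),
             (k0, (r1, dr),
              if ab then k2 else (bcell (put (bl r2) c b), dr),
              if ab then (bcell (put (bl r3) c b), dr) else k3))
          else (Rej, keep)
      | Some None => if z then (Rewind ab t, keep) else (Rej, keep)
      end
  | Incr p => if rd r0 then (Incr p, ((cell false (mk r0), Right), k1, k2, k3))
              else (Return p, ((cell true (mk r0), Stay), k1, k2, k3))
  | Return p => if mk r0 then (Parse p, keep)
                else (Return p, ((r0, Left), k1, k2, k3))
  | Rewind ab t =>
      if mk r1 then
        (if ab then Scan (q0 t) false else Incr (Dig true t true ord0), keep)
      else (Rewind ab t, (k0, (r1, Left), if ab then k2 else (r2, Left),
                                          if ab then (r3, Left) else k3))
  | Scan q b =>
      if r1 is Some _ then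
        let m := rd r1 in let n := rd r0 in
        (Scan (dlt q (m (+) n (+) b) (bl r2) (bl r3))
              (if m then n && b else n || b),
         ((r0, Right), (r1, Right), (r2, Right), (r3, Right)))
      else (if F q then Acc else Rej, keep)
  end.

Definition quad (T : Type) (a b c e : T) (j : 'I_4) : T := nth e [:: a; b; c] j.

Definition i1 : 'I_4 := Ordinal (isT : 1 < 4).
Definition i2 : 'I_4 := Ordinal (isT : 2 < 4).
Definition i3 : 'I_4 := Ordinal (isT : 3 < 4).

Definition mach : ratm (option bool) :=
  @Ratm (option bool) st sym 3 (fun a => rd (Some a)) Init Acc Rej
    (fun s l r =>
       let: (s', (a0, a1, a2, a3)) := delta4 s l (r ord0) (r i1) (r i2) (r i3) in
       (s', quad a0 a1 a2 a3)).

Definition blkof (e : nat) (v : seq bool) (k : nat) : blk d :=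
  [ffun j : 'I_D => (j < e) && nth false v (e * k + j)].

Fixpoint hsplit (w : seq (option bool)) : option (seq bool * seq (option bool)) :=
  match w with
  | [::] => None
  | None :: w' => Some ([::], w')
  | Some b :: w' => omap (fun p => (b :: p.1, p.2)) (hsplit w')
  end.

Variant hsplit_spec (w : seq (option bool)) : option (seq bool * seq (option bool)) -> Type :=
| HSplit u w' of w = map Some u ++ None :: w' : hsplit_spec w (Some (u, w'))
| HNone u of w = map Some u ++ [::] : hsplit_spec w None.

Lemma hsplitP w : hsplit_spec w (hsplit w).
Proof.
elim: w => [|[b|] w IH] /=; first exact: (HNone (u := [::])).
  case: IH => [u w' ->|u ->] /=; first exact: (HSplit (u := b :: u)).
  exact: (HNone (u := b :: u)).
exact: (HSplit (u := [::])).
Qed.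

Lemma hsplit_cat u w : hsplit (map Some u ++ None :: w) = Some (u, w).
Proof. by elim: u => //= b u ->. Qed.

Definition accepts (w : seq (option bool)) : bool :=
  let K := (up_log 2 (size w)).+1 in
  if hsplit w is Some (u, w1) then
  if [pick t : 'I_6 | binary t == u] is Some t then
  if hsplit w1 is Some (a, w2) then
  if last true a && (size a <= width false t * K) then
  if hsplit w2 is Some (b, y) then
    [&& last true b, size b <= width true t * K &
      F (foldl (fun q k => dlt q (bit (size y) k) (blkof (width false t) a k)
                                 (blkof (width true t) b k)) (q0 t) (iota 0 K))]
  else false else false else false else false else false.

Section Abstract.
Variable w : seq (option bool).
Local Notation conf := (rconf mach).
Local Notation step := (rstep (M := mach) w).

(* Tapes up to trailing blanks: content function and head position. *)
Definition ftape : Type := ((nat -> option sym) * nat)%type.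
Definition aconf : Type := (st * ftape * ftape * ftape * ftape)%type.

Definition fupd (f : nat -> option sym) i a := fun j => if j == i then a else f j.
Definition move (x : dir) (h : nat) :=
  match x with Left => h.-1 | Stay => h | Right => h.+1 end.
Definition fact (t : ftape) (a : act) : ftape := (fupd t.1 t.2 a.1, move a.2 t.2).

Definition ftape_of (t : tape sym) : ftape := (nth None t.1, t.2).

Definition abs (c : conf) : aconf :=
  (c.1, ftape_of (c.2 ord0), ftape_of (c.2 i1), ftape_of (c.2 i2), ftape_of (c.2 i3)).

Lemma ftape_of_act t a : ftape_of (tape_act t a) = fact (ftape_of t) a.
Proof.
congr pair; apply: functional_extensionality => i.
by rewrite nth_set_nth /fupd /=.
Qed.

Definition digits (s : seq bool) : nat -> option sym :=
  fun i => if i < size s then cell (nth false s i) (i == 0) else None.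

Lemma raddress_digits (t : tape sym) s h :
  ftape_of t = (digits s, h) -> raddress (M := mach) t = val2 s.
Proof.
case: t => t h' [e _]; rewrite /raddress /=.
transitivity (val2 (mkseq (fun i => rd (nth None t i)) (size t))).
  elim: (size t) => [|n IH]; first by rewrite big_ord0.
  rewrite big_ord_recr IH mkseqS val2_rcons size_mkseq; congr addn.
  by case: (nth None t n) => // -[[]].
apply: bit_inj => i; rewrite bit_mkseq bit_val2.
have <- : rd (nth None t i) = nth false s i.
  by rewrite e /digits; case: ltnP => // h1; rewrite nth_default.
by case: ltnP => //= h1; rewrite nth_default.
Qed.

Definition reach (n : nat) (a b : aconf) : Prop :=
  forall c, abs c = a -> exists2 k, k <= n & abs (iter k step c) = b.

Lemma reach0 a : reach 0 a a.
Proof. by move=> c <-; exists 0. Qed.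

Lemma reach_trans b n m a c : reach n a b -> reach m b c -> reach (n + m) a c.
Proof.
move=> h1 h2 x /h1 [k kn] /h2 [k' kn' e]; exists (k' + k); first by rewrite addnC leq_add.
by rewrite iterD.
Qed.

Lemma reach_leq n m a b : n <= m -> reach n a b -> reach m a b.
Proof. by move=> nm h x /h [k kn e]; exists k => //; apply: leq_trans nm. Qed.

Lemma reach_step s x h t1 t2 t3 s' a0 a1 a2 a3 u0 u1 u2 u3 :
  (s != Acc) && (s != Rej) ->
  delta4 s (onth w (val2 x)) (digits x h) (t1.1 t1.2) (t2.1 t2.2) (t3.1 t3.2)
    = (s', (a0, a1, a2, a3)) ->
  fact (digits x, h) a0 = u0 -> fact t1 a1 = u1 -> fact t2 a2 = u2 -> fact t3 a3 = u3 ->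
  reach 1 (s, (digits x, h), t1, t2, t3) (s', u0, u1, u2, u3).
Proof.
move=> hs hd <- <- <- <- c ca; exists 1 => //=; move: ca.
rewrite /rstep; case: c => q g; rewrite /abs /=.
set g0 := ftape_of (g ord0); set g1 := ftape_of _; set g2 := ftape_of _; set g3 := ftape_of _.
move=> [] qs e0 e1 e2 e3; rewrite qs; move: hs; rewrite -negb_or => /negbTE ->.
move=> e4.
have -> : delta4 s (onth w (raddress (M := mach) (g ord0))) (tape_read (g ord0))
   (tape_read (g i1)) (tape_read (g i2)) (tape_read (g i3)) = (s', (a0, a1, a2, a3)).
  rewrite -hd (@raddress_digits _ x h); last by rewrite /ftape_of e0 e1.
  by rewrite -e2 -e3 -e4 /tape_read e0 e1.
by rewrite /= !ftape_of_act -/g0 -/g1 -/g2 -/g3 e2 e3 e4 /g0 /ftape_of e0 e1.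
Qed.

Lemma fact_keep t x : fact t (t.1 t.2, x) = (t.1, move x t.2).
Proof.
congr pair; apply: functional_extensionality => i.
by rewrite /fupd; case: eqP => // ->.
Qed.

Lemma fact_digits x h b m y : m = (h == 0) -> h <= size x ->
  fact (digits x, h) (cell b m, y) = (digits (set_nth false x h b), move y h).
Proof.
move=> -> hx; congr pair; apply: functional_extensionality => i.
rewrite /fupd /digits /= size_set_nth nth_set_nth /=.
case: (eqVneq i h) => [->|ih]; first by rewrite leq_max leqnn.
by rewrite leq_max (_ : (i < h.+1) || _ = (i < size x)) //; lia.
Qed.

Lemma mk_digits x h : h < size x -> mk (digits x h) = (h == 0).
Proof. by rewrite /digits => ->. Qed.

Lemma rd_digits x h : rd (digits x h) = nth false x h.
Proof. by rewrite /digits; case: ltnP => // hx; rewrite nth_default. Qed.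

Lemma digits_nil : digits [::] = fun _ => None.
Proof. by apply: functional_extensionality. Qed.

Definition blank : ftape := (fun _ => None, 0).

Lemma rcons_nseq (T : Type) n (x : T) : rcons (nseq n x) x = nseq n.+1 x.
Proof. by elim: n => //= n ->. Qed.

Lemma set_nth_prefix (p x : seq bool) b b' :
  set_nth false (p ++ b' :: x) (size p) b = p ++ b :: x.
Proof. by elim: p => //= a p ->. Qed.

Lemma set_nth_size (p : seq bool) b : set_nth false p (size p) b = rcons p b.
Proof. by elim: p => //= a p ->. Qed.

Lemma set_nth_nseq n b a : set_nth false (nseq n a) n b = rcons (nseq n a) b.
Proof. by rewrite -{2}(size_nseq n a) set_nth_size. Qed.

Local Notation N := (size w).
Local Notation J := (up_log 2 N).
Local Notation K := J.+1.

Lemma onth_isSome n : isSome (onth w n) = (n < N).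
Proof. by rewrite onthTE. Qed.

Lemma reach_init :
  reach 1 (Init, (digits [::], 0), (digits [::], 0), blank, blank)
    (Up, (digits (rcons (nseq 0 false) true), 0), (digits (nseq 1 false), 0), blank, blank).
Proof.
apply: reach_step; [by []|by []| | | |].
- by rewrite fact_digits.
- by rewrite fact_digits.
- exact: fact_keep.
- exact: fact_keep.
Qed.

Lemma val2_pow j : val2 (rcons (nseq j false) true) = 2 ^ j.
Proof. by rewrite val2_rcons val2_nseq0 size_nseq mul1n. Qed.

Lemma reach_up j : j <= J ->
  reach (2 * j)
    (Up, (digits (rcons (nseq 0 false) true), 0), (digits (nseq 1 false), 0), blank, blank)
    (Up, (digits (rcons (nseq j false) true), j), (digits (nseq j.+1 false), j), blank, blank).
Proof.
elim: j => [|j IH] jJ; first exact: reach0.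
rewrite mulnS addnC; apply: reach_trans (IH (ltnW jJ)) _.
have lt : 2 ^ j < N.
  by rewrite ltnNge; apply/negP => /(up_log_min (isT : 1 < 2)); rewrite leqNgt jJ.
have sz : j < size (rcons (nseq j false) true) by rewrite size_rcons size_nseq.
have sz' : size (rcons (nseq j false) true) = j.+1 by rewrite size_rcons size_nseq.
rewrite -[2]/(1 + 1); apply: reach_trans.
  apply: reach_step; [by []| | | | |].
  - rewrite /delta4 val2_pow; move: lt; rewrite -onth_isSome.
    by case: (onth w _) => // a _; rewrite mk_digits.
  - by apply: fact_digits; rewrite ?mk_digits // sz'.
  - exact: fact_keep.
  - exact: fact_keep.
  - exact: fact_keep.
have -> : set_nth false (rcons (nseq j false) true) j false = nseq j.+1 false.
  by rewrite -cats1 -{2}(size_nseq j false) set_nth_prefix cats1 rcons_nseq.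
apply: reach_step; [by []|by []| | | |].
- by rewrite fact_digits ?size_nseq // set_nth_nseq.
- by rewrite fact_digits ?size_nseq // set_nth_nseq rcons_nseq.
- exact: fact_keep.
- exact: fact_keep.
Qed.

Lemma reach_up_down :
  reach 1
    (Up, (digits (rcons (nseq J false) true), J), (digits (nseq K false), J), blank, blank)
    (Down, (digits (rcons (nseq J false) true), J), (digits (nseq K false), J), blank, blank).
Proof.
have: ~~ isSome (onth w (2 ^ J)) by rewrite onth_isSome -leqNgt up_logP.
case E : (onth w _) => // _.
apply: reach_step; [by []|by rewrite /delta4 val2_pow E| | | |]; exact: fact_keep.
Qed.

Lemma reach_down j hi :
  2 ^ j.+1 * val2 hi <= N.-1 < 2 ^ j.+1 * (val2 hi).+1 ->
  exists m, [/\ size m = j.+1 + size hi, val2 m = N.-1 &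
   reach (2 * j.+1)
    (Down, (digits (nseq j false ++ true :: hi), j), (digits (nseq j.+1 false ++ hi), j), blank, blank)
    (Clear, (digits m, 0), (digits m, 0), blank, blank)].
Proof.
elim: j hi => [|j IH] hi /andP[lo up].
  set b := isSome (onth w (val2 (true :: hi))).
  exists (b :: hi); split => //.
    move: lo up; rewrite /b onth_isSome /=; lia.
  apply: (@reach_leq 1) => //.
  apply: reach_step; [by []|by []| | |exact: fact_keep|exact: fact_keep].
  - exact: fact_digits.
  - exact: fact_digits.
set b := isSome (onth w (val2 (nseq j.+1 false ++ true :: hi))).
have vE : val2 (nseq j.+1 false ++ true :: hi) = 2 ^ j.+1 * (val2 hi).*2.+1.
  by rewrite val2_cat val2_nseq0 size_nseq /= add0n add1n mulnC.
have [|m [sm vm rm]] := IH (b :: hi).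
  move: lo up; rewrite /b onth_isSome vE /=.
  rewrite [2 ^ j.+2]expnS; have : 0 < 2 ^ j.+1 by rewrite expn_gt0.
  move: (2 ^ j.+1) => p; case: ltnP => h p0 lo up /=; apply/andP; split; nia.
exists m; split => //; first by rewrite sm /=; lia.
rewrite mulnS; apply: reach_trans rm.
rewrite -[2]/(1 + 1); apply: reach_trans.
  apply: reach_step; [by []| | | | |].
  - by rewrite /delta4 mk_digits; last by rewrite size_cat size_nseq /=; lia.
  - by rewrite fact_digits // size_cat size_nseq /=; lia.
  - by rewrite fact_digits // size_cat size_nseq /=; lia.
  - exact: fact_keep.
  - exact: fact_keep.
rewrite /= -/(nseq j.+1 false).
have e0 : set_nth false (nseq j.+1 false ++ true :: hi) j.+1 b = nseq j.+1 false ++ b :: hi.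
  by rewrite -{2}(size_nseq j.+1 false) set_nth_prefix.
have e1 : set_nth false (nseq j.+2 false ++ hi) j.+1 b = nseq j.+1 false ++ b :: hi.
  rewrite -[RHS](set_nth_prefix _ _ _ false) size_nseq; congr set_nth.
  by rewrite -cat_rcons rcons_nseq.
move: e0 e1; rewrite /= => -> ->.
have e2 : false :: nseq j false ++ b :: hi = nseq j false ++ false :: b :: hi.
  by rewrite -[RHS]cat_rcons rcons_nseq.
apply: reach_step; [by []|by []| | |exact: fact_keep|exact: fact_keep].
- rewrite fact_digits; first last.
  + by rewrite /= size_cat size_nseq /=; lia.
  + by rewrite mk_digits //= size_cat size_nseq /=; lia.
  by rewrite e2 -{2}(size_nseq j false) set_nth_prefix.
- exact: fact_keep.
Qed.

Lemma digits_in x h : h < size x -> digits x h = cell (nth false x h) (h == 0).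
Proof. by rewrite /digits => ->. Qed.

Lemma fact_stay t : fact t (t.1 t.2, Stay) = t.
Proof. by rewrite fact_keep; case: t. Qed.

Lemma digits_out x h : size x <= h -> digits x h = None.
Proof. by rewrite /digits ltnNge => ->. Qed.

Lemma set_nth_nseq_cat j (x : seq bool) b b' :
  set_nth false (nseq j false ++ b' :: x) j b = nseq j false ++ b :: x.
Proof. by rewrite -{2}(size_nseq j false) set_nth_prefix. Qed.

Lemma reach_clear j r t1 t2 t3 :
  reach (size r).+1 (Clear, (digits (nseq j false ++ r), j), t1, t2, t3)
    (Back, (digits (nseq (j + size r) false), (j + size r).-1), t1, t2, t3).
Proof.
elim: r j => [|b r IH] j.
  rewrite cats0 addn0; apply: reach_step; [by []| | | | |].
  - by rewrite /delta4 digits_out ?size_nseq.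
  - by rewrite -(@digits_out (nseq j false) j) ?size_nseq //; apply: fact_keep.
  - exact: fact_stay.
  - exact: fact_stay.
  - exact: fact_stay.
have h : j < size (nseq j false ++ b :: r) by rewrite size_cat size_nseq /=; lia.
rewrite -[(size _).+1]add1n; apply: reach_trans; last first.
  by have := IH j.+1; rewrite addSnnS; apply.
apply: reach_step; [by []| | | | |].
- by rewrite /delta4 digits_in.
- by rewrite -rcons_nseq cat_rcons -(set_nth_nseq_cat j r false b); apply/fact_digits/ltnW.
- exact: fact_stay.
- exact: fact_stay.
- exact: fact_stay.
Qed.

Lemma reach_back h x t1 t2 t3 : h < size x ->
  reach h.+1 (Back, (digits x, h), t1, t2, t3)
    (Parse (Tag (insub_bseq 3 [::])), (digits x, 0), t1, t2, t3).
Proof.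
elim: h => [|h IH] hx.
  apply: reach_step; [by []|by rewrite /delta4 mk_digits| | | |]; solve [exact: fact_keep | exact: fact_stay].
rewrite -[h.+2]add1n; apply: reach_trans; last exact: IH (ltnW hx).
by apply: reach_step; [by []|by rewrite /delta4 mk_digits| | | |]; solve [exact: fact_keep | exact: fact_stay].
Qed.

Fixpoint incr (x : seq bool) : seq bool :=
  if x is b :: x' then if b then false :: incr x' else true :: x' else [::].

Definition trail (x : seq bool) : nat := find negb x.
Definition ones (x : seq bool) : nat := count id x.

Lemma size_incr x : size (incr x) = size x.
Proof. by elim: x => //= -[] x //= ->. Qed.

Lemma incr_spec x : (val2 x).+1 < 2 ^ size x ->
  [/\ val2 (incr x) = (val2 x).+1, ones (incr x) + trail x = (ones x).+1 & trail x < size x].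
Proof.
elim: x => //= -[] x IH; rewrite expnS => h /=.
  have [|v o t] := IH; first by lia.
  by rewrite /ones /trail /= ?add0n ?add1n v in o t *; split; lia.
by rewrite /ones /trail /= ?add0n ?add1n; split; lia.
Qed.

Lemma reach_incr p j r t1 t2 t3 : trail r < size r ->
  reach (trail r).+1 (Incr p, (digits (nseq j false ++ r), j), t1, t2, t3)
   (Return p, (digits (nseq j false ++ incr r), j + trail r), t1, t2, t3).
Proof.
elim: r j => // b r IH j.
have h : j < size (nseq j false ++ b :: r) by rewrite size_cat size_nseq /=; lia.
have n : nth false (nseq j false ++ b :: r) j = b.
  by rewrite nth_cat size_nseq ltnn subnn.
case: b h n => h n /= tr; last first.
  rewrite addn0; apply: reach_step; [by []| | | | |].
  - by rewrite /delta4 rd_digits n.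
  - rewrite -(set_nth_nseq_cat j r true false).
    by apply: fact_digits; rewrite ?mk_digits // ltnW.
  - exact: fact_stay.
  - exact: fact_stay.
  - exact: fact_stay.
rewrite -[(trail r).+2]add1n; apply: reach_trans; last first.
  have := IH j.+1 tr; rewrite addSnnS -!rcons_nseq !cat_rcons; apply.
apply: reach_step; [by []| | | | |].
- by rewrite /delta4 rd_digits n.
- rewrite -(set_nth_nseq_cat j r false true).
  by apply: fact_digits; rewrite ?mk_digits // ltnW.
- exact: fact_stay.
- exact: fact_stay.
- exact: fact_stay.
Qed.

Lemma reach_return p h x t1 t2 t3 : h < size x ->
  reach h.+1 (Return p, (digits x, h), t1, t2, t3)
    (Parse p, (digits x, 0), t1, t2, t3).
Proof.
elim: h => [|h IH] hx.
  apply: reach_step; [by []|by rewrite /delta4 mk_digits| | | |]; solve [exact: fact_keep | exact: fact_stay].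
rewrite -[h.+2]add1n; apply: reach_trans; last exact: IH (ltnW hx).
by apply: reach_step; [by []|by rewrite /delta4 mk_digits| | | |]; solve [exact: fact_keep | exact: fact_stay].
Qed.

(* Amortised cost, with twice the number of ones in the address as potential. *)
Lemma reach_next p x t1 t2 t3 : (val2 x).+1 < 2 ^ size x ->
  exists n, n + 2 * ones (incr x) <= 2 * ones x + 4 /\
  reach n (Incr p, (digits x, 0), t1, t2, t3) (Parse p, (digits (incr x), 0), t1, t2, t3).
Proof.
move=> /incr_spec [_ oE tr]; exists ((trail x).+1 + (trail x).+1); split; first by lia.
apply: reach_trans; first exact: (@reach_incr p 0 x).
by apply: reach_return; rewrite size_incr.
Qed.

Definition halts (n : nat) (a : aconf) (b : bool) : Prop :=
  exists a' : aconf, a'.1.1.1.1 = (if b then Acc else Rej) /\ reach n a a'.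

Lemma halts_trans n m a b c : reach n a b -> halts m b c -> halts (n + m) a c.
Proof. by move=> h [x [xs xr]]; exists x; split => //; apply: reach_trans xr. Qed.

Lemma halts_leq n m a b : n <= m -> halts n a b -> halts m a b.
Proof. by move=> nm [x [xs xr]]; exists x; split => //; apply: reach_leq xr. Qed.

Definition parsing p x t1 t2 t3 : aconf := (Parse p, (digits x, 0), t1, t2, t3).

Lemma lt_next x : val2 x < N -> (val2 x).+1 < 2 ^ K.
Proof.
move=> h; rewrite expnS; have := up_logP N (isT : 1 < 2).
have : 0 < 2 ^ J by rewrite expn_gt0.
lia.
Qed.

Lemma parse_reject p x t1 t2 t3 :
  (let r0 := digits x 0 in let r1 := t1.1 t1.2 in
   let r2 := t2.1 t2.2 in let r3 := t3.1 t3.2 in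
   delta4 (Parse p) (onth w (val2 x)) r0 r1 r2 r3 =
   (Rej, ((r0, Stay), (r1, Stay), (r2, Stay), (r3, Stay)))) ->
  halts 1 (parsing p x t1 t2 t3) false.
Proof.
move=> h; exists (Rej, (digits x, 0), t1, t2, t3); split => //.
apply: reach_step; [by []|exact: h| | | |]; exact: fact_stay.
Qed.

Lemma parse_letter l p p' x t1 t2 t3 a1 a2 a3 :
  size x = K -> onth w (val2 x) = Some l ->
  delta4 (Parse p) (Some l) (digits x 0) (t1.1 t1.2) (t2.1 t2.2) (t3.1 t3.2) =
    (Incr p', ((digits x 0, Stay), a1, a2, a3)) ->
  exists n x', [/\ n + 2 * ones x' <= 2 * ones x + 5, size x' = K,
    val2 x' = (val2 x).+1 &
    reach n (parsing p x t1 t2 t3) (parsing p' x' (fact t1 a1) (fact t2 a2) (fact t3 a3))].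
Proof.
move=> sx xl dl.
have lt : val2 x < N by rewrite -onth_isSome xl.
have lt' : (val2 x).+1 < 2 ^ size x by rewrite sx lt_next.
have [vE _ _] := incr_spec lt'.
have [n [le rn]] := reach_next p' (fact t1 a1) (fact t2 a2) (fact t3 a3) lt'.
exists (1 + n), (incr x); split => //; first by lia.
  by rewrite size_incr.
apply: reach_trans rn; apply: reach_step; [by []|by rewrite xl; exact: dl| | | |] => //.
exact: fact_stay.
Qed.

Lemma drop_onth (A : Type) (s : seq A) p l r :
  drop p s = l :: r -> onth s p = Some l /\ drop p.+1 s = r.
Proof.
elim: s p => [|a s IH] [|p] //=; last exact: IH.
by case=> -> ->; rewrite drop0.
Qed.

Lemma drop_onth_nil (A : Type) (s : seq A) p : drop p s = [::] -> onth s p = None.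
Proof. by elim: s p => [|a s IH] [|p] //= /IH. Qed.

Lemma val_insub_bseq n (A : Type) (s : seq A) : size s <= n -> insub_bseq n s = s :> seq A.
Proof. by move=> h; rewrite /insub_bseq insubdK. Qed.

Lemma parse_tag u v x r t1 t2 t3 : size x = K -> size v <= 3 ->
  drop (val2 x) w = map Some u ++ r ->
  (size (v ++ u) <= 3 /\ exists n x',
    [/\ n + 2 * ones x' <= 2 * ones x + 5 * size u, size x' = K, drop (val2 x') w = r,
        val2 x' = val2 x + size u &
     reach n (parsing (Tag (insub_bseq 3 v)) x t1 t2 t3)
             (parsing (Tag (insub_bseq 3 (v ++ u))) x' t1 t2 t3)])
  \/ (3 < size (v ++ u) /\ exists2 n, n <= 2 * ones x + 5 * (4 - size v) &
        halts n (parsing (Tag (insub_bseq 3 v)) x t1 t2 t3) false).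
Proof.
elim: u v x => [|b u IH] v x sx sv /= dE.
  left; rewrite cats0; split => //; exists 0, x; split => //; [lia|by rewrite addn0|exact: reach0].
have [oE dE'] := drop_onth dE.
have valv := val_insub_bseq sv.
case: (ltnP (size v) 3) => sv3; last first.
  right; split; first by rewrite size_cat /=; lia.
  exists 1; first by lia.
  by apply: parse_reject; rewrite /= oE valv ltnNge sv3.
have [|n [x' [le sx' vx' rn]]] := @parse_letter _ (Tag (insub_bseq 3 v))
    (Tag (insub_bseq 3 (rcons v b))) x t1 t2 t3 (t1.1 t1.2, Stay)
    (t2.1 t2.2, Stay) (t3.1 t3.2, Stay) sx oE.
  by rewrite /= valv sv3.
rewrite !fact_stay in rn.
have [||[sz [n' [x'' [le' sx'' d'' vx'' rn']]]]|[sz [n' le' rn']]] := IH (rcons v b) x' sx'.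
- by rewrite size_rcons.
- by rewrite vx'.
- left; rewrite -cat_rcons; split => //; exists (n + n'), x''; split => //.
  + lia.
  + by rewrite vx'' vx' /=; lia.
  + exact: reach_trans rn'.
- right; rewrite -cat_rcons; split => //; exists (n + n').
    by move: le'; rewrite size_rcons; lia.
  exact: halts_trans rn'.
Qed.

Definition bcont (e : nat) (v : seq bool) : nat -> option sym :=
  fun k => if e * k < size v then bcell (blkof e v k) else None.

Lemma bl_bcont e v k : bl (bcont e v k) = blkof e v k.
Proof.
rewrite /bcont; case: ltnP => // h; apply/ffunP => j; rewrite !ffunE.
by rewrite nth_default ?andbF //; lia.
Qed.

Lemma width_gt0 ab t : 0 < width ab t <= D.
Proof. by rewrite /width; case: ifP => _; rewrite ?leqnn. Qed.

Lemma fact_bcont e v h (c : 'I_D) b y : c < e -> e <= D -> size v = e * h + c ->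
  fact (bcont e v, h) (bcell (put (bl (bcont e v h)) c b), y) = (bcont e (rcons v b), move y h).
Proof.
move=> ce eD sv; congr pair; apply: functional_extensionality => k.
rewrite /fupd /= bl_bcont /bcont size_rcons.
case: (eqVneq k h) => [->|kh].
  rewrite ltnS sv leq_addr; congr (Some (_, _, _)); apply/ffunP => j; rewrite !ffunE.
  rewrite nth_rcons -val_eqE sv ltn_add2l eqn_add2l.
  case: (eqVneq (val j) c) => [->|jc]; first by rewrite ltnn ce.
  by case: (ltnP j c) => // cj; rewrite nth_default // sv leq_add2l.
rewrite (_ : (e * k < (size v).+1) = (e * k < size v)); last first.
  rewrite sv; case: (ltngtP k h) kh => // kh _; [|].
    have l : e * k.+1 <= e * h by rewrite leq_mul2l kh orbT.
    by lia.
  have l : e * h.+1 <= e * k by rewrite leq_mul2l kh orbT.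
  by lia.
case: ltnP => // lt; congr (Some (_, _, _)); apply/ffunP => j; rewrite !ffunE.
case je : (j < e) => //=; rewrite nth_rcons sv.
case: ltngtP => // jj; first by rewrite nth_default // sv ltnW.
have: (e * k + j) %/ e = (e * h + c) %/ e by rewrite jj.
by rewrite ![e * _]mulnC !divnMDl ?divn_small ?addn0 //; [move/eqP: kh| lia | lia].
Qed.

Definition parsing_digits ab t z (c : 'I_D) x m h v (o : ftape) : aconf :=
  let b := (bcont (width ab t) v, h) in
  parsing (Dig ab t z c) x (digits m, h) (if ab then o else b) (if ab then b else o).

Lemma parse_digits ab t o m r u z v (c : 'I_D) h x : size m = K -> size x = K ->
  let e := width ab t in
  size v = e * h + c -> c < e -> size v <= e * K ->
  drop (val2 x) w = map Some u ++ r ->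
  (size (v ++ u) <= e * K /\ exists n x' (c' : 'I_D) h',
    [/\ n + 2 * ones x' <= 2 * ones x + 5 * size u, size x' = K,
        drop (val2 x') w = r /\ val2 x' = val2 x + size u, h' <= K &
     reach n (parsing_digits ab t z c x m h v o)
             (parsing_digits ab t (last z u) c' x' m h' (v ++ u) o)])
  \/ (e * K < size (v ++ u) /\ exists2 n, n <= 2 * ones x + 5 * (e * K - size v).+1 &
        halts n (parsing_digits ab t z c x m h v o) false).
Proof.
move=> sm sx e; have /andP[e0 eD] : 0 < e <= D := width_gt0 ab t.
elim: u z v c h x sx => [|b u IH] z v c h x sx sv ce svK /= dE.
  left; rewrite cats0; split => //; exists 0, x, c, h; split => //; [lia|by rewrite addn0| |exact: reach0].
  by rewrite -(leq_pmul2l e0); lia.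
have [oE dE'] := drop_onth dE.
case: (ltnP h K) => hK; last first.
  right; split.
    have l : e * K <= e * h by rewrite leq_mul2l hK orbT.
    by rewrite size_cat /= sv; lia.
  exists 1; first by lia.
  by apply: parse_reject; rewrite /= oE digits_out ?sm.
pose full := c.+1 == e.
pose c' : 'I_D := if full then ord0 else inord c.+1.
pose dr := if full then Right else Stay.
pose h' := move dr h.
have c'E : c' = (if full then 0 else c.+1) :> nat.
  rewrite /c'; case: ifP => // /eqP f; rewrite inordK //; lia.
have sv' : size (rcons v b) = e * h' + c'.
  rewrite size_rcons sv c'E /h' /dr; case: ifP => [/eqP f|_] /=; last by lia.
  by rewrite -f; lia.
have ce' : c' < e by rewrite c'E; case: ifP => // /eqP f; lia.
have svK' : size (rcons v b) <= e * K.
  rewrite size_rcons sv; have : e * h.+1 <= e * K by rewrite leq_mul2l hK orbT.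
  by rewrite mulnS; lia.
have [|n [x' [le sx' vx' rn]]] := @parse_letter _ (Dig ab t z c)
    (Dig ab t b c') x (digits m, h)
    (if ab then o else (bcont e v, h)) (if ab then (bcont e v, h) else o)
    (digits m h, dr)
    (if ab then (o.1 o.2, Stay) else (bcell (put (bl (bcont e v h)) c b), dr))
    (if ab then (bcell (put (bl (bcont e v h)) c b), dr) else (o.1 o.2, Stay))
    sx oE.
  by rewrite /= digits_in ?sm //= -/e -/full; case: (ab).
have [||||[sz [n' [x'' [c'' [h'' [le' sx'' d'' hK'' rn']]]]]]|[sz [n' le' rn']]] :=
  IH b (rcons v b) c' h' x' sx' => //.
- by rewrite vx'.
- left; rewrite -cat_rcons; split => //; exists (n + n'), x'', c'', h''; split => //.
  + lia.
  + by case: d'' => -> ->; split => //; rewrite vx'; lia.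
  + apply: reach_trans rn'; move: rn; rewrite /parsing_digits -/e.
    by case: (ab) => /=; rewrite fact_keep fact_stay fact_bcont.
- right; rewrite -cat_rcons; split => //; exists (n + n').
    by move: le' svK'; rewrite size_rcons; lia.
  apply: halts_trans rn'; move: rn; rewrite /parsing_digits -/e.
  by case: (ab) => /=; rewrite fact_keep fact_stay fact_bcont.
Qed.

Lemma reach_rewind ab t x m h f o : size m = K -> h <= K ->
  reach h.+1
    (Rewind ab t, (digits x, 0), (digits m, h), if ab then o else (f, h), if ab then (f, h) else o)
    (if ab then Scan (q0 t) false else Incr (Dig true t true ord0),
     (digits x, 0), (digits m, 0), if ab then o else (f, 0), if ab then (f, 0) else o).
Proof.
move=> sm; elim: h => [|h IH] hK.
  apply: reach_step; [by []|by rewrite /delta4 mk_digits ?sm| | | |]; try exact: fact_stay.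
rewrite -[h.+2]add1n; apply: reach_trans (IH (ltnW hK)).
have hm : mk (digits m h.+1) = false by rewrite /digits; case: ifP.
apply: reach_step; [by []|by rewrite /delta4 hm| | | |].
- exact: fact_stay.
- exact: fact_keep.
- by case: (ab); [exact: fact_stay|exact: fact_keep].
- by case: (ab); [exact: fact_keep|exact: fact_stay].
Qed.

Definition scan_step x m (f g : nat -> option sym) (qb : Q * bool) (k : nat) : Q * bool :=
  let a := nth false m k in let n := nth false x k in
  (dlt qb.1 (a (+) n (+) qb.2) (bl (f k)) (bl (g k)), if a then n && qb.2 else n || qb.2).

Lemma halts_scan n i x m f g q b : i + n = size m ->
  halts n.+1 (Scan q b, (digits x, i), (digits m, i), (f, i), (g, i))
    (F (foldl (scan_step x m f g) (q, b) (iota i n)).1).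
Proof.
elim: n i q b => [|n IH] i q b sm /=.
  exists (if F q then Acc else Rej, (digits x, i), (digits m, i), (f, i), (g, i)).
  split; first by case: (F q).
  have hm : digits m i = None by rewrite digits_out // -sm addn0.
  apply: reach_step; [by []|by rewrite /delta4 /= hm| | | |];
    rewrite -?hm; exact: fact_stay.
rewrite -[n.+2]add1n; apply: halts_trans; last by apply: IH; rewrite addSnnS.
have im : i < size m by rewrite -sm; lia.
have hm := digits_in im.
apply: reach_step; [by []|by rewrite /delta4 /= hm rd_digits| | | |];
  rewrite -?hm; exact: fact_keep.
Qed.

Lemma eq_foldl (A B : Type) (f g : B -> A -> B) :
  (forall q k, f q k = g q k) -> forall q l, foldl f q l = foldl g q l.
Proof. by move=> fg q l; elim: l q => //= k l IH q; rewrite fg. Qed.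

Lemma bit_sub a b n : b <= a ->
  bit (a - b) n = bit a n (+) bit b n (+) (a %% 2 ^ n < b %% 2 ^ n).
Proof.
move=> ba; rewrite /bit divnB ?expn_gt0 //.
have p0 : 0 < 2 ^ n by rewrite expn_gt0.
have le : b %/ 2 ^ n + (a %% 2 ^ n < b %% 2 ^ n) <= a %/ 2 ^ n.
  have le := leq_div2r (2 ^ n) ba.
  case: ltnP => h /=; last by rewrite addn0.
  rewrite addn1 ltn_neqAle le andbT; apply/eqP => e.
  by move: ba; rewrite (divn_eq a (2 ^ n)) (divn_eq b (2 ^ n)) e leq_add2l leqNgt h.
by rewrite -subnDA oddB // oddD oddb addbA.
Qed.

Lemma scan_sub x m f g q n : val2 x <= val2 m ->
  foldl (scan_step x m f g) (q, false) (iota 0 n) =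
  (foldl (fun q k => dlt q (bit (val2 m - val2 x) k) (bl (f k)) (bl (g k))) q (iota 0 n),
   val2 m %% 2 ^ n < val2 x %% 2 ^ n).
Proof.
move=> le; elim: n => [|n IH]; first by rewrite /= !modn1.
rewrite -addn1 iotaD !foldl_cat IH /= add0n /scan_step /= (bit_sub _ le) !bit_val2.
congr pair; rewrite addn1 !modn_pow2S !bit_val2.
have : val2 m %% 2 ^ n < 2 ^ n by rewrite ltn_mod expn_gt0.
have : val2 x %% 2 ^ n < 2 ^ n by rewrite ltn_mod expn_gt0.
move: (2 ^ n) (val2 m %% _) (val2 x %% _) => p y z.
by case: (nth _ m n); case: (nth _ x n) => /=; lia.
Qed.

Lemma bcont_nil e : bcont e [::] = fun _ => None.
Proof. by apply: functional_extensionality => k; rewrite /bcont. Qed.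

Lemma ones_size x : ones x <= size x.
Proof. exact: count_size. Qed.

Lemma halts_second m x t a : size m = K -> val2 m = N.-1 -> size x = K ->
  halts (10 * K + 5 * (D * K) + 20)
    (parsing_digits true t true ord0 x m 0 [::] (bcont (width false t) a, 0))
    (if hsplit (drop (val2 x) w) is Some (b, y) then
      [&& last true b, size b <= width true t * K &
      F (foldl (fun q k => dlt q (bit (size y) k) (blkof (width false t) a k)
                                 (blkof (width true t) b k)) (q0 t) (iota 0 K))]
     else false).
Proof.
move=> sm vm sx; set e := width true t.
have /andP[e0 eD] : 0 < e <= D := width_gt0 true t.
have eK : e * K <= D * K by rewrite leq_mul2r eD orbT.
have z0 : size ([::] : seq bool) = e * 0 + (ord0 : 'I_D) by rewrite muln0.
have oK : ones x <= K by rewrite -sx ones_size.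
case: hsplitP => [b y|b] E.
- have [] := @parse_digits true t (bcont (width false t) a, 0) m (None :: y) b true [::] ord0 0 x sm sx z0 e0 (leq0n _) E.
  + rewrite -/e /= => -[sz [n [x' [c' [h' [le sx' [d' v'] hK rn]]]]]].
    have [oE _] := drop_onth d'.
    rewrite sz /=; case lb : (last true b) => /=; last first.
      apply: halts_leq (halts_trans rn (m := 1) _); first by lia.
      by apply: parse_reject; rewrite /= oE lb.
    apply: (@halts_leq (n + (1 + (h'.+1 + K.+1)))); first by lia.
    apply: (halts_trans rn); rewrite lb.
    apply: (@halts_trans _ _ _ (Rewind true t, (digits x', 0), (digits m, h'),
       (bcont (width false t) a, 0), (bcont e b, h'))).
      apply: reach_step; [by []|by rewrite /delta4 oE| | | |]; exact: fact_stay.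
    apply: halts_trans.
      exact: (@reach_rewind true t x' m h' (bcont e b) (bcont (width false t) a, 0) sm hK).
    have lt : val2 x' < N by rewrite -onth_isSome oE.
    have NE : N.-1 - val2 x' = size y.
      by have := size_drop (val2 x') w; rewrite d' /=; lia.
    have le' : val2 x' <= val2 m by rewrite vm; lia.
    have := @halts_scan K 0 x' m (bcont (width false t) a) (bcont e b) (q0 t) false.
    rewrite scan_sub // vm NE.
    rewrite (@eq_foldl _ _ _ (fun q k => dlt q (bit (size y) k) (blkof (width false t) a k)
                                 (blkof (width true t) b k))); first by apply; rewrite sm.
    by move=> q k; rewrite !bl_bcont.
  + rewrite -/e /= => -[sz [n le hn]].
    by rewrite leqNgt sz andbF; apply: halts_leq hn; lia.
- have [] := @parse_digits true t (bcont (width false t) a, 0) m [::] b true [::] ord0 0 x sm sx z0 e0 (leq0n _) E.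
  + rewrite -/e /= => -[sz [n [x' [c' [h' [le sx' [d' v'] hK rn]]]]]].
    have oE := drop_onth_nil d'.
    apply: halts_leq (halts_trans rn (m := 1) _); first by lia.
    by apply: parse_reject; rewrite /= oE.
  + rewrite -/e /= => -[sz [n le hn]].
    by apply: halts_leq hn; lia.
Qed.

Lemma halts_first m x t : size m = K -> val2 m = N.-1 -> size x = K ->
  halts (30 * K + 10 * (D * K) + 60)
    (parsing_digits false t true ord0 x m 0 [::] blank)
    (if hsplit (drop (val2 x) w) is Some (a, w2) then
     if last true a && (size a <= width false t * K) then
     if hsplit w2 is Some (b, y) then
      [&& last true b, size b <= width true t * K &
      F (foldl (fun q k => dlt q (bit (size y) k) (blkof (width false t) a k)
                                 (blkof (width true t) b k)) (q0 t) (iota 0 K))]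
     else false else false else false).
Proof.
move=> sm vm sx; set e := width false t.
have /andP[e0 eD] : 0 < e <= D := width_gt0 false t.
have eK : e * K <= D * K by rewrite leq_mul2r eD orbT.
have oK : ones x <= K by rewrite -sx ones_size.
have z0 : size ([::] : seq bool) = e * 0 + (ord0 : 'I_D) by rewrite muln0.
case: hsplitP => [a w2|a] E.
- have [] := @parse_digits false t blank m (None :: w2) a true [::] ord0 0 x sm sx z0 e0 (leq0n _) E.
  + rewrite -/e /= => -[sz [n [x' [c' [h' [le sx' [d' v'] hK rn]]]]]].
    have [oE dE] := drop_onth d'.
    rewrite sz andbT; case la : (last true a) => /=; last first.
      apply: halts_leq (halts_trans rn (m := 1) _); first by lia.
      by apply: parse_reject; rewrite /= oE la.
    have lt : val2 x' < N by rewrite -onth_isSome oE.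
    have lt' : (val2 x').+1 < 2 ^ size x' by rewrite sx' lt_next.
    have [vE _ _] := incr_spec lt'.
    have [n' [le' rn']] := reach_next (Dig true t true ord0) (digits m, 0) (bcont e a, 0) blank lt'.
    have oK' : ones x' <= K by rewrite -sx' ones_size.
    apply: (@halts_leq (n + (1 + (h'.+1 + (n' + (10 * K + 5 * (D * K) + 20)))))); first by lia.
    apply: (halts_trans rn); rewrite la.
    apply: (@halts_trans _ _ _ (Rewind false t, (digits x', 0), (digits m, h'),
       (bcont e a, h'), blank)).
      apply: reach_step; [by []|by rewrite /delta4 oE| | | |]; exact: fact_stay.
    apply: halts_trans.
      exact: (@reach_rewind false t x' m h' (bcont e a) blank sm hK).
    apply: (halts_trans rn').
    have := @halts_second m (incr x') t a sm vm _; rewrite size_incr vE dE.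
    by rewrite /parsing_digits /= bcont_nil; apply.
  + rewrite -/e /= => -[sz [n le hn]].
    by rewrite leqNgt sz andbF; apply: halts_leq hn; lia.
- have [] := @parse_digits false t blank m [::] a true [::] ord0 0 x sm sx z0 e0 (leq0n _) E.
  + rewrite -/e /= => -[sz [n [x' [c' [h' [le sx' [d' v'] hK rn]]]]]].
    have oE := drop_onth_nil d'.
    apply: halts_leq (halts_trans rn (m := 1) _); first by lia.
    by apply: parse_reject; rewrite /= oE.
  + rewrite -/e /= => -[sz [n le hn]].
    by apply: halts_leq hn; lia.
Qed.

Lemma halts_tag m x : size m = K -> val2 m = N.-1 -> size x = K -> val2 x = 0 ->
  halts (50 * K + 10 * (D * K) + 100)
    (parsing (Tag (insub_bseq 3 [::])) x (digits m, 0) blank blank) (accepts w).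
Proof.
move=> sm vm sx vx; rewrite /accepts.
have DJ := leq0n (d * J).
have oK : ones x <= K by rewrite -sx ones_size.
have d0 : drop (val2 x) w = w by rewrite vx drop0.
case: hsplitP d0 => [u w1|u] {2}-> d0;
  have [[sz [n [x' [le sx' d' v' rn]]]]|[sz [n le hn]]] :=
    parse_tag (digits m, 0) blank blank sx (leq0n 3 : size ([::] : seq bool) <= 3) d0.
- have [oE dE] := drop_onth d'.
  have valu := val_insub_bseq sz.
  have oK' : ones x' <= K by rewrite -sx' ones_size.
  rewrite /= in valu sz rn; case: pickP => [t /eqP tu|tu]; last first.
    apply: halts_leq (halts_trans rn (m := 1) _); first by lia.
    apply: parse_reject; rewrite /= oE.
    by case: pickP => // t; rewrite valu tu.
  have [|n' [x'' [le' sx'' vx'' rn']]] :=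
    @parse_letter None (Tag (insub_bseq 3 u)) (Dig false t true ord0) x' (digits m, 0)
      blank blank (digits m 0, Stay) (None, Stay) (None, Stay) sx' oE.
    rewrite /= valu; case: pickP => [t' /eqP t'u|/(_ t)]; last by rewrite tu eqxx.
    congr (Incr (Dig _ _ _ _), _); apply: ord_inj.
    by rewrite -(val2_binary t') t'u -tu val2_binary.
  apply: (@halts_leq (n + (n' + (30 * K + 10 * (D * K) + 60)))); first by lia.
  apply: (halts_trans rn); apply: (halts_trans rn').
  have := @halts_first m x'' t sm vm sx''; rewrite vx'' dE.
  by rewrite /parsing_digits /= !fact_stay bcont_nil.
- rewrite /= in sz le; case: pickP => [t /eqP tu|_]; last by apply: halts_leq hn; lia.
  move: sz; rewrite -tu ltnNge size_binary; case: (t) => k /=; lia.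
- have oE := drop_onth_nil d'; rewrite /= in sz.
  apply: halts_leq (halts_trans rn (m := 1) _); first by lia.
  by apply: parse_reject; rewrite /= oE.
- by rewrite /= in le; apply: halts_leq hn; lia.
Qed.

Lemma halts_init :
  halts (60 * K + 10 * (D * K) + 110)
    (Init, (digits [::], 0), (digits [::], 0), blank, blank) (accepts w).
Proof.
have DJ := leq0n (d * J).
have [|m [sm vm rm]] := @reach_down J [::].
  rewrite muln0 muln1 /= expnS; have := up_logP N (isT : 1 < 2).
  have : 0 < 2 ^ J by rewrite expn_gt0.
  lia.
rewrite addn0 in sm.
apply: (@halts_leq (1 + (2 * J + (1 + (2 * K + (K.+1 + (K + (50 * K + 10 * (D * K) + 100)))))))).
  by lia.
apply: (halts_trans reach_init); apply: (halts_trans (reach_up (leqnn J))).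
apply: (halts_trans reach_up_down).
rewrite -cats1 -[nseq K false]cats0; apply: (halts_trans rm).
have := @reach_clear 0 m (digits m, 0) blank blank; rewrite sm add0n => rc.
apply: (halts_trans rc).
apply: (halts_trans (@reach_back J (nseq K false) (digits m, 0) blank blank _)).
  by rewrite size_nseq.
by apply: halts_tag => //; rewrite ?size_nseq ?val2_nseq0.
Qed.

End Abstract.

Lemma rstep_halted w (c : rconf mach) :
  (c.1 == Acc) || (c.1 == Rej) -> rstep (M := mach) w c = c.
Proof. by rewrite /rstep /= => ->. Qed.

Lemma mach_DLOGTIME L : (forall w, L w <-> accepts w) -> DLOGTIME L.
Proof.
move=> LE; exists mach, (400 * D); split => // w.
have [a [aE ra]] := halts_init w.
have [|k kn kE] := ra (rinit mach).
  have e : ftape_of ([::], 0) = (digits [::], 0).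
    by congr pair; apply: functional_extensionality => i; rewrite nth_nil.
  by rewrite /abs /= e digits_nil.
set n := _ * _.
have kn' : k <= n.
  apply: leq_trans kn _; rewrite /n.
  have : up_log 2 (size w) <= (trunc_log 2 (size w)).+1.
    by apply: up_log_min => //; apply/ltnW/trunc_log_ltn.
  move: (up_log _ _) (trunc_log _ _) => x y xy.
  have h1 : D * x.+1 <= D * (2 * y.+1) by rewrite leq_mul2l; lia.
  have h2 : 1 * y.+1 <= D * y.+1 by rewrite leq_mul2r.
  lia.
have st : (iter k (rstep w) (rinit mach)).1 = (if accepts w then Acc else Rej).
  by rewrite -aE -kE.
have -> : rrun mach w n = iter k (rstep w) (rinit mach).
  rewrite /rrun -(subnK kn') iterD; elim: (n - k) => //= m ->.
  by apply: rstep_halted; rewrite st; case: ifP.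
rewrite st; split => [/LE ->//|nL].
by case: ifP => // /LE.
Qed.
End Machine.

(** * Automatic predicates *)

Section Automatic.
Variable d : nat.
Local Notation D := d.+1.

Definition bits (a : nat -> nat) (k : nat) : blk d := [ffun i : 'I_D => bit (a i) k].

Definition pred4 := 'I_6 -> nat -> (nat -> nat) -> (nat -> nat) -> bool.

(* The automaton reads the digits of [L], of the [a i] and of the [b i] in
   parallel, least significant first; [K] is any sufficient number of digits. *)
Definition automatic (P : pred4) : Prop :=
  exists (Q : finType) (q0 : 'I_6 -> Q) (dlt : Q -> bool -> blk d -> blk d -> Q) (F : pred Q),
  forall t L a b K, L < 2 ^ K -> (forall i, i < D -> a i < 2 ^ K) ->
    (forall i, i < D -> b i < 2 ^ K) ->
    F (foldl (fun q k => dlt q (bit L k) (bits a k) (bits b k)) (q0 t) (iota 0 K)) =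
    P t L a b.

Lemma automatic_ext (P P' : pred4) :
  (forall t L a b, P t L a b = P' t L a b) -> automatic P -> automatic P'.
Proof.
move=> e [Q [q0 [dlt [F h]]]]; exists Q, q0, dlt, F => *.
by rewrite -e; apply: h.
Qed.

Lemma foldl_iota (A : Type) (f : A -> nat -> A) (St : nat -> A) q K :
  q = St 0 -> (forall k, St k.+1 = f (St k) k) -> foldl f q (iota 0 K) = St K.
Proof. by move=> -> e; elim: K => // K IH; rewrite -addn1 iotaD foldl_cat IH /= addn1 e. Qed.

Lemma automatic_tag (p : 'I_6 -> bool) : automatic (fun t _ _ _ => p t).
Proof.
exists bool, p, (fun q _ _ _ => q), id => t L a b K _ _ _.
exact: (@foldl_iota _ _ (fun=> p t)).
Qed.

Lemma automatic_op (op : bool -> bool -> bool) (P P' : pred4) :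
  automatic P -> automatic P' -> automatic (fun t L a b => op (P t L a b) (P' t L a b)).
Proof.
move=> [Q [q0 [dlt [F h]]]] [Q' [q0' [dlt' [F' h']]]].
exists (Q * Q')%type, (fun t => (q0 t, q0' t)),
  (fun q l x y => (dlt q.1 l x y, dlt' q.2 l x y)), (fun q => op (F q.1) (F' q.2)).
move=> t L a b K hL ha hb; rewrite -(h _ _ _ _ K) // -(h' _ _ _ _ K) //.
set f := fun _ _ => _; set f1 := fun _ _ => _; set f2 := fun _ _ => _.
suff -> : forall s q q', foldl f (q, q') s = (foldl f1 q s, foldl f2 q' s) by [].
by elim=> //= k s IH q q'; rewrite IH.
Qed.

Lemma automatic_all (I : eqType) (P : I -> pred4) (s : seq I) :
  (forall i, i \in s -> automatic (P i)) -> automatic (fun t L a b => all (fun i => P i t L a b) s).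
Proof.
elim: s => [|i s IH] h; first exact: (automatic_tag (fun=> true)).
apply: (automatic_op andb); first by apply: h; rewrite mem_head.
by apply: IH => j js; apply: h; rewrite inE js orbT.
Qed.

Lemma automatic_has (I : eqType) (P : I -> pred4) (s : seq I) :
  (forall i, i \in s -> automatic (P i)) -> automatic (fun t L a b => has (fun i => P i t L a b) s).
Proof.
elim: s => [|i s IH] h; first exact: (automatic_tag (fun=> false)).
apply: (automatic_op orb); first by apply: h; rewrite mem_head.
by apply: IH => j js; apply: h; rewrite inE js orbT.
Qed.

Lemma automatic_find (I : eqType) (P : I -> pred4) (s : seq I) c :
  (forall i, i \in s -> automatic (P i)) ->
  automatic (fun t L a b => find (fun i => P i t L a b) s == c).
Proof.
elim: s c => [|i s IH] c h; first exact: (automatic_tag (fun=> 0 == c)).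
have hi : automatic (P i) by apply: h; rewrite mem_head.
have hs j : j \in s -> automatic (P j) by move=> js; apply: h; rewrite inE js orbT.
case: c => [|c].
  by apply: automatic_ext hi => t L a b /=; case: (P i t L a b).
apply: automatic_ext (automatic_op (fun x y => ~~ x && y) hi (IH c hs)) => t L a b /=.
by case: (P i t L a b).
Qed.

Inductive track := TLen | TA of 'I_D | TB of 'I_D.

Definition tval (x : track) (L : nat) (a b : nat -> nat) : nat :=
  match x with TLen => L | TA i => a i | TB i => b i end.

Definition tbit (x : track) (l : bool) (u v : blk d) : bool :=
  match x with TLen => l | TA i => u i | TB i => v i end.

Lemma tbitE x L a b k : tbit x (bit L k) (bits a k) (bits b k) = bit (tval x L a b) k.
Proof. by case: x => //= i; rewrite ffunE. Qed.

Lemma tval_lt x L a b K : L < 2 ^ K -> (forall i, i < D -> a i < 2 ^ K) ->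
  (forall i, i < D -> b i < 2 ^ K) -> tval x L a b < 2 ^ K.
Proof. by case: x => //= i h ha hb; rewrite ?ha ?hb. Qed.

Lemma automatic_lt x y : automatic (fun _ L a b => tval x L a b < tval y L a b).
Proof.
exists bool, (fun=> false),
  (fun q l u v => if tbit x l u v == tbit y l u v then q else tbit y l u v), id.
move=> t L a b K hL ha hb; set X := tval x L a b; set Y := tval y L a b.
rewrite (@foldl_iota _ _ (fun k => X %% 2 ^ k < Y %% 2 ^ k)) => [| |k].
- by rewrite !modn_small // tval_lt.
- by rewrite /= !modn1.
rewrite !tbitE -/X -/Y !modn_pow2S.
have : X %% 2 ^ k < 2 ^ k by rewrite ltn_mod expn_gt0.
have : Y %% 2 ^ k < 2 ^ k by rewrite ltn_mod expn_gt0.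
by case: (bit X k); case: (bit Y k) => /= h1 h2; lia.
Qed.

Lemma automatic_eq x y : automatic (fun _ L a b => tval x L a b == tval y L a b).
Proof.
have h := automatic_op (fun u v => ~~ u && ~~ v) (automatic_lt x y) (automatic_lt y x).
by apply: automatic_ext h => t L a b; rewrite -!leqNgt andbC eqn_leq.
Qed.

Lemma automatic_zero x : automatic (fun _ L a b => tval x L a b == 0).
Proof.
exists bool, (fun=> true), (fun q l u v => q && ~~ tbit x l u v), id.
move=> t L a b K hL ha hb; set X := tval x L a b.
rewrite (@foldl_iota _ _ (fun k => X %% 2 ^ k == 0)) => [| |k].
- by rewrite !modn_small // tval_lt.
- by rewrite /= !modn1.
rewrite !tbitE -/X !modn_pow2S addn_eq0 muln_eq0 expn_eq0 /= orbF.
by case: (bit X k).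
Qed.

Lemma automatic_one x : automatic (fun _ L a b => tval x L a b == 1).
Proof.
exists (option bool), (fun=> None),
  (fun q l u v => if q is Some c then Some (c && ~~ tbit x l u v) else Some (tbit x l u v)),
  (fun q => if q is Some c then c else false).
move=> t L a b K hL ha hb; set X := tval x L a b.
have XK : X < 2 ^ K by apply: tval_lt.
rewrite (@foldl_iota _ _ (fun k => if k is 0 then None else Some (X %% 2 ^ k == 1))) => [| |k].
- case: K {hL ha hb} XK => [|K] XK; first by case: X XK.
  by rewrite modn_small.
- by [].
rewrite !tbitE -/X; case: k => [|k].
  by rewrite bit0 expn1 modn2; case: (odd X).
rewrite [in LHS]modn_pow2S; congr Some; rewrite expnS.
have : X %% (2 * 2 ^ k) < 2 * 2 ^ k by rewrite ltn_mod -expnS expn_gt0.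
have : 0 < 2 ^ k by rewrite expn_gt0.
by case: (bit X k.+1) => /= h1 h2; lia.
Qed.

Definition pow2 (n : nat) : bool := (0 < n) && (n == 2 ^ trunc_log 2 n).

Lemma pow2P n : reflect (exists i, n = 2 ^ i) (pow2 n).
Proof.
apply: (iffP andP) => [[_ /eqP ->]|[i ->]]; first by exists (trunc_log 2 n).
split; first by rewrite expn_gt0.
by rewrite (@trunc_log_eq 2 i) // leqnn ltn_exp2l /=.
Qed.

Lemma automatic_pow2 x : automatic (fun _ L a b => pow2 (tval x L a b)).
Proof.
exists (bool * bool)%type, (fun=> (true, false)),
  (fun q l u v => if tbit x l u v then (false, q.1) else q), (fun q => q.2).
move=> t L a b K hL ha hb; set X := tval x L a b.
rewrite (@foldl_iota _ _ (fun k => (X %% 2 ^ k == 0, pow2 (X %% 2 ^ k)))) => [| |k].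
- by rewrite modn_small // tval_lt.
- by rewrite /= !modn1.
rewrite !tbitE -/X !modn_pow2S.
have : X %% 2 ^ k < 2 ^ k by rewrite ltn_mod expn_gt0.
case: (bit X k); rewrite ?mul0n ?addn0 // mul1n => h; congr pair.
  by rewrite addn_eq0 expn_eq0 andbF.
apply/pow2P/eqP => [[i e]|->]; last by exists k; rewrite add0n.
have ik : i = k.
  apply/eqP; rewrite eqn_leq -ltnS -(@ltn_exp2l 2) // -(@leq_exp2l 2 k) // -e leq_addl andbT.
  by rewrite expnS mul2n -addnn ltn_add2r.
by move: e; rewrite ik; lia.
Qed.

Lemma automatic_len x : automatic (fun _ L a b => tval x L a b < 2 ^ size (binary L)).
Proof.
exists bool, (fun=> true), (fun q l u v => l || (q && ~~ tbit x l u v)), id.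
move=> t L a b K hL ha hb; set X := tval x L a b.
have XK : X < 2 ^ K by apply: tval_lt.
rewrite (@foldl_iota _ _ (fun k => X %% 2 ^ k < 2 ^ size (binary (L %% 2 ^ k)))) => [| |k].
- by rewrite !modn_small.
- by rewrite /= !modn1.
rewrite !tbitE -/X !modn_pow2S.
have hX : X %% 2 ^ k < 2 ^ k by rewrite ltn_mod expn_gt0.
have hL' : L %% 2 ^ k < 2 ^ k by rewrite ltn_mod expn_gt0.
have p : 0 < 2 ^ k by rewrite expn_gt0.
case: (bit L k) => /=; rewrite ?mul1n ?mul0n ?addn0.
  have -> : size (binary (L %% 2 ^ k + 2 ^ k)) = k.+1.
    apply/eqP; rewrite eqn_leq size_binary expnS mul2n -addnn ltn_add2r hL' /=.
    by rewrite ltnNge size_binary -leqNgt leq_addl.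
  by rewrite expnS; case: (bit X k); lia.
case: (bit X k); rewrite ?mul0n ?addn0 ?andbT //= andbF.
apply/negbTE; rewrite -leqNgt.
apply: leq_trans (leq_addl _ _); rewrite mul1n leq_pexp2l //.
by rewrite size_binary.
Qed.

End Automatic.

(** * Interleaving *)

Section Interleave.
Variable D : nat.
Hypothesis D0 : 0 < D.

(* Digit [k] of the [i]-th component of [g] is digit [D * k + i] of [g], so that
   one block of [D] digits carries one digit of every component. *)
Definition dec (g i : nat) : nat := val2 (mkseq (fun k => bit g (D * k + i)) g).

Definition code (l : nat) (u : nat -> nat) : nat :=
  val2 (mkseq (fun n => bit (u (n %% D)) (n %/ D)) (D * l)).

Lemma bit_dec g i k : bit (dec g i) k = bit g (D * k + i).
Proof.
rewrite bit_mkseq; case: ltnP => //= gk; symmetry.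
apply: (@bit_big _ g); first exact: ltn_expl.
by apply: leq_trans gk _; apply: leq_trans (leq_addr _ _); apply: leq_pmull.
Qed.

Lemma ltn_bits n K : (forall i, K <= i -> bit n i = false) -> n < 2 ^ K.
Proof.
move=> h; have -> : n = val2 (mkseq (bit n) K); last exact: val2_mkseq_lt.
by apply: bit_inj => i; rewrite bit_mkseq; case: ltnP => //= /h.
Qed.

Lemma dec_lt l g i : i < D -> g < 2 ^ (D * l) -> dec g i < 2 ^ l.
Proof.
move=> iD gl; apply: ltn_bits => k lk; rewrite bit_dec (bit_big gl) //.
by apply: leq_trans (leq_addr _ _); rewrite leq_mul2l lk orbT.
Qed.

Lemma lt_dec l g : (forall i, i < D -> dec g i < 2 ^ l) -> g < 2 ^ (D * l).
Proof.
move=> h; apply: ltn_bits => n ln; rewrite (divn_eq n D) mulnC -bit_dec.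
by apply: (bit_big (h _ _)); rewrite ?ltn_mod // leq_divRL // mulnC.
Qed.

Lemma code_lt l u : code l u < 2 ^ (D * l).
Proof. exact: val2_mkseq_lt. Qed.

Lemma dec_code l u i : i < D -> u i < 2 ^ l -> dec (code l u) i = u i.
Proof.
move=> iD ul; apply: bit_inj => k; rewrite bit_dec bit_mkseq.
rewrite [D * k]mulnC modnMDl modn_small // divnMDl // divn_small // addn0.
case: ltnP => //= h; rewrite (bit_big ul) // leqNgt; apply/negP => kl.
have : D * k.+1 <= D * l by rewrite leq_mul2l kl orbT.
by rewrite mulnS; lia.
Qed.

Lemma code_dec l g : g < 2 ^ (D * l) -> code l (dec g) = g.
Proof.
move=> gl; apply: bit_inj => n; rewrite bit_mkseq bit_dec [D * (n %/ D)]mulnC -divn_eq.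
by case: ltnP => // h; rewrite (bit_big gl).
Qed.

Lemma eq_code l u v : (forall i, i < D -> u i = v i) -> code l u = code l v.
Proof.
by move=> h; congr val2; apply: eq_mkseq => n; rewrite h // ltn_mod.
Qed.

End Interleave.

(* In the word of a label [h] is the position of an input letter and hence not
   interleaved. *)
Definition decw (D : nat) (t : 'I_6) (h : nat) : nat -> nat :=
  if val t == wire_tag then dec D h else fun j => if j == 0 then h else 0.

Lemma blkof_dec d a k : blkof d d.+1 a k = bits d (dec d.+1 (val2 a)) k.
Proof.
by apply/ffunP => j; rewrite !ffunE bit_dec // bit_val2 ltn_ord.
Qed.

Lemma blkof_decw d t b k : blkof d (width d true t) b k = bits d (decw d.+1 t (val2 b)) k.
Proof.
rewrite /width /decw /=; case: eqP => /= _; first exact: blkof_dec.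
apply/ffunP => j; rewrite !ffunE mul1n; case: (eqVneq (j : nat) 0) => [->|j0] /=.
  by rewrite addn0 bit_val2.
by rewrite ltnNge lt0n j0 bit0n.
Qed.

Lemma automatic_DLOGTIME d (P : pred4) : automatic d P ->
  (forall t L a b, P t L a b -> forall i, i < d.+1 ->
     a i < 2 ^ size (binary L) /\ b i < 2 ^ size (binary L)) ->
  DLOGTIME (fun w => exists (t : 'I_6) g h y,
    w = dc_word t g h y /\ P t (size y) (dec d.+1 g) (decw d.+1 t h)).
Proof.
move=> [Q [q0 [dlt [F hP]]]] rg; apply: (@mach_DLOGTIME d Q q0 dlt F) => w.
rewrite /accepts; set K := (up_log 2 (size w)).+1.
have key (t : 'I_6) a b (y : seq (option bool)) : size y <= size w ->
  size a <= d.+1 * K -> size b <= width d true t * K ->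
  F (foldl (fun q k => dlt q (bit (size y) k) (blkof d (width d false t) a k)
      (blkof d (width d true t) b k)) (q0 t) (iota 0 K)) =
  P t (size y) (dec d.+1 (val2 a)) (decw d.+1 t (val2 b)).
  move=> yw sa sb; rewrite -(hP t (size y) _ _ K).
  - congr F; apply: eq_foldl => q k; congr dlt; last exact: blkof_decw.
    by rewrite /width /=; exact: blkof_dec.
  - apply: leq_ltn_trans yw _; apply: leq_ltn_trans (up_logP _ (isT : 1 < 2)) _.
    by rewrite ltn_exp2l.
  - move=> i iD; apply: dec_lt => //; apply: leq_trans (val2_lt a) _.
    by rewrite leq_pexp2l.
  - move=> i iD; rewrite /decw; move: sb; rewrite /width /=; case: eqP => /= _ sb.
      by apply: dec_lt => //; apply: leq_trans (val2_lt b) _; rewrite leq_pexp2l.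
    case: eqP => _; last by rewrite expn_gt0.
    by apply: leq_trans (val2_lt b) _; rewrite leq_pexp2l // -[K]mul1n.
split.
  move=> [t [g [h [y [wE Pt]]]]].
  have yw : size y <= size w.
    by rewrite wE /dc_word -!cat_rcons !size_cat; lia.
  have lK : size (binary (size y)) <= K.
    rewrite size_binary; apply: leq_ltn_trans yw _.
    by apply: leq_ltn_trans (up_logP _ (isT : 1 < 2)) _; rewrite ltn_exp2l.
  have pK n : n < 2 ^ size (binary (size y)) -> n < 2 ^ K.
    by move=> hn; apply: leq_trans hn _; rewrite leq_pexp2l.
  have sg : size (binary g) <= d.+1 * K.
    by rewrite size_binary; apply: lt_dec => // i iD; apply/pK/(rg _ _ _ _ Pt i iD).1.
  have sh : size (binary h) <= width d true t * K.
    rewrite size_binary; move: (rg _ _ _ _ Pt); rewrite /decw /width /=.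
    case: eqP => _ /= rg'; first by apply: lt_dec => // i iD; apply/pK/(rg' i iD).2.
    by rewrite mul1n; apply/pK/(rg' 0 isT).2.
  rewrite wE /dc_word hsplit_cat; case: pickP => [t' /eqP tt|/(_ t)]; last by rewrite eqxx.
  have -> : t' = t by apply: ord_inj; rewrite -(val2_binary t') tt val2_binary.
  rewrite hsplit_cat last_binary sg hsplit_cat last_binary sh /=.
  by have := key t (binary g) (binary h) y yw sg sh; rewrite !val2_binary => ->.
case: hsplitP => // u w1 wE; case: pickP => // t /eqP tu.
case: hsplitP => // a w2 w1E; case: ifP => // /andP[la sa].
case: hsplitP => // b y w2E /and3P[lb sb].
have yw : size y <= size w.
  by rewrite wE w1E w2E -!cat_rcons !size_cat; lia.
rewrite key // => Pt.
exists t, (val2 a), (val2 b), y; split => //.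
by rewrite /dc_word !binary_val2 // tu wE w1E w2E.
Qed.

(** * First-order logic with majority quantifiers *)

Inductive atom := ALt of nat & nat | AIn of nat | AZero of nat | AOne of nat | APow of nat.

Definition atomv (A : atom) (L : nat) (v : nat -> nat) : bool :=
  match A with
  | ALt i j => v i < v j
  | AIn i => v i < L
  | AZero i => v i == 0
  | AOne i => v i == 1
  | APow i => pow2 (v i)
  end.

Inductive kind := KAnd | KOr | KMaj.

Inductive fom :=
| QAtm of atom
| QIn of nat
| QNot of fom
| QNode of kind & seq nat & fom & fom.

Fixpoint subs (f : fom) : seq fom :=
  f :: match f with
       | QNot g => subs g
       | QNode _ _ g h => subs g ++ subs h
       | _ => [::]
       end.

Definition okatom (V : nat) (A : atom) : bool :=
  match A with
  | ALt i j => (i < V) && (j < V)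
  | AIn i | AZero i | AOne i | APow i => i < V
  end.

Fixpoint okfom (V : nat) (f : fom) : bool :=
  match f with
  | QAtm A => okatom V A
  | QIn i => i < V
  | QNot g => okfom V g
  | QNode _ xs g h => [&& uniq xs, all (fun x => x < V) xs, okfom V g & okfom V h]
  end.

(* [setw] writes the digits of [Z] in base [B] into the variables [xs]. *)
Fixpoint setw (B : nat) (xs : seq nat) (Z : nat) (v : nat -> nat) : nat -> nat :=
  if xs is x :: xs' then
    fun y => if y == x then Z %% B else setw B xs' (Z %/ B) v y
  else v.

Fixpoint wval (B : nat) (xs : seq nat) (u : nat -> nat) : nat :=
  if xs is x :: xs' then u x + B * wval B xs' u else 0.

Definition envs (B : nat) (xs : seq nat) (v : nat -> nat) : seq (nat -> nat) :=
  [seq setw B xs Z v | Z <- iota 0 (B ^ size xs)].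

Lemma envsE B xs v : envs B xs v = [seq setw B xs Z v | Z <- iota 0 (B ^ size xs)].
Proof. by []. Qed.

Fixpoint sem (L : nat) (x : seq bool) (B : nat) (f : fom) (v : nat -> nat) : bool :=
  match f with
  | QAtm A => atomv A L v
  | QIn i => (v i < L) && nth false x (v i)
  | QNot g => ~~ sem L x B g v
  | QNode k xs g h =>
      let l := envs B xs v in
      match k with
      | KAnd => all (fun u => sem L x B g u && sem L x B h u) l
      | KOr => has (fun u => sem L x B g u || sem L x B h u) l
      | KMaj => size l < count (sem L x B g) l + count (sem L x B h) l
      end
  end.

Lemma setw_notin B xs Z v y : y \notin xs -> setw B xs Z v y = v y.
Proof.
by elim: xs Z => //= x xs IH Z; rewrite inE negb_or => /andP[/negbTE -> /IH].
Qed.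

Lemma wval_ext B xs u v : {in xs, u =1 v} -> wval B xs u = wval B xs v.
Proof.
elim: xs => //= x xs IH h; rewrite h ?mem_head // IH // => y yx.
by apply: h; rewrite inE yx orbT.
Qed.

Lemma wval_setw B xs Z v : uniq xs -> Z < B ^ size xs -> wval B xs (setw B xs Z v) = Z.
Proof.
elim: xs Z => [|x xs IH] Z /=; first by rewrite expn0 ltnS leqn0 => _ /eqP.
case/andP=> xn un; rewrite expnS => ZB.
have B0 : 0 < B by case: (B) ZB; rewrite ?mul0n.
rewrite eqxx (@wval_ext _ _ _ (setw B xs (Z %/ B) v)); last first.
  by move=> y yx /=; case: eqP => // e; rewrite -e yx in xn.
rewrite IH //; last by rewrite ltn_divLR // mulnC.
by rewrite addnC mulnC -divn_eq.
Qed.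

Lemma wval_lt B xs u : {in xs, forall x, u x < B} -> wval B xs u < B ^ size xs.
Proof.
elim: xs => //= x xs IH h; rewrite expnS.
have h1 : u x < B by apply: h; rewrite mem_head.
have h2 : wval B xs u < B ^ size xs by apply: IH => y yx; apply: h; rewrite inE yx orbT.
have : B * (wval B xs u).+1 <= B * B ^ size xs by rewrite leq_mul2l h2 orbT.
by rewrite mulnS; lia.
Qed.

Lemma setw_wval B xs u v y : {in xs, forall x, u x < B} -> y \in xs ->
  setw B xs (wval B xs u) v y = u y.
Proof.
elim: xs => //= x xs IH h; rewrite inE.
have h1 : u x < B by apply: h; rewrite mem_head.
case: (eqVneq y x) => [->|yx] /= yxs; first by rewrite addnC mulnC modnMDl modn_small.
rewrite addnC mulnC divnMDl; last by apply: leq_ltn_trans h1.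
rewrite divn_small // addn0 IH // => z zx; apply: h; by rewrite inE zx orbT.
Qed.

Lemma setw_lt B xs Z v y : 0 < B -> y \in xs -> setw B xs Z v y < B.
Proof.
move=> B0; elim: xs Z => //= x xs IH Z; rewrite inE.
by case: eqP => _ /=; [rewrite ltn_mod | apply: IH].
Qed.

Lemma size_envs B xs v : size (envs B xs v) = B ^ size xs.
Proof. by rewrite size_map size_iota. Qed.

Lemma count_envs B xs v (P : pred (nat -> nat)) :
  count P (envs B xs v) = \sum_(Z < B ^ size xs) P (setw B xs Z v).
Proof.
rewrite /envs count_map -sum1_count big_mkcond /=.
rewrite (_ : iota 0 _ = index_iota 0 (B ^ size xs)) ?big_mkord; last by rewrite /index_iota subn0.
by apply: eq_bigr => i _; case: (P _).
Qed.

Lemma subs_at f j dflt : j < size (subs f) ->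
  exists s1 s2, subs f = s1 ++ subs (nth dflt (subs f) j) ++ s2 /\ size s1 = j.
Proof.
elim: f j => [A|i|f IH|k xs f IHf g IHg] [|j] //=; try by move=> _; exists [::], [::]; rewrite /= ?cats0.
- by rewrite ltnS => /IH [s1 [s2 [e s]]]; exists (QNot f :: s1), s2; rewrite /= -e s.
rewrite ltnS size_cat nth_cat; case: (ltnP j (size (subs f))) => [jf _|fj jfg].
  have [s1 [s2 [e s]]] := IHf _ jf; exists (QNode k xs f g :: s1), (s2 ++ subs g).
  by rewrite /= {1}e -!catA s.
have [|s1 [s2 [e s]]] := IHg (j - size (subs f)); first by lia.
exists (QNode k xs f g :: subs f ++ s1), s2.
by rewrite /= {1}e -!catA size_cat s subnKC.
Qed.

Lemma size_subs_gt0 f : 0 < size (subs f).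
Proof. by case: f. Qed.

(** * The circuits of a formula *)

Section Circuits.
Variables (root : fom) (V : nat).
Hypothesis ok : okfom V root.
(* For inputs of length 0 there is one gate only, which thus rejects. *)
Hypothesis isOr : if root is QNode KOr _ _ _ then true else false.

Local Notation T := (size (subs root)).
Definition dim : nat := V + T.-1.
Local Notation D := dim.+1.

Lemma V_lt_D i : i < V -> i < D.
Proof. by rewrite /dim; lia. Qed.

Lemma T_lt_D i : i < T -> V + i < D.
Proof. by rewrite /dim; lia. Qed.

Lemma D_split i : i < D -> (i < V) || ((V <= i) && (i - V < T)).
Proof. by rewrite /dim; have := size_subs_gt0 root; lia. Qed.

(* A gate is a node of the syntax tree, in one-hot notation (zero for the root),
   together with the values of the variables. *)
Definition gvec (j : nat) (u : nat -> nat) (i : nat) : nat :=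
  if i < V then u i else (i - V == j) && (0 < j).

Definition tagged (j : nat) (a : nat -> nat) : bool :=
  all (fun i => a (V + i) == ((i == j) && (0 < j)) :> nat) (iota 0 T).

Definition tagof (a : nat -> nat) : nat := find (fun j => tagged j a) (iota 0 T).

Definition node (j : nat) : fom := nth (QAtm (AZero 0)) (subs root) j.

Definition kids (j : nat) : seq nat :=
  match node j with
  | QNot _ => [:: j.+1]
  | QNode _ _ g _ => [:: j.+1; j.+1 + size (subs g)]
  | _ => [::]
  end.

Definition qvars (j : nat) : seq nat := if node j is QNode _ xs _ _ then xs else [::].

Definition labn (f : fom) (L : nat) (a : nat -> nat) : gate :=
  match f with
  | QAtm A => if atomv A L a then And else Or
  | QIn i => if a i < L then Input (a i) else Or
  | QNot _ => Not
  | QNode KAnd _ _ _ => And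
  | QNode KOr _ _ _ => Or
  | QNode KMaj _ _ _ => Maj
  end.

Definition edgen (a b : nat -> nat) : bool :=
  (tagof b \in kids (tagof a)) &&
  all (fun i => (i \in qvars (tagof a)) || (a i == b i)) (iota 0 V).

Definition circ (L : nat) : circuit :=
  @Circuit (2 ^ (D * size (binary L))).-1
    (fun g => labn (node (tagof (dec D g))) L (dec D g))
    (fun g h => edgen (dec D g) (dec D h)).

Lemma tagof_le a : tagof a <= T.
Proof. by rewrite -[leqRHS](size_iota 0); apply: find_size. Qed.

Lemma tagof_tagged a : tagof a < T -> tagged (tagof a) a.
Proof.
move=> h; have hh : has (fun j => tagged j a) (iota 0 T) by rewrite has_find size_iota.
by have := nth_find 0 hh; rewrite nth_iota.
Qed.

Lemma tagged_inj i j a : i < T -> j < T -> tagged i a -> tagged j a -> i = j.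
Proof.
wlog ij : i j / i <= j => [h|] iT jT ti tj.
  by case: (leqP i j) => [|/ltnW] l; [apply: h|symmetry; apply: h].
move/allP: ti => /(_ j); rewrite mem_iota add0n => /(_ jT) /eqP e.
move/allP: tj => /(_ j); rewrite mem_iota add0n => /(_ jT) /eqP; rewrite e eqxx /=.
by case: (ltngtP i j) ij => //= ij _; rewrite (leq_ltn_trans _ ij).
Qed.

Lemma tagof_eq j a : j < T -> tagged j a -> tagof a = j.
Proof.
move=> jT ta; have hh : has (fun j => tagged j a) (iota 0 T).
  by apply/hasP; exists j => //; rewrite mem_iota.
have lt : tagof a < T by move: hh; rewrite has_find size_iota.
exact: (tagged_inj lt jT (tagof_tagged lt) ta).
Qed.

Lemma tagged_ext j a b : (forall i, i < D -> a i = b i) -> tagged j a = tagged j b.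
Proof.
move=> h; apply: eq_in_all => i; rewrite mem_iota add0n => /T_lt_D iD.
by rewrite h.
Qed.

Lemma tagof_ext a b : (forall i, i < D -> a i = b i) -> tagof a = tagof b.
Proof. by move=> h; apply: eq_find => j; apply: tagged_ext. Qed.

Lemma tagof_gvec j u : j < T -> tagof (gvec j u) = j.
Proof.
move=> jT; apply: tagof_eq => //; apply/allP => i _.
by rewrite /gvec ltnNge leq_addr /= addKn.
Qed.

Lemma gvec_tagof a i : tagof a < T -> i < D -> gvec (tagof a) a i = a i.
Proof.
move=> tT /D_split; rewrite /gvec; case: ltnP => //= Vi iT.
have /allP/(_ (i - V)) := tagof_tagged tT.
by rewrite mem_iota add0n => /(_ iT) /eqP; rewrite subnKC.
Qed.

Lemma node_default j : T <= j -> node j = QAtm (AZero 0).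
Proof. exact: nth_default. Qed.

Lemma kids_lt j c : c \in kids j -> j < c < T.
Proof.
case: (ltnP j T) => [jT|/node_default e]; last by rewrite /kids e.
have [s1 [s2 [e s]]] := subs_at (QAtm (AZero 0)) jT.
have sz : T = j + size (subs (node j)) + size s2.
  by rewrite {1}e !size_cat s addnA.
move: sz; rewrite /kids; case: (node j) => //= [f|k xs f g]; rewrite ?size_cat !inE => sz.
  by move/eqP=> ->; have := size_subs_gt0 f; lia.
have := size_subs_gt0 f; have := size_subs_gt0 g.
by move=> ? ? /orP[/eqP ->|/eqP ->]; lia.
Qed.

Lemma edgen_lt a b : edgen a b -> tagof a < tagof b < T.
Proof. by case/andP=> /kids_lt. Qed.

Lemma circ_depth L : depth_at_most T (circ L).
Proof.
move=> g p; suff : path (@cedge (circ L)) g p -> tagof (dec D g) + size p <= T.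
  by move=> h /h; apply: leq_trans; apply: leq_addl.
elim: p g => [|h p IH] g /=; first by rewrite addn0 tagof_le.
case/andP=> /edgen_lt/andP[lt _] /IH; apply: leq_trans.
by rewrite addnS -addSn leq_add2r.
Qed.

Lemma circ_size : exists c, forall n, csize (circ n) <= n ^ c + c.
Proof.
exists (2 * D + 2 ^ D) => n.
rewrite /csize /= prednK ?expn_gt0 //; case: n => [|[|n]].
- have p : 0 < 2 ^ D by rewrite expn_gt0.
  by rewrite muln0 expn0; lia.
- have -> : size (binary 1) = 1 by [].
  by rewrite muln1; lia.
set N := n.+2; have h : 2 ^ size (binary N) <= N ^ 2.
  have := leqnn (size (binary N)); case E : (size (binary N)) => [|l].
    by rewrite expn0 expn_gt0.
  have : 2 ^ l <= N by rewrite leqNgt -size_binary E ltnn.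
  by rewrite expnS -[N ^ 2]/(N * N) /N; move: (2 ^ l) => z; nia.
rewrite mulnC expnM; apply: leq_trans (leq_addr _ _).
apply: (@leq_trans ((N ^ 2) ^ D)); first by rewrite leq_exp2r.
by rewrite -expnM leq_pexp2l // leq_addr.
Qed.

Hypothesis V0 : 0 < V.

Lemma okfom_subs f : okfom V f -> all (okfom V) (subs f).
Proof.
elim: f => [A|i|f IH|k xs f IHf g IHg] /= h; rewrite ?h ?andbT //=.
  exact: IH.
by case/and4P: h => _ _ hf hg; rewrite all_cat IHf // IHg.
Qed.

Lemma okfom_node j : okfom V (node j).
Proof.
case: (ltnP j T) => [jT|/node_default -> //].
by have /all_nthP := okfom_subs ok; apply.
Qed.

Local Notation aut := (automatic dim).

Lemma automatic_if P P1 P2 : aut P -> aut P1 -> aut P2 ->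
  aut (fun t L a b => if P t L a b then P1 t L a b else P2 t L a b).
Proof.
move=> h h1 h2.
have := automatic_op orb (automatic_op andb h h1) (automatic_op (fun x y => ~~ x && y) h h2).
by apply: automatic_ext => t L a b; case: (P t L a b); rewrite //= orbF.
Qed.

Lemma automatic_tagged j : aut (fun _ _ a _ => tagged j a) /\ aut (fun _ _ _ b => tagged j b).
Proof.
split; apply: automatic_all => i; rewrite mem_iota add0n => /T_lt_D iD;
  case: (_ && _).
- exact: (automatic_one (TA (Ordinal iD))).
- exact: (automatic_zero (TA (Ordinal iD))).
- exact: (automatic_one (TB (Ordinal iD))).
- exact: (automatic_zero (TB (Ordinal iD))).
Qed.

Lemma automatic_tagof j : aut (fun _ _ a _ => tagof a == j) /\ aut (fun _ _ _ b => tagof b == j).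
Proof. by split; apply: automatic_find => i _; have [] := automatic_tagged i. Qed.

Lemma automatic_node (P : nat -> pred4) :
  (forall j, aut (P j)) -> aut (fun t L a b => P (tagof a) t L a b).
Proof.
move=> h; have := @automatic_has dim _ (fun j t L a b => (tagof a == j) && P j t L a b) (iota 0 T.+1).
move=> h'; have := h' (fun j _ => automatic_op andb (automatic_tagof j).1 (h j)).
apply: automatic_ext => t L a b; apply/hasP/idP => [[j _ /andP[/eqP <-]] //|hP].
by exists (tagof a); rewrite ?eqxx // mem_iota ltnS tagof_le.
Qed.

Lemma automatic_atom A : okatom V A -> aut (fun _ L a _ => atomv A L a).
Proof.
case: A => [i j /= /andP[/V_lt_D hi /V_lt_D hj]|i /= /V_lt_D hi|i /= /V_lt_D hi
  |i /= /V_lt_D hi|i /= /V_lt_D hi].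
- exact: (automatic_lt (TA (Ordinal hi)) (TA (Ordinal hj))).
- exact: (automatic_lt (TA (Ordinal hi)) (TLen dim)).
- exact: (automatic_zero (TA (Ordinal hi))).
- exact: (automatic_one (TA (Ordinal hi))).
- exact: (automatic_pow2 (TA (Ordinal hi))).
Qed.

Definition inrange (L : nat) (a : nat -> nat) : bool :=
  all (fun i => a i < 2 ^ size (binary L)) (iota 0 D).

Lemma inrangeP L a : reflect (forall i, i < D -> a i < 2 ^ size (binary L)) (inrange L a).
Proof.
apply: (iffP allP) => h i; first by move=> iD; apply: h; rewrite mem_iota.
by rewrite mem_iota => /h.
Qed.

Lemma automatic_inrange :
  aut (fun _ L a _ => inrange L a) /\ aut (fun _ L _ b => inrange L b).
Proof.
split; apply: automatic_all => i; rewrite mem_iota add0n => iD.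
- exact: (automatic_len (TA (Ordinal iD))).
- exact: (automatic_len (TB (Ordinal iD))).
Qed.

Lemma automatic_edge : aut (fun _ _ a b => edgen a b).
Proof.
pose P j (t : 'I_6) (L : nat) a b := has (fun c => tagof b == c) (kids j) &&
  all (fun i => (i \in qvars j) || (a i == b i)) (iota 0 V).
have h j : aut (P j).
  apply: (automatic_op andb).
    by apply: automatic_has => c _; have [] := automatic_tagof c.
  apply: automatic_all => i; rewrite mem_iota add0n => /V_lt_D iD.
  apply: (automatic_op orb (automatic_tag _ (fun=> i \in qvars j))).
  exact: (automatic_eq (TA (Ordinal iD)) (TB (Ordinal iD))).
apply: automatic_ext (automatic_node h) => t L a b; congr andb.
by apply/hasP/idP => [[c ck /eqP ->] //|hk]; exists (tagof b).
Qed.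

Lemma automatic_label : aut (fun t L a b =>
  (gate_tag (labn (node (tagof a)) L a) == t) && (gate_arg (labn (node (tagof a)) L a) == b 0)).
Proof.
pose P f (t : 'I_6) L a b := (gate_tag (labn f L a) == t) && (gate_arg (labn f L a) == b 0).
suff h j : aut (P (node j)) by exact: (automatic_node h).
have D0 : 0 < D by [].
have hb : aut (fun _ _ _ b => 0 == b 0).
  have := automatic_zero (TB (Ordinal D0)); apply: automatic_ext => t L a b.
  by rewrite eq_sym.
have con (c : nat) : aut (fun t _ _ b => (c == t :> nat) && (0 == b 0)).
  exact: (automatic_op andb (automatic_tag _ (fun t => c == t :> nat)) hb).
have := okfom_node j; rewrite /P; case: (node j) => [A|i|f|[] xs f g] okn.
- have := automatic_if (automatic_atom okn) (con 1) (con 2).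
  apply: automatic_ext => t L a b /=; by case: (atomv A L a).
- have iD := V_lt_D okn.
  have hi := automatic_op andb (automatic_tag dim (fun t => 4 == t :> nat))
                (automatic_eq (TA (Ordinal iD)) (TB (Ordinal D0))).
  have := automatic_if (automatic_lt (TA (Ordinal iD)) (TLen dim)) hi (con 2).
  by apply: automatic_ext => t L a b /=; case: (a i < L).
- exact: (con 0).
- exact: (con 1).
- exact: (con 2).
- exact: (con 3).
Qed.

Definition dc_pred : pred4 := fun t L a b =>
  (inrange L a && inrange L b) &&
  (if val t == wire_tag then edgen a b
   else (gate_tag (labn (node (tagof a)) L a) == t) &&
        (gate_arg (labn (node (tagof a)) L a) == b 0)).

Lemma automatic_dc : aut dc_pred.
Proof.
apply: (automatic_op andb (automatic_op andb automatic_inrange.1 automatic_inrange.2)).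
apply: automatic_if; [|exact: automatic_edge|exact: automatic_label].
exact: (automatic_tag dim (fun t => val t == wire_tag)).
Qed.

Lemma DLOGTIME_ext (S : finType) (L L' : seq S -> Prop) :
  (forall w, L w <-> L' w) -> DLOGTIME L -> DLOGTIME L'.
Proof.
move=> e [M [c [ar h]]]; exists M, c; split => // w; have [h1 h2] := h w.
by split => [/e/h1|n] //; apply: h2 => /e.
Qed.

Lemma gate_arg_lt j L a : inrange L a ->
  gate_arg (labn (node j) L a) < 2 ^ size (binary L).
Proof.
have p : 0 < 2 ^ size (binary L) by rewrite expn_gt0.
move/inrangeP => h; have := okfom_node j.
case: (node j) => [A|i|f|[] xs f g] //=; first by case: ifP.
by move=> /V_lt_D iV; case: ifP => // _; apply: h.
Qed.

Lemma gate_tag_lt l : gate_tag l < 5.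
Proof. by case: l. Qed.

Lemma circ_uniform : DLOGTIME (direct_connection circ).
Proof.
have rg t L a b : dc_pred t L a b -> forall i, i < D ->
     a i < 2 ^ size (binary L) /\ b i < 2 ^ size (binary L).
  by case/andP=> /andP[/inrangeP ha /inrangeP hb] _ i iD; split; [apply: ha|apply: hb].
apply: DLOGTIME_ext (automatic_DLOGTIME automatic_dc rg) => w; split.
  move=> [t [g [h [y [-> /andP[/andP[/inrangeP ra /inrangeP rb]]]]]]].
  have gP : g < (2 ^ (D * size (binary (size y)))).-1.+1.
    by rewrite prednK ?expn_gt0 //; apply: lt_dec.
  move: rb; rewrite /decw; case: eqP => [-> rb e|tn rb /andP[/eqP <- /eqP <-]].
    have hP : h < (2 ^ (D * size (binary (size y)))).-1.+1.
      by rewrite prednK ?expn_gt0 //; apply: lt_dec.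
    by exists y, (Ordinal gP); right; exists (Ordinal hP).
  by exists y, (Ordinal gP); left.
move=> [y [g]]; have gP : g < 2 ^ (D * size (binary (size y))).
  by rewrite -[leqRHS]prednK ?expn_gt0.
have ra : inrange (size y) (dec D g) by apply/inrangeP => i iD; apply: dec_lt.
case=> [->|[h eh ->]].
  have t6 : gate_tag (clabel g) < 6 by apply: leq_trans (gate_tag_lt _) _.
  exists (Ordinal t6), g, (gate_arg (clabel g)), y; split => //.
  rewrite /dc_pred ra /decw /= ltn_eqF ?gate_tag_lt // !eqxx !andbT.
  apply/inrangeP => i iD; case: eqP => _; last by rewrite expn_gt0.
  exact: gate_arg_lt.
have hP : h < 2 ^ (D * size (binary (size y))) by rewrite -[leqRHS]prednK ?expn_gt0.
exists (Ordinal (isT : 5 < 6)), g, h, y; split => //.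
rewrite /dc_pred ra /decw /= [edgen _ _]eh andbT.
by apply/inrangeP => i iD; apply: dec_lt.
Qed.

Section Evaluation.
Variable x : seq bool.
Local Notation L := (size x).
Local Notation B := (2 ^ size (binary L)).
Local Notation C := (circ L).
Hypothesis L0 : 0 < L.

Definition gate_of (j : nat) (u : nat -> nat) : 'I_(cmax C).+1 :=
  inord (code D (size (binary L)) (gvec j u)).

Lemma ell_gt0 : 0 < size (binary L).
Proof. by rewrite ltnNge size_binary expn0 -leqNgt. Qed.

Lemma B_gt1 : 1 < B.
Proof. by rewrite -{1}(expn0 2) ltn_exp2l // ell_gt0. Qed.

Lemma val_gate_of j u : gate_of j u = code D (size (binary L)) (gvec j u) :> nat.
Proof. by rewrite inordK // /C /= prednK ?expn_gt0 // code_lt. Qed.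

Lemma gate_lt (g : 'I_(cmax C).+1) : g < 2 ^ (D * size (binary L)).
Proof. by rewrite -[leqRHS]prednK ?expn_gt0. Qed.

Definition inB (u : nat -> nat) : Prop := forall i, i < V -> u i < B.

Lemma dec_gate_of j u i : inB u -> i < D -> dec D (gate_of j u) i = gvec j u i.
Proof.
move=> uB iD; rewrite val_gate_of dec_code // /gvec; case: ifP => [/uB //|_].
by apply: leq_trans B_gt1; case: (_ && _).
Qed.

Lemma tagof_gate_of j u : j < T -> inB u -> tagof (dec D (gate_of j u)) = j.
Proof.
move=> jT uB; rewrite (@tagof_ext _ (gvec j u)) ?tagof_gvec // => i iD.
exact: dec_gate_of.
Qed.

Lemma dec_gate_of_var j u i : inB u -> i < V -> dec D (gate_of j u) i = u i.
Proof. by move=> uB iV; rewrite dec_gate_of ?V_lt_D // /gvec iV. Qed.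

Lemma inB_setw xs Z u : inB u -> inB (setw B xs Z u).
Proof.
move=> uB i iV; case: (boolP (i \in xs)) => h; first by rewrite setw_lt // expn_gt0.
by rewrite setw_notin // uB.
Qed.

Lemma qvars_ok j : uniq (qvars j) /\ {in qvars j, forall i, i < V}.
Proof.
have := okfom_node j; rewrite /qvars; case: (node j) => //= k xs f g.
by case/and4P=> un /allP.
Qed.

Definition child_gates (j : nat) (u : nat -> nat) : seq 'I_(cmax C).+1 :=
  [seq gate_of c (setw B (qvars j) Z u) | c <- kids j, Z <- iota 0 (B ^ size (qvars j))].

Lemma edge_gate_of j u h : j < T -> inB u ->
  cedge (gate_of j u) h = (h \in child_gates j u).
Proof.
move=> jT uB; have [un xsV] := qvars_ok j.
rewrite /= /edgen tagof_gate_of //; apply/andP/allpairsP.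
  move=> [ck /allP eqv]; set a := dec D h in ck eqv.
  have aB i : i < D -> a i < B by move=> iD; apply: dec_lt => //; apply: gate_lt.
  have aq : {in qvars j, forall i, a i < B} by move=> i /xsV /V_lt_D /aB.
  exists (tagof a, wval B (qvars j) a); split => //=.
    by rewrite mem_iota add0n wval_lt.
  apply: ord_inj; rewrite val_gate_of.
  rewrite -[LHS](@code_dec D _ (size (binary L))) ?gate_lt //; apply: eq_code => // i iD.
  have [_ tT] := andP (kids_lt ck).
  rewrite -/a -gvec_tagof // /gvec; case: ifP => // iV.
  case: (boolP (i \in qvars j)) => iq; first by rewrite setw_wval.
  have := eqv i; rewrite mem_iota add0n => /(_ iV); rewrite (negbTE iq) /= => /eqP.
  by rewrite dec_gate_of_var // setw_notin.
move=> [[c Z] /= [ck Zl ->]]; have sB := @inB_setw (qvars j) Z u uB.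
have [_ cT] := andP (kids_lt ck).
rewrite tagof_gate_of // ck; split => //; apply/allP => i; rewrite mem_iota add0n => iV.
by rewrite !dec_gate_of_var //; case: (boolP (i \in _)) => //= iq; rewrite setw_notin.
Qed.

Lemma uniq_child_gates j u : j < T -> inB u -> uniq (child_gates j u).
Proof.
move=> jT uB; have [un xsV] := qvars_ok j.
have ukids : uniq (kids j).
  rewrite /kids; case: (node j) => //= k xs f g; rewrite inE andbT.
  by have := size_subs_gt0 f; lia.
apply: allpairs_uniq => //; first exact: iota_uniq.
move=> _ _ /allpairsP[[c Z] /= [ck Zl ->]] /allpairsP[[c' Z'] /= [ck' Zl' ->]] /= e.
have cT := andP (kids_lt ck); have cT' := andP (kids_lt ck').
have e1 := congr1 (fun g : 'I__ => tagof (dec D g)) e.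
rewrite /= !tagof_gate_of ?cT.2 ?cT'.2 // in e1; try exact: inB_setw.
have e2 := congr1 (fun g : 'I__ => wval B (qvars j) (dec D g)) e.
have hw c0 Z0 : Z0 \in iota 0 (B ^ size (qvars j)) ->
    wval B (qvars j) (dec D (gate_of c0 (setw B (qvars j) Z0 u))) = Z0.
  rewrite mem_iota add0n => Zl0; rewrite -[RHS](@wval_setw B (qvars j) Z0 u) //.
  by apply: wval_ext => i /xsV iV; rewrite dec_gate_of_var //; apply: inB_setw.
by rewrite /= !hw // in e2; rewrite e1 e2.
Qed.

Lemma card_edges j u (P : pred 'I_(cmax C).+1) : j < T -> inB u ->
  #|[set h | cedge (gate_of j u) h && P h]| =
  sumn [seq count (fun v => P (gate_of c v)) (envs B (qvars j) u) | c <- kids j].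
Proof.
move=> jT uB; transitivity #|[seq h <- child_gates j u | P h]|.
  by apply: eq_card => h; rewrite !inE mem_filter edge_gate_of // andbC.
have /card_uniqP -> : uniq [seq h <- child_gates j u | P h].
  by rewrite filter_uniq // uniq_child_gates.
rewrite size_filter /child_gates count_flatten -map_comp; congr sumn.
by apply: eq_map => c /=; rewrite !count_map.
Qed.

Lemma card_edges_all j u : j < T -> inB u ->
  #|[set h | cedge (gate_of j u) h]| = size (kids j) * B ^ size (qvars j).
Proof.
move=> jT uB; rewrite -[size (kids j)]mul1n -(@eq_card _ [set h | cedge (gate_of j u) h && true]).
  rewrite card_edges // (@eq_map _ _ _ (fun=> B ^ size (qvars j))).
    by elim: (kids j) => //= _ s ->; lia.
  by move=> c; rewrite count_predT size_map size_iota.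
by move=> h; rewrite !inE andbT.
Qed.

Lemma forall_edges j u (P : pred 'I_(cmax C).+1) : j < T -> inB u ->
  [forall (h | cedge (gate_of j u) h), P h] =
  all (fun c => all (fun v => P (gate_of c v)) (envs B (qvars j) u)) (kids j).
Proof.
move=> jT uB; apply/forall_inP/allP => [h c ck|h g].
  apply/(all_nthP u) => i il.
  rewrite size_map size_iota in il; apply: h.
  rewrite edge_gate_of // (nth_map 0) ?size_iota // nth_iota // add0n.
  by apply/allpairsP; exists (c, i); split; rewrite //= mem_iota.
rewrite edge_gate_of // => /allpairsP[[c Z] /= [ck Zl ->]].
have /(all_nthP u)/(_ Z) := h c ck; rewrite size_map size_iota.
rewrite mem_iota in Zl; move/(_ Zl); rewrite (nth_map 0) ?size_iota //.
by rewrite nth_iota.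
Qed.

Lemma exists_edges j u (P : pred 'I_(cmax C).+1) : j < T -> inB u ->
  [exists (h | cedge (gate_of j u) h), P h] =
  has (fun c => has (fun v => P (gate_of c v)) (envs B (qvars j) u)) (kids j).
Proof.
move=> jT uB; rewrite -[LHS]negbK negb_exists_in forall_edges // -[RHS]negbK -all_predC.
congr negb; apply: eq_all => c; exact: all_predC.
Qed.

Lemma atomv_ext A l u v : okatom V A -> (forall i, i < V -> u i = v i) -> atomv A l u = atomv A l v.
Proof. by case: A => [i j /andP[hi hj]|i hi|i hi|i hi|i hi] e /=; rewrite !e. Qed.

Lemma eval_gate f s1 s2 u fuel : subs root = s1 ++ subs f ++ s2 ->
  size (subs f) <= fuel -> okfom V f -> inB u ->
  gate_value x fuel (gate_of (size s1) u) = sem L x B f u.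
Proof.
elim: f s1 s2 u fuel => [A|i|f IH|k xs f IHf g IHg] s1 s2 u [|fuel] //= e szf okf uB;
  set j := size s1;
  (have jT : j < T by rewrite e size_cat /= addnS ltnS leq_addr);
  (have nj : node j = nth (QAtm (AZero 0)) (subs root) j by []);
  rewrite e nth_cat ltnn subnn /= in nj; rewrite tagof_gate_of // nj /=.
- have -> : atomv A L (dec D (gate_of j u)) = atomv A L u.
    by apply: atomv_ext => // i; apply: dec_gate_of_var.
  have kj : kids j = [::] by rewrite /kids nj.
  by case: (atomv A L u); rewrite ?forall_edges ?exists_edges // kj.
- rewrite dec_gate_of_var //; case: ltnP => //= _.
  by rewrite exists_edges // /kids nj.
- rewrite forall_edges // /kids /qvars nj /envs /= ?expn0 /= !andbT; congr negb.
  have e' : subs root = rcons s1 (QNot f) ++ subs f ++ s2 by rewrite cat_rcons e.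
  by rewrite -(IH _ _ _ fuel e') // size_rcons.
have /and4P[un xsV okF okG] := okf.
have eF : subs root = rcons s1 (QNode k xs f g) ++ subs f ++ (subs g ++ s2).
  by rewrite cat_rcons e /= -catA.
have eG : subs root = (s1 ++ QNode k xs f g :: subs f) ++ subs g ++ s2.
  by rewrite e -[RHS]catA /= -catA.
have kj : kids j = [:: j.+1; j.+1 + size (subs f)] by rewrite /kids nj.
have qj : qvars j = xs by rewrite /qvars nj.
have hF v : inB v -> gate_value x fuel (gate_of j.+1 v) = sem L x B f v.
  move=> vB; rewrite -(IHf _ _ _ fuel eF) // ?size_rcons //.
  by move: szf; rewrite ltnS size_cat; apply: leq_trans; rewrite leq_addr.
have hG v : inB v -> gate_value x fuel (gate_of (j.+1 + size (subs f)) v) = sem L x B g v.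
  move=> vB; rewrite -(IHg _ _ _ fuel eG) // ?size_cat /= ?addnS //.
  by move: szf; rewrite ltnS size_cat; apply: leq_trans; rewrite leq_addl.
have cF : count (fun v => gate_value x fuel (gate_of j.+1 v)) (envs B xs u) =
          count (sem L x B f) (envs B xs u).
  by rewrite !count_map; apply: eq_count => Z /=; apply/hF/inB_setw.
have cG : count (fun v => gate_value x fuel (gate_of (j.+1 + size (subs f)) v)) (envs B xs u) =
          count (sem L x B g) (envs B xs u).
  by rewrite !count_map; apply: eq_count => Z /=; apply/hG/inB_setw.
case: k {e okf eF eG nj} => /=.
- rewrite forall_edges // kj qj /= andbT -all_predI /envs !all_map; apply: eq_all => Z /=.
  by rewrite hF ?hG //; apply: inB_setw.
- rewrite exists_edges // kj qj /= orbF -has_predU /envs !has_map; apply: eq_has => Z /=.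
  by rewrite hF ?hG //; apply: inB_setw.
rewrite card_edges_all // card_edges // kj qj /= cF cG addn0 size_envs.
by rewrite ltn_pmul2l.
Qed.

Lemma eval_circ : circuit_value C x = sem L x B root (fun=> 0).
Proof.
have z : ord0 = gate_of 0 (fun=> 0).
  apply: ord_inj; rewrite val_gate_of /=; apply: bit_inj => n.
  rewrite bit0n bit_mkseq /gvec; case: ifP => _; rewrite ?andbF ?bit0n ?andbF //.
rewrite /circuit_value z -(@eval_gate root [::] [::] _ (csize C)) ?cats0 //.
  rewrite /csize /= prednK ?expn_gt0 //.
  apply: leq_trans (ltnW (ltn_expl T (isT : 1 < 2))) _; rewrite leq_pexp2l //.
  apply: (@leq_trans D); first by rewrite /dim; have := size_subs_gt0 root; lia.
  by rewrite leq_pmulr // ell_gt0.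
by move=> i _; rewrite expn_gt0.
Qed.

Lemma gate_ofE (g : 'I_(cmax C).+1) :
  tagof (dec D g) < T -> g = gate_of (tagof (dec D g)) (dec D g).
Proof.
move=> tT; apply: ord_inj; rewrite val_gate_of.
rewrite -[LHS](@code_dec D _ (size (binary L))) ?gate_lt //.
by apply: eq_code => // i iD; rewrite gvec_tagof.
Qed.

Lemma circ_wf_pos : circuit_wf L C.
Proof.
move=> g; case: (ltnP (tagof (dec D g)) T) => tT; last first.
  by rewrite /= (node_default tT) /=; case: ifP.
have uB : inB (dec D g).
  by move=> i /V_lt_D iD; apply: dec_lt => //; apply: gate_lt.
have ce := card_edges_all tT uB; rewrite -gate_ofE // in ce.
rewrite [clabel g]/=; move: ce; rewrite /kids /qvars.
case: (node _) => [A|i|f|[] xs f h] //=; first by case: ifP.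
by case: ifP.
Qed.

End Evaluation.

Lemma tagof_circ0 (g : 'I_(cmax (circ 0)).+1) : tagof (dec D g) = 0.
Proof.
have z : g = 0 :> nat.
  have : g < 2 ^ (D * size (binary 0)) by rewrite -[leqRHS]prednK ?expn_gt0.
  by rewrite muln0; case: (nat_of_ord g).
apply: tagof_eq; first exact: size_subs_gt0.
by apply/allP => i _; rewrite z /dec andbF.
Qed.

Lemma clabel_circ0 (g : 'I_(cmax (circ 0)).+1) : clabel g = Or.
Proof.
have : root = node 0 by rewrite /node; case: (root).
by rewrite [clabel g]/= tagof_circ0; move: isOr; case: (root) => // -[] // xs f h _ <-.
Qed.

Lemma circ_wf n : circuit_wf n (circ n).
Proof.
case: (posnP n) => [-> g|n0]; first by rewrite clabel_circ0.
by have := @circ_wf_pos (nseq n false); rewrite size_nseq; apply.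
Qed.

Theorem fom_TC0 : DLOGTIME_uniform_TC0 (fun x =>
  0 < size x /\ sem (size x) x (2 ^ size (binary (size x))) root (fun=> 0)).
Proof.
exists circ; split; [exact: circ_uniform|exact: circ_wf| |exact: circ_size|].
  by exists T => n; apply: circ_depth.
move=> x; case: (posnP (size x)) => [/size0nil ->|x0]; last by rewrite eval_circ //; split=> [|[]].
split=> [|[]] //; rewrite /circuit_value /csize.
rewrite [gate_value _ _ _]/= -[labn _ _ _]/(clabel (ord0 : 'I_(cmax (circ 0)).+1)) clabel_circ0.
case/exists_inP => h /edgen_lt; by rewrite !tagof_circ0.
Qed.

End Circuits.

(** * Arithmetic in the logic *)

Definition upd (v : nat -> nat) (x a : nat) : nat -> nat := fun y => if y == x then a else v y.

Lemma upd_same v x a : upd v x a x = a.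
Proof. by rewrite /upd eqxx. Qed.

Lemma upd_other v x a y : y != x -> upd v x a y = v y.
Proof. by rewrite /upd => /negbTE ->. Qed.

Definition qfalse : fom := QAtm (ALt 0 0).
Definition qtrue : fom := QNot qfalse.
Definition qand f g : fom := QNode KAnd [::] f g.
Definition qor f g : fom := QNode KOr [::] f g.
Definition qimp f g : fom := qor (QNot f) g.
Definition qex x f : fom := QNode KOr [:: x] f f.
Definition qall x f : fom := QNode KAnd [:: x] f f.
Definition qlt x y : fom := QAtm (ALt x y).
Definition qle x y : fom := QNot (qlt y x).
Definition qeq x y : fom := qand (qle x y) (qle y x).
Definition qmore xs f g : fom := QNode KMaj xs f (QNot g).
Definition qsame xs f g : fom := qand (QNot (qmore xs f g)) (QNot (qmore xs g f)).
Definition qzeros xs k : fom := foldr (fun x f => qand (QAtm (AZero x)) f) k xs.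

Section Semantics.
Variables (L : nat) (x : seq bool) (B : nat).
Hypothesis B0 : 0 < B.
Local Notation sem := (sem L x B).
Local Notation envs := (envs B).
Local Notation setw := (setw B).
Local Notation wval := (wval B).

Lemma envs0 v : envs [::] v = [:: v].
Proof. by []. Qed.

Lemma count_envs0 v (P : pred (nat -> nat)) : count P (envs [::] v) = P v.
Proof. by rewrite envs0 /= addn0. Qed.

Lemma setw1 y Z v : Z < B -> setw [:: y] Z v = upd v y Z.
Proof. by move=> ZB; apply: functional_extensionality => z; rewrite /= modn_small. Qed.

Lemma envs1 y v : envs [:: y] v = [seq upd v y a | a <- iota 0 B].
Proof.
rewrite envsE [size _]/= expn1; apply/eq_in_map => Z; rewrite mem_iota add0n => ZB.
exact: setw1.
Qed.

Lemma sem_atom A v : sem (QAtm A) v = atomv A L v.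
Proof. by []. Qed.

Lemma sem_in i v : sem (QIn i) v = (v i < L) && nth false x (v i).
Proof. by []. Qed.

Lemma sem_not f v : sem (QNot f) v = ~~ sem f v.
Proof. by []. Qed.

Lemma sem_and f g v : sem (qand f g) v = sem f v && sem g v.
Proof. by rewrite /= ?envs0 /= andbT. Qed.

Lemma sem_or f g v : sem (qor f g) v = sem f v || sem g v.
Proof. by rewrite /= ?envs0 /= orbF. Qed.

Lemma sem_imp f g v : sem (qimp f g) v = (sem f v ==> sem g v).
Proof. by rewrite /qimp sem_or /= implybE. Qed.

Lemma sem_le y z v : sem (qle y z) v = (v y <= v z).
Proof. by rewrite /= -leqNgt. Qed.

Lemma sem_eq y z v : sem (qeq y z) v = (v y == v z).
Proof. by rewrite sem_and !sem_le eqn_leq. Qed.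

Lemma sem_false v : sem qfalse v = false.
Proof. by rewrite /= ltnn. Qed.

Lemma sem_true v : sem qtrue v.
Proof. by rewrite /= ltnn. Qed.

Lemma sem_exP y f v : reflect (exists2 a, a < B & sem f (upd v y a)) (sem (qex y f) v).
Proof.
rewrite /= envs1 has_map; apply: (iffP hasP) => [[a]|[a aB h]].
  by rewrite mem_iota add0n /= orbb => aB h; exists a.
by exists a; rewrite ?mem_iota //= orbb.
Qed.

Lemma sem_allP y f v : reflect (forall a, a < B -> sem f (upd v y a)) (sem (qall y f) v).
Proof.
rewrite /= envs1 all_map; apply: (iffP allP) => [h a aB|h a].
  by have := h a; rewrite mem_iota add0n /= andbb; apply.
by rewrite mem_iota add0n /= andbb; apply: h.
Qed.

Lemma sem_more xs f g v :
  sem (qmore xs f g) v = (count (sem g) (envs xs v) < count (sem f) (envs xs v)).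
Proof.
rewrite /=; set l := envs xs v.
have <- := count_predC (sem g) l.
rewrite (eq_count (_ : (fun u => ~~ sem g u) =1 predC (sem g))) //.
by rewrite ltn_add2r.
Qed.

Lemma sem_same xs f g v :
  sem (qsame xs f g) v = (count (sem f) (envs xs v) == count (sem g) (envs xs v)).
Proof. by rewrite sem_and !sem_not !sem_more -!leqNgt eqn_leq. Qed.

Lemma sem_zeros xs k v : sem (qzeros xs k) v = all (fun y => v y == 0) xs && sem k v.
Proof. by elim: xs => // y xs IH; rewrite [qzeros _ _]/= sem_and IH /= andbA. Qed.

Lemma sum_divmod n (G : nat -> nat -> nat) :
  \sum_(Z < B * n) G (Z %% B) (Z %/ B) = \sum_(a < B) \sum_(Z < n) G a Z.
Proof.
rewrite exchange_big /=; elim: n => [|n IH]; first by rewrite muln0 !big_ord0.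
rewrite big_ord_recr /= -IH mulnS addnC -(big_mkord xpredT (fun Z => G (Z %% B) (Z %/ B))).
rewrite (@big_cat_nat _ _ _ (B * n)) //= ?leq_addr // big_mkord; congr addn.
rewrite -{1}[B * n]add0n big_addn addKn big_mkord; apply: eq_bigr => a _.
by rewrite addnC mulnC modnMDl modn_small // divnMDl // divn_small // addn0.
Qed.

Lemma setw_cons y ys Z v : y \notin ys ->
  setw (y :: ys) Z v = setw ys (Z %/ B) (upd v y (Z %% B)).
Proof.
move=> yn; apply: functional_extensionality => z /=.
elim: ys (Z %/ B) yn => [|w ys IH] Z' /=; first by [].
rewrite inE negb_or => /andP[yw yn]; case: (eqVneq z w) => [->|zw].
  by rewrite eq_sym (negbTE yw).
exact: IH.
Qed.

Lemma count_envs_cons y ys v (P : pred (nat -> nat)) : y \notin ys ->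
  count P (envs (y :: ys) v) = \sum_(a < B) count P (envs ys (upd v y a)).
Proof.
move=> yn; rewrite count_envs /= expnS.
pose G a Z : nat := P (setw ys Z (upd v y a)).
transitivity (\sum_(Z < B * B ^ size ys) G (Z %% B) (Z %/ B)).
  by apply: eq_bigr => Z _; rewrite /G -setw_cons.
rewrite sum_divmod; by apply: eq_bigr => a _; rewrite count_envs.
Qed.

Lemma count_envs_cat xs ys v (P : pred (nat -> nat)) : uniq (xs ++ ys) ->
  count P (envs (xs ++ ys) v) = \sum_(Z < B ^ size xs) count P (envs ys (setw xs Z v)).
Proof.
elim: xs v => [|y xs IH] v /=; first by rewrite expn0 big_ord1.
case/andP=> yn un; rewrite count_envs_cons // expnS.
pose G a Z : nat := count P (envs ys (setw xs Z (upd v y a))).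
have yxs : y \notin xs by apply: contra yn; rewrite mem_cat => ->.
transitivity (\sum_(Z < B * B ^ size xs) G (Z %% B) (Z %/ B)); last first.
  by apply: eq_bigr => Z _; rewrite /G -setw_cons.
rewrite sum_divmod; by apply: eq_bigr => a _; rewrite IH.
Qed.

Lemma wval_eq0 xs v : (wval xs v == 0) = all (fun y => v y == 0) xs.
Proof. by elim: xs => //= y xs IH; rewrite addn_eq0 muln_eq0 (gtn_eqF B0) IH. Qed.

Lemma count_zeros ys v (P : pred (nat -> nat)) : uniq ys ->
  count (fun u => all (fun y => u y == 0) ys && P u) (envs ys v) = P (setw ys 0 v).
Proof.
move=> un; have p : 0 < B ^ size ys by rewrite expn_gt0 B0.
rewrite count_envs (bigD1 (Ordinal p)) //= -wval_eq0 wval_setw // eqxx /=.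
rewrite big1 ?addn0 // => Z Z0; rewrite -wval_eq0 wval_setw //.
by move: Z0; rewrite -val_eqE /= => /negbTE ->.
Qed.

Lemma sum_interval c z : z <= B -> \sum_(t < B) ((c <= t) && (t < z)) = z - c.
Proof.
move=> zB; elim: z zB => [|z IH] zB.
  by rewrite big1 // => t _; rewrite ltn0 andbF.
rewrite (bigD1 (Ordinal zB)) //= ltnSn andbT.
have := IH (ltnW zB); rewrite (bigD1 (Ordinal zB)) //= ltnn andbF add0n => h.
rewrite (eq_bigr (fun t : 'I_B => ((c <= t) && (t < z)) : nat)) => [|t].
  by rewrite h; case: leqP => /=; lia.
by rewrite -val_eqE /= => tz; rewrite ltnS [t <= z]leq_eqVlt (negbTE tz).
Qed.

(* [vZ] is never assigned and keeps the value 0; [vN] is the size of the domain,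
   [vO] an offset in the input, [vP] an accumulator, [vA] an address; [pv y] stands
   for the variable [y] of the given formula. *)
Definition vS := 0. Definition vT := 1. Definition vQ := 2. Definition vP := 3.
Definition vO := 4. Definition vA := 5. Definition vN := 6. Definition vOne := 7.
Definition vZ := 8. Definition vI := 9. Definition vJ := 10.
Definition pv (y : nat) := 11 + y.

(* [z = y1 * y2 + a], where [z - a] and [y1 * y2] are compared as numbers of pairs. *)
Definition qmuladd y1 y2 a z : fom :=
  qand (qle a z) (qsame [:: vS; vT]
    (qand (QAtm (AZero vS)) (qand (qle a vT) (qlt vT z)))
    (qand (qlt vS y1) (qlt vT y2))).

Lemma sem_muladd y1 y2 a z v :
  [&& 1 < y1, 1 < y2, 1 < a & 1 < z] -> (forall y, v y < B) ->
  sem (qmuladd y1 y2 a z) v = (v z == v y1 * v y2 + v a).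
Proof.
have up c s t : 1 < c -> upd (upd v vS s) vT t c = v c.
  by case: c => [|[]].
case/and4P=> h1 h2 ha hz vB; rewrite sem_and sem_le sem_same.
have -> : count (sem (qand (QAtm (AZero vS)) (qand (qle a vT) (qlt vT z)))) (envs [:: vS; vT] v)
    = v z - v a.
  rewrite count_envs_cons // (bigD1 (Ordinal B0)) // big1 => [|s s0].
    etransitivity; first exact: addn0.
    rewrite count_envs_cons // -(sum_interval _ (ltnW (vB z))).
    apply: eq_bigr => t _; rewrite count_envs0; congr nat_of_bool.
    by rewrite !sem_and sem_le /= upd_same !up.
  rewrite count_envs_cons // big1 // => t _; rewrite count_envs0.
  by rewrite sem_and /= /upd /=; move: s0; rewrite -val_eqE /= => /negbTE ->.
have -> : count (sem (qand (qlt vS y1) (qlt vT y2))) (envs [:: vS; vT] v) = v y1 * v y2.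
  rewrite count_envs_cons //.
  rewrite -{1}[v y1]subn0 -(sum_interval 0 (ltnW (vB y1))) big_distrl.
  apply: eq_bigr => s _; rewrite count_envs_cons //.
  rewrite -{1}[v y2]subn0 -(sum_interval 0 (ltnW (vB y2))) big_distrr.
  apply: eq_bigr => t _; rewrite count_envs0 sem_and /=.
  by rewrite upd_same [upd _ _ _ vS]upd_other // upd_same !up // mulnb.
by apply/andP/eqP => [[h /eqP e]|e]; [lia|split; [lia|apply/eqP; lia]].
Qed.

(* The instruction [(d, y1, y2, a)] is the assignment [d := y1 * y2 + a]. *)

Definition instr : Type := (nat * nat * nat * nat)%type.

Definition ires (i : instr) (v : nat -> nat) : nat :=
  let: (d, y1, y2, a) := i in v y1 * v y2 + v a.

Definition run1 (i : instr) (v : nat -> nat) : nat -> nat :=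
  upd (upd v vQ (ires i v)) i.1.1.1 (ires i v).

Definition qinstr (i : instr) (k : fom) : fom :=
  let: (d, y1, y2, a) := i in
  qex vQ (qand (qmuladd y1 y2 a vQ) (qex d (qand (qeq d vQ) k))).

Definition qprog (pr : seq instr) (k : fom) : fom := foldr qinstr k pr.

Definition oki (i : instr) : bool :=
  let: (d, y1, y2, a) := i in [&& 2 < d, 2 < y1, 2 < y2 & 2 < a].

Fixpoint okp (pr : seq instr) (v : nat -> nat) : bool :=
  if pr is i :: pr' then (ires i v < B) && okp pr' (run1 i v) else true.

Definition runp (pr : seq instr) (v : nat -> nat) : nat -> nat := foldl (fun v i => run1 i v) v pr.

Lemma upd_lt v y a : a < B -> (forall z, v z < B) -> forall z, upd v y a z < B.
Proof. by move=> aB vB z; rewrite /upd; case: ifP. Qed.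

Lemma sem_instr i k v : oki i -> (forall y, v y < B) ->
  sem (qinstr i k) v = (ires i v < B) && sem k (run1 i v).
Proof.
case: i => [[[d y1] y2] a] /and4P[hd h1 h2 ha] vB.
set r0 := v y1 * v y2 + v a.
change (sem (qex vQ (qand (qmuladd y1 y2 a vQ) (qex d (qand (qeq d vQ) k)))) v =
  (r0 < B) && sem k (upd (upd v vQ r0) d r0)).
have up c r : 2 < c -> upd v vQ r c = v c by case: c => [|[|[|]]].
apply/sem_exP/andP => [[r rB]|[rB h]].
  have vB' := upd_lt vQ rB vB.
  rewrite sem_and sem_muladd ?(ltn_trans _ h1) ?(ltn_trans _ h2) ?(ltn_trans _ ha) //.
  rewrite upd_same !up // => /andP[/eqP rE /sem_exP [r' rB']].
  rewrite sem_and sem_eq upd_same upd_other ?upd_same; last by case: d hd => [|[|[|]]].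
  by move=> /andP[/eqP -> h]; rewrite /r0 -rE.
exists r0 => //; have vB' := upd_lt vQ rB vB.
rewrite sem_and sem_muladd ?(ltn_trans _ h1) ?(ltn_trans _ h2) ?(ltn_trans _ ha) //.
rewrite upd_same !up // eqxx andTb; apply/sem_exP; exists r0 => //.
by rewrite sem_and sem_eq upd_same upd_other ?upd_same ?eqxx //; case: d hd {h} => [|[|[|]]].
Qed.

Lemma run1_lt i v : ires i v < B -> (forall y, v y < B) -> forall y, run1 i v y < B.
Proof. by move=> h vB y; apply: upd_lt => // z; apply: upd_lt. Qed.

Lemma sem_prog pr k v : all oki pr -> (forall y, v y < B) ->
  sem (qprog pr k) v = okp pr v && sem k (runp pr v).
Proof.
elim: pr v => //= i pr IH v /andP[oi ois] vB; rewrite sem_instr // -andbA.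
by case: ltnP => //= h; rewrite IH //; apply: run1_lt.
Qed.

Lemma runp_lt pr v : okp pr v -> (forall y, v y < B) -> forall y, runp pr v y < B.
Proof. by elim: pr v => //= i pr IH v /andP[h1 h2] vB; apply: IH => //; apply: run1_lt. Qed.

Lemma okp_cat pr pr' v : okp (pr ++ pr') v = okp pr v && okp pr' (runp pr v).
Proof. by elim: pr v => //= i pr IH v; rewrite IH andbA. Qed.

End Semantics.

(** * Positions in the encoding *)

Definition horner (n : nat) (s : seq nat) : nat := foldl (fun p a => p * n + a) 0 s.

Definition sumpow (n : nat) (rs : seq nat) : nat := sumn [seq n ^ r | r <- rs].

Lemma horner_rcons n s a : horner n (rcons s a) = horner n s * n + a.
Proof. by rewrite /horner -cats1 foldl_cat. Qed.

Lemma horner_lt n s : all (fun a => a < n) s -> horner n s < n ^ size s.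
Proof.
elim/last_ind: s => [|s a IH]; first by rewrite expn0.
rewrite all_rcons horner_rcons size_rcons expnS => /andP[an /IH].
by move: (horner n s) (n ^ size s) => h p hp; nia.
Qed.

Lemma horner_digit n s i : all (fun a => a < n) s -> i < size s ->
  horner n s %/ n ^ (size s - i.+1) %% n = nth 0 s i.
Proof.
elim/last_ind: s => // s a IH; rewrite all_rcons horner_rcons size_rcons nth_rcons.
case/andP=> an sn; rewrite ltnS subSS => is1.
have n0 : 0 < n by apply: leq_ltn_trans an.
case: ltngtP is1 => // [lt _|-> _]; last by rewrite subnn divn1 modnMDl modn_small.
have -> : size s - i = (size s - i.+1).+1 by lia.
by rewrite expnS divnMA divnMDl // (divn_small an) addn0 IH.
Qed.

Lemma horner_digits n r j : 0 < n -> j < n ^ r ->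
  horner n (mkseq (fun i => j %/ n ^ (r - i.+1) %% n) r) = j.
Proof.
move=> n0; elim: r j => [|r IH] j; first by rewrite expn0; case: j.
rewrite mkseqS horner_rcons subnn divn1 => jr.
rewrite [X in _ = X](divn_eq j n); congr (_ * n + _).
rewrite -[RHS]IH; last by rewrite ltn_divLR // mulnC -expnS.
congr horner; apply/eq_in_map => i; rewrite mem_iota add0n => ir.
by rewrite -divnMA -expnS; congr (_ %/ _ ^ _ %% _); lia.
Qed.

(** * Programs computing positions *)

Definition pw (r : nat) : seq instr := (vP, vZ, vZ, vOne) :: nseq r (vP, vP, vN, vZ).

Definition offprog (rs : seq nat) : seq instr :=
  flatten [seq rcons (pw r) (vO, vP, vOne, vO) | r <- rs].

Definition startprog (rs : seq nat) : seq instr := (vO, vN, vOne, vOne) :: offprog rs.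

Definition posprog (ys : seq nat) : seq instr :=
  (vP, vZ, vZ, vZ) :: [seq (vP, vP, vN, pv y) | y <- ys].

Definition addrprog (rs ys : seq nat) : seq instr :=
  startprog rs ++ rcons (posprog ys) (vA, vP, vOne, vO).

Definition dests : seq nat := [:: vQ; vP; vO; vA].

Definition base (n : nat) (v : nat -> nat) : Prop := [/\ v vN = n, v vOne = 1 & v vZ = 0].

Lemma runp_cat p q v : runp (p ++ q) v = runp q (runp p v).
Proof. exact: foldl_cat. Qed.

Lemma runp_cons i p v : runp (i :: p) v = runp p (run1 i v).
Proof. by []. Qed.

Lemma runp_notin (pr : seq instr) v y :
  y \notin vQ :: [seq i.1.1.1 | i <- pr] -> runp pr v y = v y.
Proof.
elim: pr v => //= i pr IH v; rewrite !inE !negb_or => /and3P[yQ yi ypr].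
by rewrite IH ?inE ?negb_or ?yQ // /run1 !upd_other.
Qed.

Lemma base_runp n pr v : all (mem dests) [seq i.1.1.1 | i <- pr] -> base n v ->
  base n (runp pr v).
Proof.
move=> /allP h [bN b1 bZ]; split; rewrite runp_notin // inE negb_or /=;
  by apply/negP => /h.
Qed.

Lemma run1_dest i v : run1 i v i.1.1.1 = ires i v.
Proof. by rewrite /run1 upd_same. Qed.

Lemma dests_pw r : all (mem dests) [seq i.1.1.1 | i <- pw r].
Proof. by rewrite /= all_map; apply/allP => i /nseqP[->]. Qed.

Lemma dests_off rs : all (mem dests) [seq i.1.1.1 | i <- offprog rs].
Proof.
elim: rs => // r rs IH.
rewrite (_ : offprog (r :: rs) = rcons (pw r) (vO, vP, vOne, vO) ++ offprog rs) //.
by rewrite map_cat all_cat IH andbT map_rcons all_rcons dests_pw.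
Qed.

Lemma oki_off rs : all oki (offprog rs).
Proof.
elim: rs => // r rs IH.
rewrite (_ : offprog (r :: rs) = rcons (pw r) (vO, vP, vOne, vO) ++ offprog rs) //.
rewrite all_cat IH andbT all_rcons /=; by apply/allP => i /nseqP[->].
Qed.

Section Programs.
Variables (B n : nat).
Hypothesis n0 : 0 < n.

Lemma run_pow r v : base n v -> runp (nseq r (vP, vP, vN, vZ)) v vP = v vP * n ^ r /\
  (v vP * n ^ r < B -> okp B (nseq r (vP, vP, vN, vZ)) v).
Proof.
elim: r v => [|r IH] v bv; first by rewrite muln1.
have [bN b1 bZ] := bv; rewrite /= expnS mulnA.
have bv' : base n (run1 (vP, vP, vN, vZ) v) by apply: (@base_runp n [:: _]).
have [-> okr] := IH _ bv'; move: okr.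
rewrite [run1 _ _ vP](run1_dest (vP, vP, vN, vZ)) /= bN bZ addn0; split => // h.
rewrite okr // andbT; apply: leq_ltn_trans h.
by rewrite leq_pmulr // expn_gt0 n0.
Qed.

Lemma run_off rs v : base n v -> runp (offprog rs) v vO = v vO + sumpow n rs /\
  (v vO + sumpow n rs < B -> 0 < v vO -> okp B (offprog rs) v).
Proof.
elim: rs v => [|r rs IH] v bv; first by rewrite addn0.
have [bN b1 bZ] := bv.
rewrite /offprog /= -/(offprog rs) -cats1 -catA /runp foldl_cat -/(runp _ _).
have bv1 : base n (run1 (vP, vZ, vZ, vOne) v) by apply: (@base_runp n [:: _]).
have v1P : run1 (vP, vZ, vZ, vOne) v vP = 1.
  by rewrite [run1 _ _ vP](run1_dest (vP, vZ, vZ, vOne)) /= bZ b1.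
have v1O : run1 (vP, vZ, vZ, vOne) v vO = v vO by [].
set v1 := run1 _ v in bv1 v1P v1O *.
have [rP okP] := run_pow r bv1; rewrite v1P mul1n in rP okP.
set v2 := runp (nseq r _) v1 in rP *.
have v2O : v2 vO = v vO.
  by rewrite -v1O; apply: runp_notin; rewrite inE negb_or /=; apply/negP => /mapP[i /nseqP[-> _]].
have bv2 : base n v2.
  by apply: base_runp => //; have /andP[] := dests_pw r.
have [b2N b21 b2Z] := bv2.
set v3 := run1 (vO, vP, vOne, vO) v2.
have v3O : v3 vO = v vO + n ^ r.
  by rewrite [v3 vO](run1_dest (vO, vP, vOne, vO)) /= rP b21 v2O muln1 addnC.
have bv3 : base n v3 by apply: (@base_runp n [:: _]).
have [rO okO] := IH _ bv3; rewrite v3O in rO okO.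
rewrite [sumpow n (r :: rs)]/= addnA; split; first exact: rO.
move=> lt pos; rewrite okp_cat /= -/v1 -/v2 -/v3 okO //; last by rewrite addn_gt0 pos.
have lt' : v vO + n ^ r < B by apply: leq_ltn_trans lt; apply: leq_addr.
rewrite bZ b1 rP b21 v2O muln1 [n ^ r + _]addnC lt' okP ?andbT //=; lia.
Qed.

Lemma run_start rs v : base n v ->
  runp (startprog rs) v vO = n.+1 + sumpow n rs /\
  (n.+1 + sumpow n rs < B -> okp B (startprog rs) v).
Proof.
move=> bv; have [bN b1 bZ] := bv.
have bv1 : base n (run1 (vO, vN, vOne, vOne) v) by apply: (@base_runp n [:: _]).
have [rO okO] := run_off rs bv1; move: rO okO.
rewrite [run1 _ _ vO](run1_dest (vO, vN, vOne, vOne)) /=. rewrite bN b1 muln1 addn1 => rO okO.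
split => // lt; rewrite okO // andbT; apply: leq_ltn_trans lt.
exact: leq_addr.
Qed.

Lemma foldl_horner_ge s p : p <= foldl (fun p a => p * n + a) p s.
Proof.
elim: s p => //= a s IH p; apply: leq_trans (IH _).
by apply: leq_trans (leq_addr _ _); rewrite leq_pmulr.
Qed.

Lemma run_pos ys v : base n v ->
  let h := foldl (fun p a => p * n + a) (v vP) [seq v (pv y) | y <- ys] in
  runp [seq (vP, vP, vN, pv y) | y <- ys] v vP = h /\
  (h < B -> okp B [seq (vP, vP, vN, pv y) | y <- ys] v).
Proof.
elim: ys v => [|y ys IH] v bv //=; have [bN b1 bZ] := bv.
have bv1 : base n (run1 (vP, vP, vN, pv y) v) by apply: (@base_runp n [:: _]).
have := IH _ bv1; rewrite [run1 _ _ vP](run1_dest (vP, vP, vN, pv y)) /= bN.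
rewrite (@eq_map _ _ (fun y0 => run1 (vP, vP, vN, pv y) v (pv y0)) (fun y0 => v (pv y0))) //.
move=> [-> okr]; split => // lt; rewrite okr // andbT.
exact: leq_ltn_trans (foldl_horner_ge _ _) lt.
Qed.

Lemma run_addr rs ys v : base n v ->
  let a := horner n [seq v (pv y) | y <- ys] + (n.+1 + sumpow n rs) in
  runp (addrprog rs ys) v vA = a /\ (a < B -> okp B (addrprog rs ys) v).
Proof.
move=> bv a; have [rO okO] := run_start rs bv.
set v1 := runp (startprog rs) v in rO.
have d1 : all (mem dests) [seq i.1.1.1 | i <- startprog rs] by rewrite /= dests_off.
have bv1 : base n v1 by apply: base_runp.
have [b1N b11 b1Z] := bv1.
have v1v y : v1 (pv y) = v (pv y).
  apply: runp_notin; rewrite inE negb_or /=; apply/negP => h.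
  by have /allP/(_ _ h) := d1.
set v2 := run1 (vP, vZ, vZ, vZ) v1.
have bv2 : base n v2 by apply: (@base_runp n [:: _]).
have v2P : v2 vP = 0 by rewrite [v2 vP](run1_dest (vP, vZ, vZ, vZ)) /= b1Z.
have [rP okP] := run_pos ys bv2; rewrite v2P in rP okP.
have hE : foldl (fun p a => p * n + a) 0 [seq v2 (pv y) | y <- ys] =
          horner n [seq v (pv y) | y <- ys].
  by congr foldl; apply: eq_map => y; rewrite -v1v.
rewrite hE in rP okP.
set v3 := runp [seq (vP, vP, vN, pv y) | y <- ys] v2 in rP.
have bv3 : base n v3.
  by apply: base_runp => //; rewrite all_map; apply/allP => i /mapP[y _ ->].
have [b3N b31 b3Z] := bv3.
have v3O : v3 vO = n.+1 + sumpow n rs.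
  rewrite -rO -[RHS]/(v2 vO); apply: runp_notin; rewrite inE negb_or /= -map_comp.
  by apply/negP => /mapP[i].
rewrite /addrprog /posprog rcons_cons; split.
  rewrite runp_cat -/v1 runp_cons -/v2 -cats1 runp_cat -/v3 runp_cons.
  rewrite -[LHS]/(run1 (vA, vP, vOne, vO) v3 vA).
  by rewrite [run1 _ _ vA](run1_dest (vA, vP, vOne, vO)) /= rP b31 v3O muln1.
move=> lt.
have lt1 : n.+1 + sumpow n rs < B by apply: leq_ltn_trans lt; apply: leq_addl.
have lt2 : horner n [seq v (pv y) | y <- ys] < B by apply: leq_ltn_trans lt; apply: leq_addr.
rewrite okp_cat okO // -/v1 [okp _ _ _]/= -/v2 -cats1 okp_cat okP // -/v3 /=.
by rewrite b1Z rP b31 v3O muln1 lt (leq_ltn_trans _ lt).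
Qed.

End Programs.

(** * Wide numbers *)

Fixpoint qweq (zs ps : seq nat) : fom :=
  match zs, ps with
  | z :: zs', p :: ps' => qand (qweq zs' ps') (qeq z p)
  | _, _ => qtrue
  end.

Fixpoint qwlt (zs ps : seq nat) : fom :=
  match zs, ps with
  | z :: zs', p :: ps' => qor (qwlt zs' ps') (qand (qweq zs' ps') (qlt z p))
  | _, _ => qfalse
  end.

Fixpoint qwpow (ps : seq nat) : fom :=
  if ps is p :: ps' then
    qor (qand (QAtm (APow p)) (qzeros ps' qtrue)) (qand (QAtm (AZero p)) (qwpow ps'))
  else qfalse.

Lemma sem_weq L x B zs ps v : (forall y, v y < B) -> size zs = size ps ->
  sem L x B (qweq zs ps) v = (wval B zs v == wval B ps v).
Proof.
move=> vB; elim: zs ps => [|z zs IH] [|p ps] // sz; first by rewrite sem_true.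
case: sz => sz.
rewrite [qweq _ _]/= sem_and sem_eq IH //=; have := vB z; have := vB p.
move: (wval B zs v) (wval B ps v) (v z) (v p) => X Y a b aB bB.
by case: (ltngtP X Y) => [c|c|->] /=; [apply/esym/negbTE; nia|apply/esym/negbTE; nia|rewrite eqn_add2r].
Qed.

Lemma sem_wlt L x B zs ps v : (forall y, v y < B) -> size zs = size ps ->
  sem L x B (qwlt zs ps) v = (wval B zs v < wval B ps v).
Proof.
move=> vB; elim: zs ps => [|z zs IH] [|p ps] // sz; first by rewrite sem_false.
case: sz => sz.
rewrite [qwlt _ _]/= sem_or sem_and sem_weq // IH //=; have := vB z; have := vB p.
move: (wval B zs v) (wval B ps v) (v z) (v p) => X Y a b aB bB.
by case: (ltngtP X Y) => [c|c|->] /=; [nia|nia|rewrite ltn_add2r].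
Qed.

Lemma sem_wpow L x l ps v : (forall y, v y < 2 ^ l) ->
  sem L x (2 ^ l) (qwpow ps) v = pow2 (wval (2 ^ l) ps v).
Proof.
move=> vB; have B0 : 0 < 2 ^ l by rewrite expn_gt0.
elim: ps => [|p ps IH]; first by rewrite sem_false.
rewrite [qwpow _]/= -/(qwpow _) sem_or !sem_and sem_zeros // sem_true andbT IH /=.
rewrite -(wval_eq0 B0); move: (wval _ ps v) (vB p) => Z.
move: (v p) => a aB; apply/idP/idP.
  case/orP=> /andP[].
    by move=> ha /eqP ->; rewrite muln0 addn0.
  by move=> /eqP -> /pow2P[i ->]; rewrite add0n -expnD; apply/pow2P; exists (l + i).
case/pow2P=> i e; case: (ltnP i l) => il.
  have lt : a + 2 ^ l * Z < 2 ^ l by rewrite e ltn_exp2l.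
  have Z0 : Z = 0 by case: Z lt {e} => // Z; rewrite mulnS; lia.
  by move: e; rewrite Z0 muln0 addn0 => ->; rewrite eqxx andbT; apply/orP; left; apply/pow2P; exists i.
have e' : 2 ^ i = 2 ^ (i - l) * 2 ^ l by rewrite -expnD subnK.
have a0 : a = 0.
  have := congr1 (modn^~ (2 ^ l)) e.
  by rewrite /= e' modnMl addnC mulnC modnMDl modn_small.
move: e; rewrite a0 add0n e' mulnC => /eqP; rewrite eqn_pmul2r // => /eqP ->.
by apply/orP; right; rewrite eqxx; apply/pow2P; exists (i - l).
Qed.

(** * Flatness *)

Section Flatness.
Local Open Scope fset_scope.
Local Open Scope fmap_scope.
Variables (tau : vocabulary) (A : finType) (St : structure tau A).

Fixpoint fo_sat (s : assignment A) (phi : formula tau) : bool :=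
  match phi with
  | FEq x y => eq_holds s x y
  | FNeq x y => ~~ eq_holds s x y
  | FRel R xs => rel_holds St s xs
  | FNrel R xs => ~~ rel_holds St s xs
  | FAnd p q => fo_sat s p && fo_sat s q
  | FOr p q => fo_sat s p || fo_sat s q
  | FEx x p => [exists a, fo_sat s.[x <- a] p]
  | FAll x p => [forall a, fo_sat s.[x <- a] p]
  end.

Lemma team_extP (T : {fset assignment A}) x (f : assignment A -> {set A}) t :
  reflect (exists2 s, s \in T & exists2 a, a \in f s & t = s.[x <- a]) (t \in team_ext T x f).
Proof. exact: imfset2P. Qed.

Lemma flatness (T : {fset assignment A}) (phi : formula tau) :
  team_sat St T phi <-> forall s, s \in T -> fo_sat s phi.
Proof.
elim: phi T => [x y|x y|R xs|R xs|p IHp q IHq|p IHp q IHq|x p IH|x p IH] T //=.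
- rewrite IHp IHq; split=> [[hp hq] s sT|h]; first by rewrite hp // hq.
  by split=> s /h /andP[].
- split=> [[T0 [T1 [-> /IHp h0 /IHq h1]]] s|h].
    by case/fsetUP=> [/h0 ->|/h1 ->]; rewrite ?orbT.
  exists [fset s in T | fo_sat s p], [fset s in T | fo_sat s q]; split.
  + apply/fsetP => s; rewrite !inE -andb_orr.
    by case: (boolP (s \in T)) => //= /h ->.
  + by apply/IHp => s; rewrite !inE => /andP[].
  + by apply/IHq => s; rewrite !inE => /andP[].
- split=> [[f [fn /IH h]] s sT|h].
    have /set0Pn[a af] := fn _ sT; apply/existsP; exists a; apply: h.
    by apply/team_extP; exists s => //; exists a.
  exists (fun s => [set a | fo_sat s.[x <- a] p]); split.
    by move=> s /h /existsP[a ha]; apply/set0Pn; exists a; rewrite inE.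
  apply/IH => t /team_extP[s sT [a]]; rewrite inE => ha ->; exact: ha.
split=> [hT s sT|h].
  have h := (IH _).1 hT.
  apply/forallP => a; apply: h; apply/team_extP; exists s => //; exists a => //.
by apply/IH => t /team_extP[s sT [a _ ->]]; have /forallP := h s sT; apply.
Qed.

Lemma WT_iff (phi : formula tau) k (l : seq (assignment A)) : uniq l ->
  (forall s, (s \in l) = (domf s == Fr phi) && fo_sat s phi) ->
  WT St phi k <-> k <= size l.
Proof.
move=> ul lP; split=> [[T [dT cT /flatness sT]]|kl].
  rewrite -cT; apply: uniq_leq_size; first exact: fset_uniq.
  by move=> s sT'; rewrite lP dT // eqxx sT.
exists [fset s in take k l]; split.
- by move=> s; rewrite !inE => /mem_take; rewrite lP => /andP[/eqP].
- by rewrite card_fseq undup_id ?take_uniq // size_takel.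
- by apply/flatness => s; rewrite !inE => /mem_take; rewrite lP => /andP[].
Qed.

End Flatness.

(** * Instances as binary words *)

Definition arities (tau : vocabulary) : seq nat := [seq arity R | R <- enum 'I_(nrel tau)].

Lemma size_arities tau : size (arities tau) = nrel tau.
Proof. by rewrite size_map size_enum_ord. Qed.

Section Encoding.
Variables (tau : vocabulary) (m : nat).
Local Notation n := m.+1.
Local Notation offset R := (n.+1 + sumpow n (take R (arities tau))).

Definition encoded_rels (St : structure tau 'I_n) (l : seq 'I_(nrel tau)) : seq bool :=
  flatten [seq encode_rel (interp St R) | R <- l].

Lemma size_encoded_rels St l : size (encoded_rels St l) = sumpow n [seq arity R | R <- l].
Proof. by elim: l => //= R l IH; rewrite /encoded_rels /= size_cat size_mkseq IH. Qed.

Lemma horner_ord_lt r (a : r.-tuple 'I_n) : horner n [seq val i | i <- a] < n ^ r.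
Proof.
rewrite -[X in _ ^ X](size_tuple a) -(size_map val); apply: horner_lt.
by rewrite all_map; apply/allP => i _ /=.
Qed.

Lemma tuple_of_horner r (a : r.-tuple 'I_n) :
  [tuple inord (horner n [seq val i | i <- a] %/ n ^ (r - i.+1) %% n) | i < r] = a.
Proof.
apply: eq_from_tnth => i; rewrite tnth_mktuple; apply: val_inj.
have sz : size [seq val j | j <- a] = r by rewrite size_map size_tuple.
rewrite -[X in X - _]sz horner_digit ?sz //; last first.
  by rewrite all_map; apply/allP => j _ /=.
by rewrite (nth_map ord0) ?size_tuple // -tnth_nth /= inordK.
Qed.

Lemma encode_nth (St : structure tau 'I_n) k R (a : (arity R).-tuple 'I_n) :
  let i := horner n [seq val j | j <- a] + offset R in
  i < size (encode St k) /\ nth false (encode St k) i = (a \in interp St R).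
Proof.
move=> i; pose e := enum 'I_(nrel tau).
have eE : e = take R e ++ R :: drop R.+1 e.
  rewrite -{1}(cat_take_drop R e); congr cat.
  by rewrite (drop_nth R) ?nth_ord_enum // size_enum_ord.
have wE : encode St k = (nseq n false ++ true :: encoded_rels St (take R e)) ++
    (encode_rel (interp St R) ++ (encoded_rels St (drop R.+1 e) ++ binary k)).
  rewrite /encode -catA cat_cons; congr (_ ++ _ :: _).
  rewrite -[X in X ++ _]/(encoded_rels St e) {1}eE /encoded_rels map_cat flatten_cat /=.
  by rewrite -!catA.
have sz : size (nseq n false ++ true :: encoded_rels St (take R e)) = offset R.
  by rewrite size_cat size_nseq /= size_encoded_rels /arities -map_take addnS.
have lt := horner_ord_lt a.
split.
  rewrite wE size_cat sz size_cat size_mkseq /i.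
  by rewrite addnC ltn_add2l; apply: leq_trans lt (leq_addr _ _).
rewrite wE nth_cat sz /i ltnNge leq_addl /= addnK nth_cat size_mkseq lt nth_mkseq //.
by rewrite tuple_of_horner.
Qed.

Definition structure_of (x : seq bool) : structure tau 'I_n :=
  Structure (fun R => [set a : (arity R).-tuple 'I_n |
    nth false x (horner n [seq val j | j <- a] + offset R)]).

Lemma encoded_structure_of x : n.+1 + sumpow n (arities tau) <= size x ->
  encoded_rels (structure_of x) (enum 'I_(nrel tau)) =
  take (sumpow n (arities tau)) (drop n.+1 x).
Proof.
move=> szx; pose e := enum 'I_(nrel tau).
suff h j : j <= nrel tau -> encoded_rels (structure_of x) (take j e) =
    take (sumpow n (take j (arities tau))) (drop n.+1 x).
  have e1 : take (nrel tau) e = e by rewrite take_oversize // size_enum_ord.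
  have e2 : take (nrel tau) (arities tau) = arities tau.
    by rewrite take_oversize // size_arities.
  by have := h _ (leqnn _); rewrite e1 e2.
elim: j => [|j IH] jr; first by rewrite !take0.
pose R := Ordinal jr.
have eR : nth R e j = R by rewrite -[j]/(val R) nth_ord_enum.
have rR : nth 0 (arities tau) j = arity R.
  by rewrite (nth_map R) ?size_enum_ord // -/e eR.
rewrite (take_nth R) ?size_enum_ord // eR (take_nth 0) ?size_arities // rR.
rewrite /encoded_rels map_rcons flatten_rcons -/(encoded_rels _ _) IH ?(ltnW jr) //.
rewrite /sumpow map_rcons sumn_rcons -!/(sumpow _ _) takeD; congr cat.
have le : n.+1 + sumpow n (take j (arities tau)) + n ^ arity R <= size x.
  apply: leq_trans szx; rewrite -addnA leq_add2l.
  rewrite -{2}(cat_take_drop j.+1 (arities tau)) (take_nth 0) ?size_arities // rR.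
  by rewrite /sumpow map_cat sumn_cat map_rcons sumn_rcons leq_addr.
rewrite drop_drop; apply: (@eq_from_nth _ false).
  by rewrite size_mkseq size_takel // size_drop; lia.
rewrite size_mkseq => i ir; rewrite nth_mkseq // nth_take // nth_drop inE.
have -> : [seq val j | j <- [tuple (inord (i %/ m.+1 ^ (arity R - i0.+1) %% m.+1) : 'I_n) | i0 < arity R]] =
   mkseq (fun i0 => i %/ n ^ (arity R - i0.+1) %% n) (arity R).
  apply: (@eq_from_nth _ 0); first by rewrite size_map size_tuple size_mkseq.
  rewrite size_map size_tuple => i0 ri0; rewrite nth_mkseq //.
  rewrite (nth_map ord0) ?size_tuple // -[i0]/(val (Ordinal ri0)) -tnth_nth tnth_mktuple /=.
  by rewrite inordK // ltn_mod.
by rewrite horner_digits //; congr nth; rewrite /=; lia.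
Qed.

Lemma encode_structure_of x : n.+1 + sumpow n (arities tau) <= size x ->
  (forall i, i < n -> nth false x i = false) -> nth false x n ->
  last true (drop (n.+1 + sumpow n (arities tau)) x) ->
  x = encode (structure_of x) (val2 (drop (n.+1 + sumpow n (arities tau)) x)).
Proof.
move=> szx h0 h1 hl; rewrite /encode binary_val2 //.
rewrite -[X in _ :: X ++ _]/(encoded_rels _ _) encoded_structure_of //.
rewrite [n.+1 + _]addnC -drop_drop cat_take_drop.
rewrite -[LHS](cat_take_drop n); congr cat.
  apply: (@eq_from_nth _ false); rewrite size_takel ?size_nseq //; try lia.
  by move=> i im; rewrite nth_nseq im nth_take // h0.
by rewrite (drop_nth false) ?h1 //; lia.
Qed.

Lemma drop_encode (St : structure tau 'I_n) k :
  drop (n.+1 + sumpow n (arities tau)) (encode St k) = binary k /\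
  size (encode St k) = n.+1 + sumpow n (arities tau) + size (binary k).
Proof.
have sz : size (nseq n false ++ true :: encoded_rels St (enum 'I_(nrel tau))) =
    n.+1 + sumpow n (arities tau).
  by rewrite size_cat size_nseq /= size_encoded_rels addnS.
have wE : encode St k = (nseq n false ++ true :: encoded_rels St (enum 'I_(nrel tau))) ++ binary k.
  by rewrite -catA.
by rewrite wE -{1}sz drop_size_cat // size_cat sz.
Qed.

End Encoding.

(** * Translation of formulas *)

Fixpoint tr (tau : vocabulary) (phi : formula tau) : fom :=
  match phi with
  | FEq x y => qeq (pv x) (pv y)
  | FNeq x y => QNot (qeq (pv x) (pv y))
  | FRel R xs => qprog (addrprog (take R (arities tau)) xs) (QIn vA)
  | FNrel R xs => QNot (qprog (addrprog (take R (arities tau)) xs) (QIn vA))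
  | FAnd p q => qand (tr p) (tr q)
  | FOr p q => qor (tr p) (tr q)
  | FEx x p => qex (pv x) (qand (qlt (pv x) vN) (tr p))
  | FAll x p => qall (pv x) (qimp (qlt (pv x) vN) (tr p))
  end.

Lemma oki_addr rs ys : all oki (addrprog rs ys).
Proof.
rewrite all_cat /= oki_off /= all_rcons /= all_map.
by apply/allP.
Qed.

Section Translation.
Variables (tau : vocabulary) (m : nat) (St : structure tau 'I_m.+1) (k : nat).
Local Notation w := (encode St k).
Local Notation L := (size w).
Variable B : nat.
Hypothesis LB : L < B.

Definition agree (X : {fset nat}) (s : assignment 'I_m.+1) (v : nat -> nat) : Prop :=
  forall y, y \in X -> exists2 a, s.[? y]%fmap = Some a & v (pv y) = val a.

Lemma agree_upd X s v y a : agree (X `\ y)%fset s v ->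
  agree X s.[y <- a]%fmap (upd v (pv y) (val a)).
Proof.
move=> h z zX; rewrite fnd_set /upd /pv eqn_add2l; case: (eqVneq z y) => [_|zy].
  by exists a.
by apply: h; rewrite !inE zy.
Qed.

Lemma sem_rel R (xs : (arity R).-tuple nat) s v : base m.+1 v -> (forall y, v y < B) ->
  agree [fset y in (xs : seq nat)]%fset s v ->
  sem L w B (qprog (addrprog (take R (arities tau)) xs) (QIn vA)) v = rel_holds St s xs.
Proof.
move=> bv vB ag; have B0 : 0 < B by apply: leq_ltn_trans LB.
pose a : (arity R).-tuple 'I_m.+1 := [tuple odflt ord0 s.[? tnth xs i]%fmap | i < arity R].
have aP i : s.[? tnth xs i]%fmap = Some (tnth a i) /\ v (pv (tnth xs i)) = val (tnth a i).
  have [|c e1 e2] := ag (tnth xs i); first by rewrite !inE /= mem_tnth.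
  by rewrite tnth_mktuple e1 e2.
clearbody a.
have -> : rel_holds St s xs = (a \in interp St R).
  apply/exists_inP/idP => [[b bI /forallP h]|aI].
    suff -> : a = b by [].
    apply: eq_from_tnth => i; have [e _] := aP i; have /eqP := h i.
    by rewrite e => -[].
  by exists a => //; apply/forallP => i; rewrite (aP i).1.
rewrite (sem_prog _ _ _ _ (oki_addr _ _)) //.
have [rE ok] := @run_addr B m.+1 isT (take R (arities tau)) xs v bv.
have hE : [seq v (pv y) | y <- xs] = [seq val j | j <- a].
  apply: (@eq_from_nth _ 0); rewrite !size_map ?size_tuple // => i ir.
  rewrite (nth_map 0) ?size_tuple // (nth_map ord0) ?size_tuple //.
  by rewrite -[i]/(val (Ordinal ir)) -!tnth_nth (aP _).2.
rewrite hE in ok rE; have [lt nE] := encode_nth St k a.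
by rewrite sem_in rE lt nE ok //; apply: ltn_trans LB.
Qed.

Lemma sem_tr phi s v : base m.+1 v -> (forall y, v y < B) -> agree (Fr phi) s v ->
  sem L w B (tr phi) v = fo_sat St s phi.
Proof.
have B0 : 0 < B by apply: leq_ltn_trans LB.
have mB : m.+1 < B.
  apply: ltn_trans LB; rewrite (drop_encode St k).2; lia.
elim: phi s v => [x y|x y|R xs|R xs|p IHp q IHq|p IHp q IHq|x p IH|x p IH] s v bv vB ag.
- rewrite sem_eq //= /eq_holds.
  have [|a ea va] := ag x; first by rewrite !inE eqxx.
  have [|b eb vb] := ag y; first by rewrite !inE eqxx orbT.
  by rewrite ea eb va vb.
- rewrite sem_not sem_eq //= /eq_holds.
  have [|a ea va] := ag x; first by rewrite !inE eqxx.
  have [|b eb vb] := ag y; first by rewrite !inE eqxx orbT.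
  by rewrite ea eb va vb.
- exact: sem_rel.
- by rewrite [tr _]/= sem_not (sem_rel bv vB ag).
- rewrite [tr _]/= sem_and (IHp s) ?(IHq s) // => y yX; apply: ag; rewrite !inE yX ?orbT //.
- rewrite [tr _]/= sem_or (IHp s) ?(IHq s) // => y yX; apply: ag; rewrite !inE yX ?orbT //.
- have [bN _ _] := bv; rewrite [tr _]/= [fo_sat _ _ _]/=; apply/sem_exP/existsP => [[a aB]|[a ha]].
    rewrite sem_and /= => /andP[]; rewrite upd_same upd_other // bN => am h.
    exists (Ordinal am); rewrite -(IH _ (upd v (pv x) a)) //; first exact: upd_lt.
    exact: (@agree_upd _ _ _ _ (Ordinal am)).
  have aB : a < B by apply: ltn_trans mB.
  exists (val a) => //; rewrite sem_and /= upd_same upd_other // bN ltn_ord /=.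
  rewrite (IH s.[x <- a]%fmap) //; first exact: upd_lt.
  exact: agree_upd.
have [bN _ _] := bv; rewrite [tr _]/= [fo_sat _ _ _]/=; apply/sem_allP/forallP => [h a|h a aB].
  have aB : a < B by apply: ltn_trans mB.
  have := h a aB; rewrite sem_imp /= upd_same upd_other // bN ltn_ord /=.
  by rewrite (IH s.[x <- a]%fmap) //; [exact: upd_lt|exact: agree_upd].
rewrite sem_imp /= upd_same upd_other // bN; apply/implyP => am.
rewrite (IH s.[x <- Ordinal am]%fmap) //; first exact: upd_lt.
exact: (@agree_upd _ _ _ _ (Ordinal am)).
Qed.

End Translation.

(** * The defining formula *)

Fixpoint maxv (tau : vocabulary) (phi : formula tau) : nat :=
  match phi with
  | FEq x y | FNeq x y => maxn x y
  | FRel _ xs | FNrel _ xs => foldr maxn 0 xs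
  | FAnd p q | FOr p q => maxn (maxv p) (maxv q)
  | FEx x p | FAll x p => maxn x (maxv p)
  end.

Lemma foldr_maxn_ge s y : y \in s -> y <= foldr maxn 0 s.
Proof. by elim: s => //= a s IH; rewrite inE leq_max => /orP[/eqP ->|/IH ->]; rewrite ?leqnn ?orbT. Qed.

Lemma Fr_maxv tau (phi : formula tau) y : y \in Fr phi -> y <= maxv phi.
Proof.
elim: phi => [a b|a b|R xs|R xs|p IHp q IHq|p IHp q IHq|a p IH|a p IH] /=; rewrite ?inE ?leq_max.
- by case/orP=> /eqP ->; rewrite leqnn ?orbT.
- by case/orP=> /eqP ->; rewrite leqnn ?orbT.
- exact: foldr_maxn_ge.
- exact: foldr_maxn_ge.
- by case/orP=> [/IHp|/IHq] ->; rewrite ?orbT.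
- by case/orP=> [/IHp|/IHq] ->; rewrite ?orbT.
- by case/andP=> _ /IH ->; rewrite orbT.
- by case/andP=> _ /IH ->; rewrite orbT.
Qed.

Definition instr_lt (V : nat) (i : instr) : bool :=
  let: (d, y1, y2, a) := i in [&& d < V, y1 < V, y2 < V & a < V].

Lemma okfom_prog V pr k : 11 <= V -> all (instr_lt V) pr -> okfom V k -> okfom V (qprog pr k).
Proof.
move=> V11; elim: pr => //= -[[[d y1] y2] a] pr IH /andP[/and4P[h1 h2 h3 h4] hpr] hk.
by rewrite /= /vS /vT /vQ h1 h2 h3 h4 !(leq_trans _ V11) //= IH.
Qed.

Lemma instr_lt_scratch V d y1 y2 a : 11 <= V ->
  [&& d < 11, y1 < 11, y2 < 11 & a < 11] -> instr_lt V (d, y1, y2, a).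
Proof. by move=> V11 /and4P[h1 h2 h3 h4]; rewrite /= !(leq_trans _ V11). Qed.

Lemma instr_lt_pw V r : 11 <= V -> all (instr_lt V) (pw r).
Proof.
move=> V11; apply/andP; split; first exact: instr_lt_scratch.
by apply/allP => i /nseqP[-> _]; apply: instr_lt_scratch.
Qed.

Lemma instr_lt_off V rs : 11 <= V -> all (instr_lt V) (offprog rs).
Proof.
move=> V11; elim: rs => // r rs IH.
rewrite (_ : offprog (r :: rs) = rcons (pw r) (vO, vP, vOne, vO) ++ offprog rs) //.
by rewrite all_cat IH andbT all_rcons instr_lt_pw // instr_lt_scratch.
Qed.

Lemma instr_lt_start V rs : 11 <= V -> all (instr_lt V) (startprog rs).
Proof. by move=> V11; apply/andP; split; [exact: instr_lt_scratch|exact: instr_lt_off]. Qed.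

Lemma instr_lt_addr V rs ys : 11 <= V -> all (fun y => pv y < V) ys ->
  all (instr_lt V) (addrprog rs ys).
Proof.
move=> V11 hys; rewrite all_cat instr_lt_start // all_rcons instr_lt_scratch // !andTb.
apply/andP; split; first exact: instr_lt_scratch.
apply/allP => i /mapP[y yys ->]; have h := allP hys _ yys.
by rewrite /instr_lt h !(leq_trans _ V11).
Qed.

Lemma okfom_tr tau (phi : formula tau) V : 11 + maxv phi < V -> okfom V (tr phi).
Proof.
have addr R (xs : (arity R).-tuple nat) : 11 + foldr maxn 0 xs < V ->
    okfom V (qprog (addrprog (take R (arities tau)) xs) (QIn vA)).
  move=> h; have V11 : 11 <= V by lia.
  apply: okfom_prog => //; last by rewrite /= /vA (leq_trans _ V11).
  apply: instr_lt_addr => //; apply/allP => y /foldr_maxn_ge hy; rewrite /pv; lia.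
elim: phi => [a b|a b|R xs|R xs|p IHp q IHq|p IHp q IHq|a p IH|a p IH] /= h.
- by rewrite /pv; lia.
- by rewrite /pv; lia.
- exact: addr.
- exact: addr.
- by rewrite IHp ?IHq //; lia.
- by rewrite IHp ?IHq //; lia.
- by rewrite IH ?andbT /pv /vN; lia.
- by rewrite IH ?andbT /pv /vN; lia.
Qed.

Lemma okfom_zeros V xs k : all (fun y => y < V) xs -> okfom V k -> okfom V (qzeros xs k).
Proof. by elim: xs => //= y xs IH /andP[-> h] hk; rewrite IH. Qed.

Lemma okfom_true V : 0 < V -> okfom V qtrue.
Proof. by move=> h; rewrite /= h. Qed.

Lemma okfom_weq V zs ps : 0 < V -> all (fun y => y < V) zs -> all (fun y => y < V) ps ->
  okfom V (qweq zs ps).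
Proof.
move=> V0; elim: zs ps => [|z zs IH] [|p ps] /=; rewrite ?V0 //.
by move=> /andP[-> h1] /andP[-> h2]; rewrite IH.
Qed.

Lemma okfom_wlt V zs ps : 0 < V -> all (fun y => y < V) zs -> all (fun y => y < V) ps ->
  okfom V (qwlt zs ps).
Proof.
move=> V0; elim: zs ps => [|z zs IH] [|p ps] /=; rewrite ?V0 //.
by move=> /andP[-> h1] /andP[-> h2]; rewrite IH // okfom_weq.
Qed.

Lemma okfom_wpow V ps : 0 < V -> all (fun y => y < V) ps -> okfom V (qwpow ps).
Proof.
move=> V0; elim: ps => [|p ps IH] /=; rewrite ?V0 //.
by move=> /andP[-> h]; rewrite IH // okfom_zeros // okfom_true.
Qed.

Lemma okfom_and V f g : okfom V (qand f g) = okfom V f && okfom V g.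
Proof. by []. Qed.

Lemma okfom_more V xs f g : okfom V (qmore xs f g) =
  [&& uniq xs, all (fun y => y < V) xs, okfom V f & okfom V g].
Proof. by []. Qed.

Lemma okfom_same V xs f g : okfom V (qsame xs f g) =
  [&& uniq xs, all (fun y => y < V) xs, okfom V f & okfom V g].
Proof.
rewrite /qsame okfom_and [okfom V (QNot _)]okfom_more [X in _ && X]okfom_more.
by case: (uniq xs); case: (all _ xs); case: (okfom V f); case: (okfom V g).
Qed.

Section Root.
Variables (tau : vocabulary) (phi : formula tau).

Definition frs : seq nat := [seq pv y | y <- Fr phi].
Definition wide : nat := (size frs).+1.
Definition fresh : nat := 12 + maxv phi.
Definition pbar : seq nat := iota fresh wide.
Definition zbar : seq nat := iota (fresh + wide) wide.
Definition qhead : nat := fresh + wide + wide.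
Definition qtail : seq nat := iota qhead.+1 (size frs).
Definition qbar : seq nat := qhead :: qtail.
Definition nvars : nat := fresh + wide + wide + wide.
Definition ybar : seq nat := vI :: pbar ++ zbar.

(* [pbar] is [2 ^ (vI - vO)]: as many powers of 2 are below [pbar] as there are
   numbers from [vO] to [vI - 1]. *)
Definition qidx : fom := qsame qbar (qand (qwpow qbar) (qwlt qbar pbar))
  (qzeros qtail (qand (qle vO qhead) (qlt qhead vI))).
Definition qbit : fom := qand (qle vO vI) (QIn vI).
Definition qone : fom := qand qbit (qand (qwpow pbar) (qand qidx (qwlt zbar pbar))).
Definition qsat : fom := foldr (fun y f => qand (qlt y vN) f) (tr phi) frs.
(* If [vO] is the position of the first digit of [k], then [k] is the number of
   triples [(vI, pbar, zbar)] that satisfy [qone]. *)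
Definition qcount : fom := QNot (qmore (frs ++ ybar) (qzeros frs qone) (qzeros ybar qsat)).
Definition qpows : fom := qand (qwpow pbar) qidx.
Definition qbig : fom := qall vI (qimp qbit (QNode KOr pbar qpows qpows)).
Definition qlast : fom := qor (QNot (QAtm (AIn vO)))
  (qex vI (qand (QIn vI) (qall vJ (qimp (qlt vI vJ) (QNot (QAtm (AIn vJ))))))).
Definition qend : fom := qall vJ (qimp (qlt vJ vO) (QAtm (AIn vJ))).
Definition qprefix : fom := qand (QNot (QAtm (AZero vN)))
  (qand (QIn vN) (qall vI (qimp (qlt vI vN) (QNot (QIn vI))))).
Definition qbody : fom := qand qend (qand qlast (qand qbig qcount)).
Definition qroot : fom := qex vN (qand qprefix (qex vOne (qand (QAtm (AOne vOne))
  (qprog (startprog (arities tau)) qbody)))).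

Lemma frs_lt y : y \in frs -> 10 < y < fresh.
Proof. by case/mapP=> z /Fr_maxv h ->; rewrite /pv /fresh; lia. Qed.

Lemma uniq_frs : uniq frs.
Proof. by rewrite map_inj_uniq ?fset_uniq // => a b /addnI. Qed.

Lemma pbarP y : (y \in pbar) = (fresh <= y < fresh + wide).
Proof. exact: mem_iota. Qed.

Lemma zbarP y : (y \in zbar) = (fresh + wide <= y < fresh + wide + wide).
Proof. exact: mem_iota. Qed.

Lemma qtailP y : (y \in qtail) = (qhead < y < nvars).
Proof. by rewrite mem_iota /nvars /qhead /wide; lia. Qed.

Lemma qbarP y : (y \in qbar) = (qhead <= y < nvars).
Proof. by rewrite inE qtailP /nvars /qhead /wide; lia. Qed.

Lemma uniq_ybar : uniq (frs ++ ybar).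
Proof.
have f12 : 12 <= fresh by rewrite /fresh.
rewrite cat_uniq uniq_frs andTb; apply/andP; split.
  apply/hasPn => y; rewrite inE mem_cat pbarP zbarP => hy; apply/negP => /frs_lt.
  by move: hy; rewrite /vI; lia.
rewrite cons_uniq mem_cat pbarP zbarP cat_uniq !iota_uniq andTb andbT.
by apply/hasPn => y; rewrite zbarP /= pbarP; lia.
Qed.

Lemma okfom_root : okfom nvars qroot.
Proof.
have f12 : 12 <= fresh by rewrite /fresh.
have V11 : 11 <= nvars by rewrite /nvars; lia.
have V0 : 0 < nvars by lia.
have hv y : y < 11 -> y < nvars by move=> h; apply: leq_trans V11.
have hp : all (fun y => y < nvars) pbar by apply/allP => y; rewrite pbarP /nvars; lia.
have hz : all (fun y => y < nvars) zbar by apply/allP => y; rewrite zbarP /nvars; lia.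
have ht : all (fun y => y < nvars) qtail by apply/allP => y; rewrite qtailP; lia.
have hh : qhead < nvars by rewrite /nvars /qhead /wide; lia.
have hq : all (fun y => y < nvars) qbar by rewrite /= hh.
have hf : all (fun y => y < nvars) frs.
  by apply/allP => y /frs_lt; rewrite /nvars; lia.
have uq : uniq qbar by rewrite /= iota_uniq qtailP ltnn.
have oidx : okfom nvars qidx.
  by rewrite okfom_same uq hq !okfom_and okfom_wpow // okfom_wlt // okfom_zeros //= hh !hv.
have osat : okfom nvars qsat.
  rewrite /qsat; elim: frs hf => [|y s IH] /=.
    by move=> _; apply: okfom_tr; rewrite /nvars /fresh; lia.
  by move=> /andP[-> h]; rewrite IH // hv.
have obit : okfom nvars qbit by rewrite /= !hv.
have oone : okfom nvars qone.
  by rewrite /qone okfom_and obit okfom_and okfom_wpow // okfom_and oidx okfom_wlt.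
have opows : okfom nvars qpows by rewrite /qpows okfom_and oidx okfom_wpow.
have obig : okfom nvars qbig.
  have onode : okfom nvars (QNode KOr pbar qpows qpows) by apply/and4P; split; rewrite ?iota_uniq.
  have oimp : okfom nvars (qimp qbit (QNode KOr pbar qpows qpows)) by apply/and4P; split.
  by apply/and4P; split => //; rewrite /= hv.
have hy : all (fun y => y < nvars) ybar.
  have hpz : all (fun y => y < nvars) (pbar ++ zbar) by rewrite all_cat hp.
  by apply/andP; split; [exact: hv|exact: hpz].
have ocount : okfom nvars qcount.
  have : okfom nvars (qmore (frs ++ ybar) (qzeros frs qone) (qzeros ybar qsat)).
    by rewrite okfom_more uniq_ybar all_cat hf hy !okfom_zeros.
  by [].
have olast : okfom nvars qlast by rewrite /= !hv.
have oend : okfom nvars qend by rewrite /= !hv.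
have oprefix : okfom nvars qprefix by rewrite /= !hv.
have obody : okfom nvars qbody by rewrite /qbody okfom_and oend okfom_and olast okfom_and obig.
have oprog : okfom nvars (qprog (startprog (arities tau)) qbody).
  by apply: okfom_prog => //; apply: instr_lt_start.
have oex x f : x < 11 -> okfom nvars f -> okfom nvars (qex x f).
  by move=> x11 of_; apply/and4P; split => //; rewrite /= hv.
by rewrite /qroot oex // okfom_and oprefix oex // okfom_and oprog andbT /= hv.
Qed.

End Root.

(** * Counting *)

Lemma count_pow2 e N : 2 ^ e <= N -> \sum_(Z < N) (pow2 Z && (Z < 2 ^ e)) = e.
Proof.
move=> eN; transitivity (\sum_(Z < N) \sum_(j < e) ((Z : nat) == 2 ^ j)).
  apply: eq_bigr => Z _; case: (boolP (pow2 Z)) => [/pow2P[i zi]|np] /=.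
    rewrite zi ltn_exp2l //; case: (ltnP i e) => ie.
      rewrite (bigD1 (Ordinal ie)) //= eqxx big1 // => j.
      by rewrite -val_eqE /= eqn_exp2l // eq_sym => /negbTE ->.
    rewrite big1 // => j _; rewrite eqn_exp2l //; case: eqP => // ij.
    by have := ltn_ord j; rewrite -ij ltnNge ie.
  rewrite big1 // => j _; case: eqP => // zj.
  by case/negP: np; apply/pow2P; exists j.
rewrite exchange_big /= (eq_bigr (fun=> 1)) ?sum1_card ?card_ord // => j _.
have jN : 2 ^ j < N by apply: leq_trans eN; rewrite ltn_exp2l.
rewrite (bigD1 (Ordinal jN)) //= eqxx big1 // => Z.
by rewrite -val_eqE /= => /negbTE ->.
Qed.

Lemma sum_delta N c (G : nat -> nat) : c < N -> \sum_(P < N) ((P == c :> nat) * G P) = G c.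
Proof.
move=> cN; rewrite (bigD1 (Ordinal cN)) //= eqxx mul1n big1 ?addn0 // => Z.
by rewrite -val_eqE /= => /negbTE ->.
Qed.

Lemma sum_bits s E b : \sum_(i < b) ((E <= i) && nth false s i) * 2 ^ (i - E) =
  val2 (mkseq (fun j => nth false s (E + j)) (b - E)).
Proof.
elim: b => [|b IH]; first by rewrite big_ord0.
rewrite big_ord_recr /= IH; case: (leqP E b) => Eb /=.
  by rewrite subSn // mkseqS val2_rcons size_mkseq subnKC.
by rewrite addn0 (eqP (ltnW Eb : b - E == 0)) (eqP (Eb : b.+1 - E == 0)).
Qed.

Lemma val2_drop s E b : size s <= b ->
  val2 (mkseq (fun j => nth false s (E + j)) (b - E)) = val2 (drop E s).
Proof.
move=> sb; apply: bit_inj => j; rewrite bit_mkseq bit_val2 nth_drop.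
by case: ltnP => //= h; rewrite nth_default //; lia.
Qed.

Section Counting.
Variables (B : nat).
Hypothesis B0 : 0 < B.

Lemma setw0 ys v : {in ys, forall y, v y = 0} -> setw B ys 0 v = v.
Proof.
move=> h; apply: functional_extensionality => z; elim: ys h => //= y ys IH h.
rewrite mod0n div0n; case: eqP => [->|_]; first by rewrite h ?mem_head.
by apply: IH => u us; apply: h; rewrite inE us orbT.
Qed.

Lemma count_zeros_cat xs ys v (P : pred (nat -> nat)) : uniq (xs ++ ys) ->
  count (fun u => all (fun y => u y == 0) xs && P u) (envs B (xs ++ ys) v) =
  count P (envs B ys (setw B xs 0 v)).
Proof.
move=> un; have p : 0 < B ^ size xs by rewrite expn_gt0 B0.
have [unx [/hasPn disj uny]] : uniq xs /\ ~~ has (mem xs) ys /\ uniq ys.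
  by move: un; rewrite cat_uniq => /and3P[].
have zE Z u : Z < B ^ size xs -> u \in [seq Z' | Z' <- iota 0 (B ^ size ys)] ->
    all (fun y => setw B ys u (setw B xs Z v) y == 0) xs = (Z == 0).
  move=> ZB _; rewrite -(wval_eq0 B0) (@wval_ext _ _ _ (setw B xs Z v)) ?wval_setw //.
  by move=> y yx; rewrite setw_notin //; apply/negP => /disj /negP; apply.
rewrite count_envs_cat // (bigD1 (Ordinal p)) //= [X in _ + X]big1 ?addn0.
  rewrite /envs !count_map; apply: eq_in_count => Z Zi /=.
  by rewrite zE // map_id.
move=> Z Z0; apply/eqP; rewrite -leqn0 leqNgt -has_count -all_predC /envs.
rewrite all_map; apply/allP => Z' Zi /=; rewrite zE ?map_id //.
by move: Z0; rewrite -val_eqE /= => /negbTE ->.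
Qed.

End Counting.

Section Body.
Variables (tau : vocabulary) (phi : formula tau).
Variables (m : nat) (St : structure tau 'I_m.+1) (k : nat).
Local Notation n := m.+1.
Local Notation w := (encode St k).
Local Notation L := (size w).
Local Notation l := (size (binary L)).
Local Notation B := (2 ^ l).
Local Notation E := (n.+1 + sumpow n (arities tau)).
Local Notation W := (wide phi).
Local Notation sem := (sem L w B).

Definition good_env (v : nat -> nat) : Prop :=
  [/\ base n v, v vO = E & forall y, v y < B].

Lemma LB : L < B.
Proof. exact: ltn_size_binary. Qed.

Lemma B_gt0 : 0 < B.
Proof. by rewrite expn_gt0. Qed.

Lemma good_setw xs Z v : all (fun y => 8 < y) xs -> good_env v -> good_env (setw B xs Z v).
Proof.
move=> /allP h [[h1 h2 h3] h4 h5].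
have no y : y <= 8 -> y \notin xs by move=> y8; apply/negP => /h; rewrite ltnNge y8.
split; first by split; rewrite setw_notin ?no.
  by rewrite setw_notin ?no.
move=> y; case: (boolP (y \in xs)) => hy; first by rewrite setw_lt ?B_gt0.
by rewrite setw_notin.
Qed.

Lemma good_upd y a v : 8 < y -> a < B -> good_env v -> good_env (upd v y a).
Proof.
move=> y8 aB g; rewrite -(setw1 _ _ aB).
by apply: good_setw => //; rewrite /= y8.
Qed.

Lemma fresh12 : 12 <= fresh phi.
Proof. by rewrite /fresh. Qed.

Lemma big_qbar : all (fun y => 8 < y) (qbar phi).
Proof. by apply/allP => y; rewrite qbarP /qhead; have := fresh12; lia. Qed.
Lemma big_pbar : all (fun y => 8 < y) (pbar phi).
Proof. by apply/allP => y; rewrite pbarP; have := fresh12; lia. Qed.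
Lemma big_zbar : all (fun y => 8 < y) (zbar phi).
Proof. by apply/allP => y; rewrite zbarP; have := fresh12; lia. Qed.
Lemma big_frs : all (fun y => 8 < y) (frs phi).
Proof. by apply/allP => y /frs_lt; lia. Qed.

Lemma uniq_qbar : uniq (qbar phi).
Proof. by rewrite cons_uniq iota_uniq qtailP ltnn. Qed.

Lemma uniq_pbar : uniq (pbar phi).
Proof. exact: iota_uniq. Qed.

Lemma uniq_zbar : uniq (zbar phi).
Proof. exact: iota_uniq. Qed.

Lemma size_qbar : size (qbar phi) = W.
Proof. by rewrite /= size_iota. Qed.

Lemma size_pbar : size (pbar phi) = W.
Proof. exact: size_iota. Qed.

Lemma size_zbar : size (zbar phi) = W.
Proof. exact: size_iota. Qed.

Lemma sem_qidx u e : good_env u -> wval B (pbar phi) u = 2 ^ e -> 2 ^ e < B ^ W ->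
  sem (qidx phi) u = (e == u vI - E).
Proof.
move=> g pE eB; have [bu uO uB] := g; rewrite sem_same; congr (_ == _).
- rewrite count_envs size_qbar -[RHS](count_pow2 (ltnW eB)); apply: eq_bigr => Z _.
  have [_ _ uB'] := good_setw Z big_qbar g.
  rewrite sem_and sem_wpow // sem_wlt ?size_qbar ?size_pbar //.
  rewrite wval_setw ?uniq_qbar ?size_qbar // (@wval_ext _ (pbar phi) _ u) ?pE //.
  move=> y; rewrite pbarP => yp; rewrite setw_notin // qbarP /qhead; lia.
- rewrite (count_envs_cons B_gt0); last by rewrite qtailP ltnn.
  rewrite -uO -(@sum_interval B B_gt0 (u vO) (u vI)); last exact: ltnW.
  apply: eq_bigr => a _.
  rewrite (eq_count (a2 := fun v => all (fun y => v y == 0) (qtail phi) &&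
     ((v vO <= v (qhead phi)) && (v (qhead phi) < v vI)))).
    have f12 := fresh12.
    rewrite count_zeros ?B_gt0 ?iota_uniq // !setw_notin ?qtailP ?ltnn //;
      try by rewrite /qhead /vO /vI; lia.
    rewrite upd_same !upd_other //; by rewrite /qhead /vO /vI; lia.
  by move=> v; rewrite sem_zeros sem_and sem_le.
Qed.

Definition setbit (i : nat) : bool := (E <= i) && nth false w i.

Lemma sem_qbit u : good_env u -> sem qbit u = setbit (u vI).
Proof.
move=> [_ uO _]; rewrite sem_and sem_le uO /setbit sem_in; congr andb.
by case: ltnP => // h; rewrite nth_default.
Qed.

Lemma sem_qpows u : good_env u -> wval B (pbar phi) u < B ^ W ->
  sem (qpows phi) u = (wval B (pbar phi) u == 2 ^ (u vI - E)).
Proof.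
move=> g lt; have [bu uO uB] := g; rewrite sem_and sem_wpow //.
apply/andP/eqP => [[/pow2P[e pe]]|pe].
  by rewrite (sem_qidx g pe) -?pe // => /eqP <-.
split; first by apply/pow2P; eexists; apply: pe.
by rewrite (sem_qidx g pe) -?pe.
Qed.

Definition fits : Prop := forall i, setbit i -> 2 ^ (i - E) < B ^ W.

Lemma setbit_lt i : setbit i -> i < B.
Proof.
case/andP=> _ h; apply: ltn_trans LB; rewrite ltnNge; apply/negP => Li.
by rewrite nth_default in h.
Qed.

Lemma vI_pbar : vI \notin pbar phi.
Proof. by rewrite pbarP; have := fresh12; rewrite /vI; lia. Qed.

Lemma vI_zbar : vI \notin zbar phi.
Proof. by rewrite zbarP; have := fresh12; rewrite /vI; lia. Qed.

Lemma sem_exs xs f v : sem (QNode KOr xs f f) v = has (sem f) (envs B xs v).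
Proof. by apply: eq_has => u; rewrite /= orbb. Qed.

Lemma sem_qbig v : good_env v -> sem (qbig phi) v <-> fits.
Proof.
move=> g.
have key i : i < B -> sem (QNode KOr (pbar phi) (qpows phi) (qpows phi)) (upd v vI i) =
    (2 ^ (i - E) < B ^ W).
  move=> iB; have g' := @good_upd vI i v isT iB g.
  rewrite sem_exs envsE has_map; apply/hasP/idP => [[Z]|lt].
    rewrite mem_iota add0n size_pbar => ZB hZ.
    have : sem (qpows phi) (setw B (pbar phi) Z (upd v vI i)) by exact: hZ.
    rewrite sem_qpows ?wval_setw ?uniq_pbar ?size_pbar //; last exact: good_setw big_pbar g'.
    by rewrite setw_notin ?vI_pbar // upd_same => /eqP <-.
  exists (2 ^ (i - E)); first by rewrite mem_iota add0n size_pbar.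
  suff : sem (qpows phi) (setw B (pbar phi) (2 ^ (i - E)) (upd v vI i)) by [].
  rewrite sem_qpows ?wval_setw ?uniq_pbar ?size_pbar //; last exact: good_setw big_pbar g'.
  by rewrite setw_notin ?vI_pbar // upd_same.
split=> [/sem_allP h i bi|h].
  have iB := setbit_lt bi; have := h i iB.
  by rewrite sem_imp key // sem_qbit ?upd_same ?bi //; apply: good_upd.
apply/sem_allP => i iB; rewrite sem_imp key // sem_qbit ?upd_same; last exact: good_upd.
by apply/implyP => /h.
Qed.

Lemma count_qone v : good_env v -> fits -> count (sem (qone phi)) (envs B (ybar phi) v) = k.
Proof.
move=> g fit.
have un : uniq (pbar phi ++ zbar phi).
  by have := uniq_ybar phi; rewrite cat_uniq => /and3P[_ _ /andP[]].
have vn : vI \notin pbar phi ++ zbar phi by rewrite mem_cat negb_or vI_pbar vI_zbar.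
rewrite (count_envs_cons B_gt0) // -[RHS]val2_binary -(drop_encode St k).1.
rewrite -(@val2_drop w E B) ?(ltnW LB) // -sum_bits; apply: eq_bigr => i _.
rewrite (count_envs_cat B_gt0) // size_pbar -/(setbit i).
have g1 := @good_upd vI i v isT (ltn_ord i) g.
transitivity (\sum_(P < B ^ W) ((P == 2 ^ (i - E) :> nat) * (setbit i * P))).
  apply: eq_bigr => P _; rewrite count_envs size_zbar.
  have g2 := good_setw P big_pbar g1.
  rewrite mulnA -[X in _ = _ * X](@subn0 P) -(@sum_interval (B ^ W) _ 0 P) ?expn_gt0 ?B_gt0 ?(ltnW (ltn_ord P)) //.
  rewrite big_distrr; apply: eq_bigr => Z _.
  have g3 := good_setw Z big_zbar g2.
  have eI : setw B (zbar phi) Z (setw B (pbar phi) P (upd v vI i)) vI = i.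
    by rewrite !setw_notin ?vI_pbar ?vI_zbar // upd_same.
  have eP : wval B (pbar phi) (setw B (zbar phi) Z (setw B (pbar phi) P (upd v vI i))) = P.
    rewrite -[RHS](@wval_setw B (pbar phi) P (upd v vI i)) ?uniq_pbar ?size_pbar //.
    by apply: wval_ext => y; rewrite pbarP => yp; rewrite setw_notin // zbarP; lia.
  have eZ : wval B (zbar phi) (setw B (zbar phi) Z (setw B (pbar phi) P (upd v vI i))) = Z.
    by rewrite wval_setw ?uniq_zbar ?size_zbar.
  rewrite sem_and sem_qbit // eI sem_and sem_and [X in _ && X]andbA.
  have := sem_qpows g3; rewrite sem_and eP eI => -> //.
  rewrite sem_wlt ?size_zbar ?size_pbar ?eZ ?eP //; last by case: g3.
  by case: (setbit i); case: (_ == _); case: (_ < _).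
case bi : (setbit i); last by rewrite big1 // => P _; rewrite muln0.
by rewrite sum_delta ?mul1n //; apply: fit.
Qed.

Lemma sem_qsat u : sem (qsat phi) u = all (fun y => u y < u vN) (frs phi) && sem (tr phi) u.
Proof. by rewrite /qsat; elim: (frs phi) => // y s IH; rewrite [foldr _ _ _]/= sem_and IH andbA. Qed.

Definition assign (u : nat -> nat) : assignment 'I_n :=
  [fmap y : Fr phi => (inord (u (pv (val y))) : 'I_n)]%fmap.

Lemma fnd_assign u y : y \in Fr phi -> ((assign u).[? y] = Some (inord (u (pv y))))%fmap.
Proof. by move=> yF; rewrite in_fnd ffunE. Qed.

Lemma agree_assign u : all (fun y => u y < n) (frs phi) -> agree (Fr phi) (assign u) u.
Proof.
move=> /allP h y yF; exists (inord (u (pv y))); first exact: fnd_assign.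
by rewrite /= inordK //; apply: h; apply: map_f.
Qed.

Variable v : nat -> nat.
Hypothesis gv : good_env v.
Hypothesis v0 : forall y, 8 < y -> v y = 0.

Definition values (Z : nat) : nat -> nat := setw B (frs phi) Z v.

Definition satisfying : seq (assignment 'I_n) :=
  [seq assign (values Z) | Z <- iota 0 (B ^ size (frs phi)) & sem (qsat phi) (values Z)].

Lemma values_base Z : base n (values Z) /\ forall y, values Z y < B.
Proof. by have [b _ h] := good_setw Z big_frs gv. Qed.

Lemma n_lt_B : n < B.
Proof. by apply: ltn_trans LB; rewrite (drop_encode St k).2; lia. Qed.

Lemma satisfyingP s : (s \in satisfying) = (domf s == Fr phi) && fo_sat St s phi.
Proof.
apply/mapP/andP => [[Z]|[/eqP ds hs]].
  have [bZ hZ] := values_base Z; have [bN _ _] := bZ.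
  rewrite mem_filter sem_qsat bN => /andP[/andP[hn ht] _] ->; split; first by [].
  by rewrite -(sem_tr LB bZ hZ (agree_assign hn)).
pose u0 y := if s.[? y - 11]%fmap is Some a then val a else 0.
have u0n y : u0 y < n by rewrite /u0; case: (s.[? _]%fmap) => [a|] //=.
have u0B : {in frs phi, forall y, u0 y < B}.
  by move=> y _; apply: ltn_trans n_lt_B; apply: u0n.
exists (wval B (frs phi) u0).
  rewrite mem_filter mem_iota add0n wval_lt // leq0n !andbT sem_qsat.
  have [bZ hZ] := values_base (wval B (frs phi) u0); have [bN _ _] := bZ.
  apply/andP; split.
    by apply/allP => y yf; rewrite bN /values setw_wval.
  rewrite (sem_tr LB bZ hZ (s := s)) // => y yF.
  have ys : y \in domf s by rewrite ds.
  exists s.[ys]%fmap; first exact: in_fnd.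
  rewrite /values setw_wval //; last exact: map_f.
  by rewrite /u0 /pv addKn in_fnd.
apply/fmapP => y; case: (boolP (y \in Fr phi)) => yF; last first.
  have ys : y \notin domf s by rewrite ds.
  by rewrite (not_fnd ys) not_fnd.
have ys : y \in domf s by rewrite ds.
rewrite fnd_assign // in_fnd /values setw_wval //; last exact: map_f.
by rewrite /u0 /pv addKn in_fnd inord_val.
Qed.

Lemma uniq_satisfying : uniq satisfying.
Proof.
rewrite map_inj_in_uniq ?filter_uniq ?iota_uniq // => Z Z'.
have [[bN _ _] _] := values_base Z; have [[bN' _ _] _] := values_base Z'.
rewrite !mem_filter !sem_qsat bN bN' !mem_iota !add0n.
move=> /andP[/andP[/allP h _] ZB] /andP[/andP[/allP h' _] ZB'] e.
rewrite -(@wval_setw B (frs phi) Z v) ?uniq_frs // -(@wval_setw B (frs phi) Z' v) ?uniq_frs //.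
apply: wval_ext => _ /mapP[y yF ->]; rewrite -/(values Z) -/(values Z').
have := congr1 (fun f : assignment 'I_n => f.[? y]%fmap) e.
rewrite !fnd_assign // => -[] /(congr1 val) /=.
by rewrite !inordK ?h ?h' ?map_f.
Qed.

Lemma size_satisfying :
  size satisfying = \sum_(Z < B ^ size (frs phi)) sem (qsat phi) (values Z).
Proof.
rewrite size_map size_filter.
have := count_envs B (frs phi) v (sem (qsat phi)); rewrite envsE count_map => <-.
by apply: eq_count.
Qed.

Lemma ybar_gt8 y : y \in ybar phi -> 8 < y.
Proof.
rewrite inE mem_cat => /orP[/eqP -> //|/orP[/(allP big_pbar)|/(allP big_zbar)]]; exact.
Qed.

Lemma sem_qcount : fits -> sem (qcount phi) v = (k <= size satisfying).
Proof.
move=> fit; rewrite sem_not sem_more -leqNgt.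
have un := uniq_ybar phi.
have uy : uniq (ybar phi) by move: un; rewrite cat_uniq => /and3P[].
rewrite (eq_count (sem_zeros L w B (frs phi) (qone phi))).
rewrite (eq_count (sem_zeros L w B (ybar phi) (qsat phi))).
rewrite (count_zeros_cat B_gt0) // setw0; last by move=> y /(allP big_frs) /v0.
rewrite count_qone // size_satisfying (count_envs_cat B_gt0) //; congr (_ <= _).
apply: eq_bigr => Z _; rewrite (count_zeros B_gt0) // setw0 // => y yy.
rewrite setw_notin ?v0 //; first exact: ybar_gt8.
by move: un; rewrite cat_uniq => /and3P[_ /hasPn /(_ _ yy)].
Qed.

Lemma sem_qbig_qcount : sem (qand (qbig phi) (qcount phi)) v <-> WT St phi k.
Proof.
rewrite (WT_iff _ uniq_satisfying satisfyingP) sem_and; split.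
  by case/andP=> /(sem_qbig gv) fit; rewrite sem_qcount.
move=> kN; have fit : fits.
  move=> i /andP[Ei bi]; apply: (@leq_ltn_trans k).
    rewrite leqNgt; apply/negP => /bit_small.
    by rewrite -nth_binary -(drop_encode St k).1 nth_drop subnKC // bi.
  apply: leq_ltn_trans kN _; rewrite size_satisfying.
  apply: (@leq_ltn_trans (B ^ size (frs phi))).
    apply: (@leq_trans (\sum_(Z < B ^ size (frs phi)) 1)).
      by apply: leq_sum => Z _; case: (sem _ _).
    by rewrite sum1_card card_ord.
  by rewrite ltn_exp2l //; have := n_lt_B; lia.
by apply/andP; split; [apply/sem_qbig|rewrite sem_qcount].
Qed.

End Body.

(** * The theorem *)

Lemma sem_qend L x B v : L < B -> sem L x B qend v <-> v vO <= L.
Proof.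
move=> LB; split=> [/sem_allP h|h].
  have := h L LB; rewrite sem_imp !sem_atom /= upd_same upd_other //.
  by case: leqP => //; rewrite ltnn.
apply/sem_allP => a aB; rewrite sem_imp !sem_atom /= upd_same upd_other //.
by apply/implyP => lt; apply: leq_trans h.
Qed.

Lemma sem_qprefix L x B v : L = size x -> L < B -> (forall y, v y < B) ->
  sem L x B qprefix v <->
  [/\ 0 < v vN, forall i, i < v vN -> nth false x i = false & nth false x (v vN)].
Proof.
move=> Lx LB vB; rewrite !sem_and sem_not sem_atom sem_in [atomv _ _ _]/= -lt0n; split.
  case/and3P=> h1 /andP[h2 h3] /sem_allP h4; split=> // i ilt.
  have iB : i < B by apply: ltn_trans (vB vN).
  have := h4 i iB; rewrite sem_imp sem_not sem_atom sem_in /= upd_same upd_other // ilt.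
  by rewrite (ltn_trans ilt h2) => /negbTE.
case=> h1 h2 h3; apply/and3P; split=> //.
  rewrite h3 andbT Lx ltnNge; apply/negP => le; by rewrite nth_default in h3.
apply/sem_allP => a aB; rewrite sem_imp sem_not sem_atom sem_in /= upd_same upd_other //.
by apply/implyP => /h2 ->; rewrite andbF.
Qed.

Lemma sem_qlast L x B v : L = size x -> L < B -> v vO <= L ->
  sem L x B qlast v <-> last true (drop (v vO) x).
Proof.
move=> Lx LB vL; rewrite sem_or sem_not sem_atom [atomv _ _ _]/=.
case: ltnP => lt; last by rewrite drop_oversize // -Lx.
have sd : size (drop (v vO) x) = L - v vO by rewrite size_drop Lx.
have lE : last true (drop (v vO) x) = nth false x L.-1.
  rewrite (last_nth false); case E : (drop (v vO) x) sd => [|b s] /=; first by lia.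
  move=> sd; rewrite -[nth _ _ _]/(nth false (b :: s) (size s)) -E nth_drop.
  by congr nth; lia.
rewrite lE orFb; split.
  case/sem_exP=> a aB; rewrite sem_and sem_in upd_same => /andP[/andP[aL xa] /sem_allP h].
  suff -> : L.-1 = a by [].
  apply/eqP; rewrite eqn_leq; apply/andP; split; last by lia.
  have l1 : L.-1 < B by lia.
  rewrite leqNgt; apply/negP => al.
  have := h _ l1; rewrite sem_imp sem_not !sem_atom /= upd_same upd_other // upd_same al /=.
  by lia.
move=> h; have l1 : L.-1 < B by lia.
apply/sem_exP; exists L.-1 => //; rewrite sem_and sem_in upd_same h andbT; apply/andP.
split; first by lia.
apply/sem_allP => a aB; rewrite sem_imp sem_not !sem_atom /= upd_same upd_other // upd_same.
by apply/implyP; lia.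
Qed.

Section Main.
Variables (tau : vocabulary) (phi : formula tau).

Lemma sem_qroot x : 0 < size x ->
  sem (size x) x (2 ^ size (binary (size x))) (qroot phi) (fun=> 0) <-> WT_language phi x.
Proof.
move=> x0; set L := size x; set B := 2 ^ _.
have LB : L < B by apply: ltn_size_binary.
have B1 : 1 < B by lia.
have B0 : 0 < B by lia.
pose env n := runp (startprog (arities tau)) (upd (upd (fun=> 0) vN n) vOne 1).
have env_base n : base n (upd (upd (fun=> 0) vN n) vOne 1) by [].
have envO n : 0 < n -> env n vO = n.+1 + sumpow n (arities tau).
  by move=> n0; have [] := @run_start B n n0 (arities tau) _ (env_base n).
have env_ok n : 0 < n -> n.+1 + sumpow n (arities tau) < B ->
    okp B (startprog (arities tau)) (upd (upd (fun=> 0) vN n) vOne 1).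
  by move=> n0 h; have [_] := @run_start B n n0 (arities tau) _ (env_base n); apply.
have dst : all (mem dests) [seq i.1.1.1 | i <- startprog (arities tau)] by rewrite /= dests_off.
have env0 n y : 8 < y -> env n y = 0.
  move=> y8; rewrite /env runp_notin; first by rewrite !upd_other //; rewrite /vN /vOne; lia.
  rewrite inE negb_or; apply/andP; split; first by rewrite /vQ; lia.
  apply/negP => h; have := allP dst _ h; rewrite !inE /vQ /vP /vO /vA; lia.
have env_bs n : base n (env n) by apply: base_runp.
have key n : n < B -> sem L x B (qand qprefix (qex vOne (qand (QAtm (AOne vOne))
    (qprog (startprog (arities tau)) (qbody phi))))) (upd (fun=> 0) vN n) <->
   [/\ 0 < n, forall i, i < n -> nth false x i = false, nth false x n,
     okp B (startprog (arities tau)) (upd (upd (fun=> 0) vN n) vOne 1) &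
     sem L x B (qbody phi) (env n)].
  move=> nB; have uB : forall y, upd (fun=> 0) vN n y < B by apply: upd_lt.
  have uB' : forall y, upd (upd (fun=> 0) vN n) vOne 1 y < B by apply: upd_lt.
  rewrite sem_and; split.
    case/andP=> /(sem_qprefix erefl LB uB) [h1 h2 h3] /sem_exP[a aB].
    rewrite sem_and => /andP[/eqP]; rewrite upd_same => ->.
    rewrite sem_prog //; last by rewrite /= oki_off.
    by case/andP.
  case=> h1 h2 h3 h4 h5; apply/andP; split; first by apply/sem_qprefix.
  apply/sem_exP; exists 1 => //; rewrite sem_and sem_prog //; last by rewrite /= oki_off.
  by rewrite h4.
split.
  case/sem_exP=> n nB /(key _ nB) [n0 h0 h1 okn].
  case: n n0 nB h0 h1 okn => // m n0 nB h0 h1 okn.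
  rewrite /qbody !sem_and => /and3P[/(sem_qend _ _ LB) le hl hc].
  have eO := envO m.+1 n0.
  move/(sem_qlast erefl LB le): hl; rewrite eO in le * => hl.
  have xE := encode_structure_of le h0 h1 hl.
  set S := structure_of tau m x in xE; set k := val2 _ in xE.
  exists m, S, k; split=> //.
  have ge : good_env S k (env m.+1).
    rewrite /good_env -xE; split => //.
    by apply: runp_lt => //; do 2 apply: upd_lt => //.
  apply/(sem_qbig_qcount phi ge (env0 _)).
  by rewrite -xE sem_and.
case=> m [S [k [xE wt]]].
have [dE sE] := drop_encode S k; rewrite -xE in dE sE.
have n0 : 0 < m.+1 by [].
have EL : m.+2 + sumpow m.+1 (arities tau) <= L by rewrite /L sE leq_addr.
have EB := leq_ltn_trans EL LB.
have okn := env_ok _ n0 EB.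
have mB : m.+1 < B by apply: leq_ltn_trans EB; rewrite addSn ltnW // ltnS leq_addr.
have ge : good_env S k (env m.+1).
  rewrite /good_env -xE; split => //; first exact: envO.
  by apply: runp_lt => //; apply: upd_lt => //; apply: upd_lt.
apply/sem_exP; exists m.+1; first exact: mB.
apply/(key _ mB); split => //.
- by move=> i im; rewrite xE nth_cat size_nseq im nth_nseq im.
- by rewrite xE nth_cat size_nseq ltnn subnn.
have eO := envO m.+1 n0.
have le : env m.+1 vO <= L by rewrite eO.
rewrite /qbody sem_and sem_and; apply/and3P; split; first by apply/sem_qend.
  by apply/(sem_qlast erefl LB le); rewrite eO dE last_binary.
by have := (sem_qbig_qcount phi ge (env0 _)).2 wt; rewrite -xE.
Qed.

End Main.

Theorem theorem9 (tau : vocabulary) (phi : formula tau) :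
  DLOGTIME_uniform_TC0 (WT_language phi).
Proof.
have nv : 0 < nvars phi by rewrite /nvars /fresh.
have [C [h1 h2 h3 h4 h5]] := fom_TC0 (okfom_root phi) isT nv.
exists C; split => // x; rewrite h5; split=> [[x0 /(sem_qroot phi x0)] //|wt].
have x0 : 0 < size x by case: wt => m [S [k [-> _]]].
by split => //; apply/sem_qroot.
Qed.
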